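(* Let $C$ be a hyperelliptic curve defined over $\mathbb{Q}$ of genus $g\in\{2,3\}$ with Jacobian $J$. If $J(\mathbb{Q})$ is trivial, then $C(K)=C(\mathbb{Q})$ for all primitive quartic number fields $K$. However, there are infinitely many imprimitive quartic number fields $K$ such that $C(K)\neq C(\mathbb{Q})$.
   Context: A curve over a field $K$ is a smooth projective geometrically irreducible variety of dimension $1$ over $K$. A curve $C$ over $K$ is hyperelliptic if its genus is at least $2$ and it admits a degree $2$ morphism $C\to\mathbb{P}^1$ defined over $K$. A number field $K$ is primitive if the only subfields of $K$ are $\mathbb{Q}$ and $K$; otherwise (i.e. if there is a field $L$ with $\mathbb{Q}\subsetneq L\subsetneq K$) it is imprimitive. *)

(* Defs.v *)
From HB Require Import structures.
From mathcomp Require Import all_boot all_order all_algebra all_field.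
From mathcomp Require Import freeg mpoly.

Set Implicit Arguments.
Unset Strict Implicit.
Unset Printing Implicit Defensive.

Import GRing.Theory Num.Theory.
Local Open Scope ring_scope.

(* A point of P^n(F) is represented by its unique coordinate vector whose
   first nonzero entry is 1. *)
Definition normalized (F : fieldType) (n : nat) (v : 'rV[F]_n.+1) : bool :=
  [exists i, (v 0 i == 1) && [forall j : 'I_n.+1, (j < i)%N ==> (v 0 j == 0)]].

Record ppoint (F : fieldType) (n : nat) : Type := PPoint {
  pcoord : 'rV[F]_n.+1;
  pcoord_normalized : normalized pcoord
}.

HB.instance Definition _ (F : fieldType) (n : nat) :=
  [isSub for @pcoord F n].
HB.instance Definition _ (F : fieldType) (n : nat) :=
  [Choice of ppoint F n by <:].

Lemma map_normalized (F L : fieldType) (f : {rmorphism F -> L}) (n : nat)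
  (P : ppoint F n) : normalized (map_mx f (pcoord P)).
Proof.
case: P => v /= /existsP[i /andP[/eqP vi /forallP v0]].
apply/existsP; exists i; rewrite mxE vi rmorph1 eqxx /=.
apply/forallP => j; apply/implyP => ji.
by rewrite mxE (eqP (implyP (v0 j) ji)) rmorph0.
Qed.

Definition map_ppoint (F L : fieldType) (f : {rmorphism F -> L}) (n : nat)
  (P : ppoint F n) : ppoint L n := PPoint (map_normalized f P).

(* For homogeneous
   A and B of the same degree, evalp f A P / evalp f B P does not depend on the
   choice of coordinates, nor does the vanishing of evalp f A P. *)
Definition evalp (k F : fieldType) (f : {rmorphism k -> F}) (n : nat)
  (A : {mpoly k[n.+1]}) (P : ppoint F n) : F :=
  (map_mpoly f A).@[pcoord P 0].

Definition homogeneous (k : fieldType) (n : nat) (A : {mpoly k[n.+1]}) : Prop :=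
  exists d : nat, A \is d.-homog.

Section ZariskiTopology.
Variable n : nat.
Implicit Types X Y Z : ppoint algC n -> Prop.

Definition subset_of X Y : Prop := forall P, X P -> Y P.

Definition zclosed Z : Prop :=
  exists S : {mpoly algC[n.+1]} -> Prop,
    (forall A, S A -> homogeneous A) /\
    (forall P, Z P <-> forall A, S A -> evalp idfun A P = 0).

Definition irreducible X : Prop :=
  (exists P, X P) /\
  forall Y Z, zclosed Y -> zclosed Z ->
    (forall P, X P -> Y P \/ Z P) -> subset_of X Y \/ subset_of X Z.

Definition has_chain X (d : nat) : Prop :=
  exists Z : nat -> ppoint algC n -> Prop,
    (forall i, (i <= d)%N -> [/\ zclosed (Z i), irreducible (Z i) & subset_of (Z i) X]) /\
    (forall i, (i < d)%N ->
       subset_of (Z i) (Z i.+1) /\ ~ subset_of (Z i.+1) (Z i)).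

Definition krull_dim X (d : nat) : Prop := has_chain X d /\ ~ has_chain X d.+1.

End ZariskiTopology.

Record proj_scheme : Type := ProjScheme {
  pdim : nat;
  peqs : seq {mpoly rat[pdim.+1]};
  peqs_homogeneous : forall A, A \in peqs -> homogeneous A
}.

Definition on_scheme (C : proj_scheme) (F : fieldType) (f : {rmorphism rat -> F})
  (P : ppoint F (pdim C)) : Prop :=
  forall A, A \in peqs C -> evalp f A P = 0.

Definition geom_points (C : proj_scheme) : ppoint algC (pdim C) -> Prop :=
  on_scheme (ratr : {rmorphism rat -> algC}).
Arguments geom_points : clear implicits.

Definition jacobian_matrix (C : proj_scheme) (P : ppoint algC (pdim C)) :
  'M[algC]_(size (peqs C), (pdim C).+1) :=
  \matrix_(i, j) evalp (ratr : {rmorphism rat -> algC}) ((peqs C)`_i)^`M(j) P.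
Arguments jacobian_matrix : clear implicits.

(* Jacobian criterion. The rank is that of the given equations, not of
   generators of the radical ideal, so it forces the scheme to be reduced. *)
Definition smooth_of_dim (C : proj_scheme) (d : nat) : Prop :=
  forall P, geom_points C P -> (\rank (jacobian_matrix C P) + d)%N = pdim C.

Definition is_curve (C : proj_scheme) : Prop :=
  [/\ irreducible (geom_points C), krull_dim (geom_points C) 1
    & smooth_of_dim C 1].

Definition same_points (C : proj_scheme) (K : fieldExtType rat) : Prop :=
  forall P : ppoint K (pdim C), on_scheme (in_alg K) P ->
    exists2 Q : ppoint rat (pdim C), on_scheme idfun Q & P = map_ppoint (in_alg K) Q.

(* The function field k(C) of the base change of C to a field k embedded in algC
   by j, presented by the generic point: a form over k vanishes at ff_gen iff it
   vanishes on C, and the elements of k(C) are the quotients A / B of forms of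
   the same degree with B not identically zero on C. This determines (ff_sort,
   ff_const, ff_gen) up to a unique isomorphism. *)
Record function_field (k : fieldType) (j : {rmorphism k -> algC})
  (C : proj_scheme) : Type := FunctionField {
  ff_sort : fieldType;
  ff_const : {rmorphism k -> ff_sort};
  ff_gen : ppoint ff_sort (pdim C);
  ff_vanish : forall (d : nat) (A : {mpoly k[(pdim C).+1]}), A \is d.-homog ->
    (evalp ff_const A ff_gen = 0 <-> forall P, geom_points C P -> evalp j A P = 0);
  ff_quotient : forall f : ff_sort,
    exists (d : nat) (A B : {mpoly k[(pdim C).+1]}),
      [/\ A \is d.-homog, B \is d.-homog, evalp ff_const B ff_gen != 0
        & f = evalp ff_const A ff_gen / evalp ff_const B ff_gen]
}.

Definition geom_function_field (C : proj_scheme) : Type :=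
  function_field (idfun : {rmorphism algC -> algC}) C.

Definition rat_function_field (C : proj_scheme) : Type :=
  function_field (ratr : {rmorphism rat -> algC}) C.

(* S is meant to be a subfield of F and V an S-subspace. *)
Definition dim_over (F : fieldType) (S V : F -> Prop) (l : nat) : Prop :=
  exists b : 'I_l -> F,
    (forall f, V f <-> exists c : 'I_l -> F,
       (forall i, S (c i)) /\ f = \sum_i c i * b i) /\
    (forall c : 'I_l -> F, (forall i, S (c i)) ->
       \sum_i c i * b i = 0 -> forall i, c i = 0).

(* The subfield k(x) of F. *)
Definition simple_ext (k F : fieldType) (f : {rmorphism k -> F}) (x : F) :
  F -> Prop :=
  fun z => exists p q : {poly k},
    (map_poly f q).[x] != 0 /\ z = (map_poly f p).[x] / (map_poly f q).[x].

(* phi is [A : B] wherever A and B do not both vanish (the equation is vacuous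
   where they do). *)
Definition represents (C : proj_scheme)
  (phi : ppoint algC (pdim C) -> ppoint algC 1)
  (A B : {mpoly rat[(pdim C).+1]}) : Prop :=
  (exists2 d : nat, A \is d.-homog & B \is d.-homog) /\
  forall P, geom_points C P ->
    evalp (ratr : {rmorphism rat -> algC}) A P * pcoord (phi P) 0 1 =
    evalp (ratr : {rmorphism rat -> algC}) B P * pcoord (phi P) 0 0.

Definition is_morphism (C : proj_scheme)
  (phi : ppoint algC (pdim C) -> ppoint algC 1) : Prop :=
  forall P, geom_points C P -> exists A B, represents phi A B /\
    (evalp (ratr : {rmorphism rat -> algC}) A P != 0 \/
     evalp (ratr : {rmorphism rat -> algC}) B P != 0).

(* [Q(C) : Q(x)] = m, where x = A / B is the pullback by phi of the coordinate
   function on P^1. *)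
Definition morphism_degree (C : proj_scheme)
  (phi : ppoint algC (pdim C) -> ppoint algC 1) (m : nat) : Prop :=
  exists (F : rat_function_field C) (A B : {mpoly rat[(pdim C).+1]}),
    [/\ represents phi A B, evalp (ff_const F) B (ff_gen F) != 0
      & dim_over (simple_ext (ff_const F)
                   (evalp (ff_const F) A (ff_gen F) /
                    evalp (ff_const F) B (ff_gen F)))
                 (fun _ => True) m].

Section Orders.
Variables (C : proj_scheme) (F : geom_function_field C).
Implicit Types (P : ppoint algC (pdim C)) (f t u : ff_sort F).

Definition local_ring P f : Prop :=
  exists (d : nat) (A B : {mpoly algC[(pdim C).+1]}),
    [/\ A \is d.-homog, B \is d.-homog, evalp idfun B P != 0
      & f = evalp (ff_const F) A (ff_gen F) / evalp (ff_const F) B (ff_gen F)].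

Definition maximal_ideal P f : Prop :=
  exists (d : nat) (A B : {mpoly algC[(pdim C).+1]}),
    [/\ A \is d.-homog, B \is d.-homog,
        evalp idfun A P = 0, evalp idfun B P != 0
      & f = evalp (ff_const F) A (ff_gen F) / evalp (ff_const F) B (ff_gen F)].

Definition uniformizer P t : Prop :=
  maximal_ideal P t /\
  forall f, maximal_ideal P f -> exists2 g, local_ring P g & f = g * t.

Definition ord P f (m : int) : Prop :=
  exists t u, [/\ uniformizer P t, u != 0, local_ring P u, local_ring P u^-1
                & f = u * t ^ m].

Definition constants f : Prop := exists c : algC, f = ff_const F c.

Definition riemann_roch_space (D : {freeg (ppoint algC (pdim C)) / int}) f : Prop :=
  f = 0 \/
  forall P, geom_points C P -> exists2 m : int, ord P f m & - coeff P D <= m.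

End Orders.

Definition is_divisor (C : proj_scheme)
  (D : {freeg (ppoint algC (pdim C)) / int}) : Prop :=
  forall P, P \in dom D -> geom_points C P.

Definition principal (C : proj_scheme)
  (D : {freeg (ppoint algC (pdim C)) / int}) : Prop :=
  exists (F : geom_function_field C) (f : ff_sort F),
    f != 0 /\ forall P, geom_points C P -> ord P f (coeff P D).

(* The genus as in Riemann's theorem: the maximum of deg D + 1 - l(D) over all
   divisors D. *)
Definition genus (C : proj_scheme) (g : nat) : Prop :=
  exists F : geom_function_field C,
    (exists (D : {freeg (ppoint algC (pdim C)) / int}) (l : nat),
       [/\ is_divisor D,
           dim_over (@constants C F) (@riemann_roch_space C F D) l
         & deg D + 1 - l%:Z = g%:Z]) /\
    (forall (D : {freeg (ppoint algC (pdim C)) / int}) (l : nat),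
       is_divisor D ->
       dim_over (@constants C F) (@riemann_roch_space C F D) l ->
       deg D + 1 - l%:Z <= g%:Z).

Definition hyperelliptic (C : proj_scheme) : Prop :=
  [/\ is_curve C,
      exists2 g : nat, genus C g & (2 <= g)%N
    & exists phi : ppoint algC (pdim C) -> ppoint algC 1,
        is_morphism phi /\ morphism_degree phi 2].

(* The Galois group of algC over Q consists of all its ring endomorphisms. *)
Definition galois_div (C : proj_scheme) (s : {rmorphism algC -> algC})
  (D : {freeg (ppoint algC (pdim C)) / int}) :
  {freeg (ppoint algC (pdim C)) / int} :=
  \sum_(P <- dom D) << coeff P D *g map_ppoint s P >>.

(* J represents the sheafified degree 0 Picard functor, so J(Q) is the group of
   Galois-invariant elements of Pic^0 of C over algC. Such a class need not
   contain a Galois-invariant divisor when C has no rational point. *)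
Definition jacobian_rat_point (C : proj_scheme)
  (D : {freeg (ppoint algC (pdim C)) / int}) : Prop :=
  [/\ is_divisor D, deg D = 0
    & forall s : {rmorphism algC -> algC}, principal (galois_div s D - D)].

Definition jacobian_rat_trivial (C : proj_scheme) : Prop :=
  forall D : {freeg (ppoint algC (pdim C)) / int},
    jacobian_rat_point D -> principal D.

Definition primitive_field (K : fieldExtType rat) : Prop :=
  forall L : {subfield K}, (L = 1 :> {vspace K})%VS \/ (L = fullv :> {vspace K})%VS.

Definition imprimitive_field (K : fieldExtType rat) : Prop :=
  exists L : {subfield K}, (L <> 1 :> {vspace K})%VS /\ (L <> fullv :> {vspace K})%VS.

Definition isomorphic_fields (K L : fieldType) : Prop :=
  exists f : {rmorphism K -> L}, bijective f.

(* Main.v *)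
(* Let x be the hyperelliptic function, c a general rational number, P1 and P2 the
   two points above x = c, and u = 1 / (x - c). The key point is that a function f
   whose poles are bounded by 2 (P1 + P2) is a polynomial in u of degree at most 2:
   otherwise L(n (P1 + P2)) would contain the 2n independent functions u^i, i <= n,
   and f u^j, j <= n - 2, for all large n, whence genus at most 1.

   Let P be a non-rational point over a primitive quartic field K, so that its four
   conjugates are distinct. Their sum minus 2 (P1 + P2) is a rational class of
   degree 0, hence the divisor of some f = p(u) with deg p <= 2. So u takes at most
   two values on the conjugates; by primitivity u(P) is then rational, and four
   points would lie in one fibre of a map of degree 2.

   If P1 and P2 were rational, P1 - P2 would be the divisor of a polynomial in u,
   which has the same order at P1 and at P2. So they are defined over a quadratic
   field Q(eps) only, and the fields Q(eps, sqrt p), for suitable primes p, are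
   infinitely many imprimitive quartic fields with a new point.

   Local rings at smooth points are discrete valuation rings by Taylor expansion and
   Nakayama's lemma; a fibre of u has degree at most [F : k(u)] = 2 by weak
   approximation. *)

Require Import Defs.
From HB Require Import structures.
From mathcomp Require Import all_boot all_order all_algebra all_field.
From mathcomp Require Import freeg mpoly.
From Stdlib Require Import Classical ClassicalEpsilon.
From mathcomp Require Import zify ring.

Set Implicit Arguments.
Unset Strict Implicit.
Unset Printing Implicit Defensive.

(** * Homogeneous forms and comparison of function fields *)

(** The curve is an arbitrary smooth projective scheme, not an equation y^2 = f(x), so the two
    points above x = c have to be constructed. The coordinates of the generic point over Q are
    written as (p_i(x) + q_i(x) y) / d(x) with y^2 = f(x), and x := c, y := eps with eps^2 = delta =
    f(c) is substituted. The same formula gives P1 and P2 over [algC] (for eps and - eps) and the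
    new point over any field containing a square root of delta. Neither Riemann-Roch nor the
    vanishing of the degree of a principal divisor is used. [genus] only provides some divisor D
    with deg D + 1 - l(D) >= 2, unrelated to P1 + P2; the inequality is carried to n (P1 + P2)
    because deg - l does not decrease when an effective divisor is added. The degree of the
    hyperelliptic map is measured in Q(C), orders and divisors live over [algC], and [genus] and
    [principal] each bring their own presentation of the geometric function field. Comparison maps
    between presentations reconcile them, and the degree 2 survives over [algC] in the weak form
    that any three functions are linearly dependent over algC(u). *)

Section Evaluation.
Import GRing.Theory Num.Theory.
Local Open Scope ring_scope.
Variables (k F : fieldType) (f : {rmorphism k -> F}) (n : nat).
Implicit Types (A B : {mpoly k[n.+1]}) (P : ppoint F n).

Lemma evalpD A B P : evalp f (A + B) P = evalp f A P + evalp f B P.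
Proof. by rewrite /evalp !rmorphD. Qed.

Lemma evalpN A P : evalp f (- A) P = - evalp f A P.
Proof. by rewrite /evalp !rmorphN. Qed.

Lemma evalpB A B P : evalp f (A - B) P = evalp f A P - evalp f B P.
Proof. by rewrite evalpD evalpN. Qed.

Lemma evalpM A B P : evalp f (A * B) P = evalp f A P * evalp f B P.
Proof. by rewrite /evalp !rmorphM. Qed.

Lemma evalpC c P : evalp f c%:MP P = f c.
Proof. by rewrite /evalp map_mpolyC mevalC. Qed.

Lemma evalp0 P : evalp f 0 P = 0.
Proof. by rewrite /evalp !rmorph0. Qed.

Lemma evalp1 P : evalp f 1 P = 1.
Proof. by rewrite /evalp !rmorph1. Qed.

Lemma evalpU i P : evalp f 'X_i P = pcoord P 0 i.
Proof. by rewrite /evalp map_mpolyX mevalXU. Qed.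

Lemma evalpXn A e P : evalp f (A ^+ e) P = evalp f A P ^+ e.
Proof. by rewrite /evalp !rmorphXn. Qed.

Lemma evalp_sum (I : Type) (r : seq I) (p : pred I) (G : I -> {mpoly k[n.+1]}) P :
  evalp f (\sum_(i <- r | p i) G i) P = \sum_(i <- r | p i) evalp f (G i) P.
Proof.
exact: (big_morph (fun A => evalp f A P) (fun A B => evalpD A B P) (evalp0 P)).
Qed.

Lemma meval_homog (R : comNzRingType) (A : {mpoly R[n.+1]}) d (a : R) v :
  A \is d.-homog -> A.@[fun i => a * v i] = a ^+ d * A.@[v].
Proof.
move=> /dhomogP hA; rewrite !mevalE mulr_sumr; apply: eq_big_seq => m mA.
rewrite mulrCA; congr (_ * _).
transitivity (\prod_(i < n.+1) (a ^+ m i * v i ^+ m i)).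
  by apply: eq_bigr => i _; rewrite exprMn.
rewrite big_split /=; congr (_ * _).
by rewrite prodrXr -mdegE (hA m mA).
Qed.

Lemma map_mpoly_homog A d : A \is d.-homog -> map_mpoly f A \is d.-homog.
Proof.
move=> /dhomogP hA; apply/dhomogP => m.
by rewrite mcoeff_msupp mcoeff_map_mpoly fmorph_eq0 -mcoeff_msupp; apply: hA.
Qed.

Lemma homogX1 (i : 'I_n.+1) : ('X_i : {mpoly k[n.+1]}) \is 1.-homog.
Proof. by rewrite dhomogX; apply/eqP/mdeg1. Qed.

Lemma homogC (c : k) : (c%:MP : {mpoly k[n.+1]}) \is 0.-homog.
Proof. by rewrite -[c]mulr1 mpolyCM mul_mpolyC dhomogZ // dhomog1. Qed.

Lemma homogZ d (c : k) A : A \is d.-homog -> c%:MP * A \is d.-homog.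
Proof. by rewrite mul_mpolyC => /dhomogZ. Qed.

Lemma homogM d e A B : A \is d.-homog -> B \is e.-homog -> A * B \is (d + e).-homog.
Proof. exact: dhomogM. Qed.

Lemma homogCross d e A B A' B' : A \is d.-homog -> B \is d.-homog ->
  A' \is e.-homog -> B' \is e.-homog -> A * B' - A' * B \is (d + e).-homog.
Proof.
move=> hA hB hA' hB'; apply: dhomogD; first exact: homogM.
by rewrite dhomogN addnC; apply: homogM.
Qed.

Lemma homogXn (i : 'I_n.+1) d : ('X_i ^+ d : {mpoly k[n.+1]}) \is d.-homog.
Proof. by have := dhomogMn d (homogX1 i); rewrite mul1n. Qed.

End Evaluation.

Section EvalMap.
Import GRing.Theory Num.Theory.
Local Open Scope ring_scope.

Lemma evalp_map (k F L : fieldType) (f : {rmorphism k -> F}) (s : {rmorphism F -> L})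
  (h : {rmorphism k -> L}) n (A : {mpoly k[n.+1]}) (P : ppoint F n) :
  (forall a, h a = s (f a)) ->
  evalp h A (map_ppoint s P) = s (evalp f A P).
Proof.
move=> hE; elim/mpolyind: A => [|c m p _ _ IH]; first by rewrite !evalp0 rmorph0.
rewrite !evalpD rmorphD IH; congr (_ + _).
rewrite -mul_mpolyC !evalpM !evalpC rmorphM hE; congr (_ * _).
rewrite /evalp !map_mpolyX !mevalX rmorph_prod; apply: eq_bigr => i _.
by rewrite rmorphXn mxE.
Qed.

Lemma evalp_map_mpoly (k1 k2 F : fieldType) (i : {rmorphism k1 -> k2})
  (f : {rmorphism k2 -> F}) (h : {rmorphism k1 -> F}) n (A : {mpoly k1[n.+1]})
  (P : ppoint F n) : (forall a, h a = f (i a)) ->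
  evalp f (map_mpoly i A) P = evalp h A P.
Proof.
move=> hE; elim/mpolyind: A => [|c m p _ _ IH]; first by rewrite rmorph0 !evalp0.
rewrite rmorphD !evalpD IH; congr (_ + _).
rewrite -!mul_mpolyC rmorphM !evalpM /= map_mpolyC !evalpC hE; congr (_ * _).
by rewrite /evalp !map_mpolyX.
Qed.

Lemma ppoint_nz (F : fieldType) n (P : ppoint F n) :
  exists i, pcoord P 0 i = 1.
Proof. by case: P => v /= /existsP[i /andP[/eqP vi _]]; exists i. Qed.

(** Vanishing minors make the coordinate vectors proportional; their first nonzero entries then have
    the same index, and both are 1 there. *)
Lemma ppoint_sep (F : fieldType) n (P Q : ppoint F n) :
  (forall i j, pcoord P 0 i * pcoord Q 0 j = pcoord P 0 j * pcoord Q 0 i) -> P = Q.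
Proof.
case: P Q => [v nv] [w nw] /= h; apply: val_inj => /=.
case/existsP: (nv) => i /andP[/eqP vi /forallP v0].
case/existsP: (nw) => j /andP[/eqP wj /forallP w0].
have ij : i = j.
  apply: val_inj; case: (ltngtP i j) => // hij.
    have /eqP wi := implyP (w0 i) hij.
    by have := h i j; rewrite vi wj wi mulr0 mulr1 => /eqP; rewrite oner_eq0.
  have /eqP vj := implyP (v0 j) hij.
  by have := h i j; rewrite vi wj vj mul0r mulr1 => /eqP; rewrite oner_eq0.
apply/rowP => l; have := h i l; rewrite vi ij wj mulr1 mul1r.
by move=> ->.
Qed.

End EvalMap.

Section FieldQuotients.
Import GRing.Theory.
Local Open Scope ring_scope.
Variable F : fieldType.
Implicit Types a b : F.

Lemma cross_div a b a' b' : b != 0 -> b' != 0 -> a * b' = a' * b -> a / b = a' / b'.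
Proof. by move=> nb nb' e; apply/eqP; rewrite eqr_div // e. Qed.

Lemma div_cross a b a' b' : b != 0 -> b' != 0 -> a / b = a' / b' -> a * b' = a' * b.
Proof. by move=> nb nb' /eqP; rewrite eqr_div // => /eqP. Qed.

Lemma cross_solve a b a' b' : b != 0 -> a * b' = a' * b -> a' = a / b * b'.
Proof. by move=> nb e; rewrite mulrAC e mulfK. Qed.

Lemma sub_div a b a' b' : b != 0 -> b' != 0 ->
  a / b - a' / b' = (a * b' - a' * b) / (b * b').
Proof. by move=> nb nb'; rewrite -mulNr addf_div // mulNr. Qed.

Lemma add_div a b a' b' : b != 0 -> b' != 0 ->
  a / b + a' / b' = (a * b' + a' * b) / (b * b').
Proof. exact: addf_div. Qed.

End FieldQuotients.

(* The map A/B |-> A/B between two function fields of C whose constant fields are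
   nested; it is the comparison of Q(C) with the geometric function field, and of
   two presentations of the latter. *)
Section Comparison.
Import GRing.Theory Num.Theory.
Local Open Scope ring_scope.
Variables (C : proj_scheme) (k1 k2 : fieldType).
Variables (j1 : {rmorphism k1 -> algC}) (j2 : {rmorphism k2 -> algC}).
Variable i : {rmorphism k1 -> k2}.
Hypothesis ji : forall a, j1 a = j2 (i a).
Variables (E1 : function_field j1 C) (E2 : function_field j2 C).
Local Notation n := (pdim C).
Local Notation F1 := (ff_sort E1).
Local Notation F2 := (ff_sort E2).
Local Notation ev1 A := (evalp (ff_const E1) A (ff_gen E1)).
Local Notation ev2 A := (evalp (ff_const E2) (map_mpoly i A) (ff_gen E2)).

(** Both sides say that the form vanishes at all geometric points of [C], which does not involve the
    presentation. *)
Lemma ff_compare_eq0 d (A : {mpoly k1[n.+1]}) : A \is d.-homog ->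
  ev1 A = 0 <-> ev2 A = 0.
Proof.
move=> hA; rewrite (ff_vanish E1 hA) (ff_vanish E2 (map_mpoly_homog i hA)).
by split=> h P hP; have := h P hP; rewrite (evalp_map_mpoly _ _ ji).
Qed.

(** An element has many presentations A / B, so the map starts as a relation. It is single-valued
    because A B' - A' B is again a form, whose vanishing passes from one field to the other. *)
Let cmp_rel (z : F1) (w : F2) := exists d (A B : {mpoly k1[n.+1]}),
  [/\ A \is d.-homog, B \is d.-homog, ev1 B != 0, z = ev1 A / ev1 B & w = ev2 A / ev2 B].

Let nz d (B : {mpoly k1[n.+1]}) : B \is d.-homog -> ev1 B != 0 -> ev2 B != 0.
Proof. by move=> hB; apply: contra_neq; move/(ff_compare_eq0 hB). Qed.

Let cmp_fun z w w' : cmp_rel z w -> cmp_rel z w' -> w = w'.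
Proof.
case=> d [A [B [hA hB nB -> ->]]] [e [A' [B' [hA' hB' nB' hz ->]]]].
have hAB : A * B' - A' * B \is (d + e).-homog.
  exact: homogCross.
have : ev1 (A * B' - A' * B) = 0.
  by rewrite evalpB !evalpM (div_cross nB nB' hz) subrr.
move/(ff_compare_eq0 hAB); rewrite rmorphB !rmorphM evalpB !evalpM => e2.
apply: cross_div; [exact: nz hB nB|exact: nz hB' nB'|exact: subr0_eq].
Qed.

Let cmp_ex z : exists w, cmp_rel z w.
Proof.
have [d [A [B [hA hB nB ->]]]] := ff_quotient z.
by exists (ev2 A / ev2 B), d, A, B.
Qed.

Let cmp (z : F1) : F2 := proj1_sig (constructive_indefinite_description _ (cmp_ex z)).

Let cmpP z : cmp_rel z (cmp z).
Proof. by rewrite /cmp; case: constructive_indefinite_description. Qed.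

Let cmp_is_additive : additive cmp.
Proof.
move=> x y; apply: cmp_fun (cmpP _) _.
move: (cmpP x) (cmpP y); move: (cmp x) (cmp y) => w w'.
case=> d [A [B [hA hB nB -> ->]]] [e [A' [B' [hA' hB' nB' -> ->]]]].
exists (d + e)%N, (A * B' - A' * B), (B * B').
have nB2 := nz hB nB; have nB2' := nz hB' nB'.
split; [exact: homogCross|exact: homogM|by rewrite evalpM mulf_neq0| |].
- by rewrite evalpB !evalpM; apply: sub_div.
- by rewrite rmorphB !rmorphM evalpB !evalpM; apply: sub_div.
Qed.

Let cmp_is_multiplicative : multiplicative cmp.
Proof.
split=> [x y|]; last first.
  apply: cmp_fun (cmpP _) _; exists 0%N, 1, 1.
  by rewrite dhomog1 !rmorph1 !evalp1 !divr1 oner_neq0.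
apply: cmp_fun (cmpP _) _.
move: (cmpP x) (cmpP y); move: (cmp x) (cmp y) => w w'.
case=> d [A [B [hA hB nB -> ->]]] [e [A' [B' [hA' hB' nB' -> ->]]]].
exists (d + e)%N, (A * A'), (B * B').
split; [exact: homogM|exact: homogM|by rewrite evalpM mulf_neq0| |].
- by rewrite !evalpM mulf_div.
- by rewrite !rmorphM !evalpM mulf_div.
Qed.

Lemma ff_compare : exists h : {rmorphism F1 -> F2}, forall d (A B : {mpoly k1[n.+1]}),
  A \is d.-homog -> B \is d.-homog -> ev1 B != 0 ->
  h (ev1 A / ev1 B) = ev2 A / ev2 B.
Proof.
pose aM := GRing.isAdditive.Build _ _ cmp cmp_is_additive.
pose mM := GRing.isMultiplicative.Build _ _ cmp cmp_is_multiplicative.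
pose h : {rmorphism F1 -> F2} := HB.pack cmp aM mM.
exists h => d A B hA hB nB; apply: cmp_fun (cmpP _) _.
by exists d, A, B.
Qed.

End Comparison.

(** * The local ring of a smooth point *)

Section MPolyDeriv.
Import GRing.Theory Num.Theory.
Local Open Scope ring_scope.

Lemma mderiv_map (k F : fieldType) (f : {rmorphism k -> F}) n (A : {mpoly k[n]}) i :
  (map_mpoly f A)^`M(i) = map_mpoly f A^`M(i).
Proof.
by apply/mpolyP => m; rewrite mcoeff_mderiv !mcoeff_map_mpoly mcoeff_mderiv raddfMn.
Qed.

(** Euler's identity. It puts the coordinate vector of a point of the curve into the kernel of the
    Jacobian matrix. *)
Lemma euler_mderiv (k : fieldType) n (A : {mpoly k[n]}) d : A \is d.-homog ->
  \sum_i 'X_i * A^`M(i) = A *+ d.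
Proof.
move=> /dhomogP hA; transitivity (\sum_(m <- msupp A) A@_m *: 'X_[m] *+ d); last first.
  by rewrite sumrMnl -mpolyE.
rewrite {1}[A]mpolyE; under eq_bigr => i _.
  rewrite raddf_sum mulr_sumr; under eq_bigr => m _ do rewrite /= mderivZ mderivX -scalerAr -scalerAr.
  over.
rewrite exchange_big /=; apply: eq_big_seq => m mA.
rewrite -scaler_sumr scalerMnr; congr (_ *: _).
transitivity (\sum_(i < n) ('X_[m] : {mpoly k[n]}) *+ m i); last first.
  by rewrite sumrMnr -(hA m mA) /= mdegE.
apply: eq_bigr => i _; rewrite scaler_nat; case: (posnP (m i)) => [->|mi].
  by rewrite !mulr0n.
congr (_ *+ _); rewrite -mpolyXD; congr 'X_[_].
by rewrite addmC submK // lep1mP -lt0n.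
Qed.

End MPolyDeriv.

Section FirstOrder.
Import GRing.Theory.
Local Open Scope ring_scope.

(** Product of two first-order expansions with values a, b, gradients u, v and remainders r, s: the
    Leibniz part is isolated and everything else is collected as new remainder coefficients. *)
Lemma first_order_mul (R : comNzRingType) m (a b : R) (u v r s z : 'I_m -> R) :
  (a + \sum_i u i * z i + \sum_i r i * z i) * (b + \sum_i v i * z i + \sum_i s i * z i)
  = a * b + \sum_i (u i * b + a * v i) * z i
    + \sum_i (a * s i + b * r i
        + (u i + r i) * (\sum_l v l * z l + \sum_l s l * z l)) * z i.
Proof.
move L : (\sum_l v l * z l + \sum_l s l * z l) => L'.
have -> : \sum_i (u i * b + a * v i) * z i = b * \sum_i u i * z i + a * \sum_i v i * z i.
  by rewrite !mulr_sumr -big_split; apply: eq_bigr => i _ /=; ring.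
have -> : \sum_i (a * s i + b * r i + (u i + r i) * L') * z i =
  a * \sum_i s i * z i + b * (\sum_i r i * z i)
  + L' * (\sum_i u i * z i) + L' * \sum_i r i * z i.
  by rewrite !mulr_sumr -!big_split; apply: eq_bigr => i _ /=; ring.
rewrite -L; ring.
Qed.

End FirstOrder.

Section RankOne.
Import GRing.Theory.
Local Open Scope ring_scope.

Lemma rank_le1 (F : fieldType) m n (A : 'M[F]_(m, n)) : (\rank A <= 1)%N ->
  exists (W : 'cV[F]_m) (E : 'rV[F]_n), A = W *m E.
Proof.
have := mulmx_base A; move: (col_base A) (row_base A).
case: (\rank A) => [|[|r]] // W E <- _; last by exists W, E.
by exists 0, 0; rewrite mul0mx [W]thinmx0 mul0mx.
Qed.

End RankOne.

Section LocalRing.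
Import GRing.Theory Num.Theory.
Local Open Scope ring_scope.
Variables (C : proj_scheme) (F : geom_function_field C) (P : ppoint algC (pdim C)).
Hypothesis hP : geom_points C P.
Local Notation n := (pdim C).
Local Notation K := (ff_sort F).
Local Notation kappa := (ff_const F).
Local Notation O := (@local_ring C F P).
Local Notation M := (@maximal_ideal C F P).
Local Notation ev A := (evalp (ff_const F) A (ff_gen F)).
Local Notation evP A := (evalp idfun A P).
Implicit Types (f g : K) (A B : {mpoly algC[n.+1]}).

Lemma ev_neq0 d A : A \is d.-homog -> evP A != 0 -> ev A != 0.
Proof. by move=> hA; apply: contra_neq => /(ff_vanish F hA); apply. Qed.

Lemma M_O f : M f -> O f.
Proof. by case=> d [A [B [hA hB _ nB ->]]]; exists d, A, B. Qed.

Lemma O_const c : O (kappa c).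
Proof.
exists 0%N, c%:MP, 1.
by rewrite !evalp1 evalpC divr1 homogC dhomog1 oner_neq0.
Qed.

Lemma O_1 : O 1. Proof. by rewrite -(rmorph1 kappa); apply: O_const. Qed.
Lemma O_0 : O 0. Proof. by rewrite -(rmorph0 kappa); apply: O_const. Qed.

Lemma O_M f g : O f -> O g -> O (f * g).
Proof.
case=> d [A [B [hA hB nB ->]]] [e [A' [B' [hA' hB' nB' ->]]]].
exists (d + e)%N, (A * A'), (B * B').
split; [exact: homogM|exact: homogM|by rewrite evalpM mulf_neq0|].
by rewrite !evalpM mulf_div.
Qed.

Lemma O_B f g : O f -> O g -> O (f - g).
Proof.
case=> d [A [B [hA hB nB ->]]] [e [A' [B' [hA' hB' nB' ->]]]].
exists (d + e)%N, (A * B' - A' * B), (B * B').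
split; [exact: homogCross|exact: homogM|by rewrite evalpM mulf_neq0|].
by rewrite evalpB !evalpM; apply: sub_div; [exact: ev_neq0 hB nB|exact: ev_neq0 hB' nB'].
Qed.

Lemma O_N f : O f -> O (- f).
Proof. by rewrite -sub0r; apply: O_B; apply: O_0. Qed.

Lemma O_D f g : O f -> O g -> O (f + g).
Proof. by move=> hf hg; rewrite -[g]opprK; apply: O_B => //; apply: O_N. Qed.

Lemma O_X f e : O f -> O (f ^+ e).
Proof.
by move=> hf; elim: e => [|e IH]; rewrite ?expr0 ?exprS; [apply: O_1|apply: O_M].
Qed.

Lemma M_B f g : M f -> M g -> M (f - g).
Proof.
case=> d [A [B [hA hB zA nB ->]]] [e [A' [B' [hA' hB' zA' nB' ->]]]].
exists (d + e)%N, (A * B' - A' * B), (B * B').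
split; [exact: homogCross|exact: homogM| |by rewrite evalpM mulf_neq0|].
  by rewrite evalpB !evalpM zA zA' !mul0r subr0.
by rewrite evalpB !evalpM; apply: sub_div; [exact: ev_neq0 hB nB|exact: ev_neq0 hB' nB'].
Qed.

Lemma M_Ol f g : O f -> M g -> M (f * g).
Proof.
case=> d [A [B [hA hB nB ->]]] [e [A' [B' [hA' hB' zA nB' ->]]]].
exists (d + e)%N, (A * A'), (B * B').
split; [exact: homogM|exact: homogM| |by rewrite evalpM mulf_neq0|].
  by rewrite evalpM zA mulr0.
by rewrite !evalpM mulf_div.
Qed.

Lemma M_Or f g : M f -> O g -> M (f * g).
Proof. by move=> ? ?; rewrite mulrC; apply: M_Ol. Qed.

Lemma M_0 : M 0.
Proof.
exists 0%N, 0, 1.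
by rewrite !evalp0 !evalp1 divr1 dhomog0 dhomog1 oner_neq0.
Qed.

Lemma M_N f : M f -> M (- f).
Proof. by rewrite -sub0r; apply: M_B; apply: M_0. Qed.

Lemma M_D f g : M f -> M g -> M (f + g).
Proof. by move=> hf hg; rewrite -[g]opprK; apply: M_B => //; apply: M_N. Qed.

Lemma O_sum (I : Type) (r : seq I) (p : pred I) (G : I -> K) :
  (forall i, O (G i)) -> O (\sum_(i <- r | p i) G i).
Proof. by move=> h; elim/big_ind: _ => //; [apply: O_0|apply: O_D]. Qed.

Lemma M_sum (I : Type) (r : seq I) (p : pred I) (G : I -> K) :
  (forall i, M (G i)) -> M (\sum_(i <- r | p i) G i).
Proof. by move=> h; elim/big_ind: _ => //; [apply: M_0|apply: M_D]. Qed.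

Lemma O_value f : O f -> exists c, M (f - kappa c).
Proof.
case=> d [A [B [hA hB nB ->]]]; exists (evP A / evP B).
have eE : ev A / ev B - kappa (evP A / evP B) =
          ev (A - (evP A / evP B)%:MP * B) / ev B.
  by rewrite evalpB evalpM evalpC mulrBl mulfK ?(ev_neq0 hB).
exists d, (A - (evP A / evP B)%:MP * B), B; split => //.
  by apply: dhomogD => //; rewrite dhomogN; apply: homogZ.
by rewrite evalpB evalpM evalpC divfK // subrr.
Qed.

(** If 1 = A / B, then A - B vanishes at the generic point, hence at [P], where its value is -
    B(P). *)
Lemma M_1 : ~ M 1.
Proof.
case=> d [A [B [hA hB zA nB e]]].
have eAB : ev A = ev B by rewrite -[LHS](mulfVK (ev_neq0 hB nB)) -e mul1r.
have hAB : A - B \is d.-homog by apply: dhomogD => //; rewrite dhomogN.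
have : ev (A - B) = 0 by rewrite evalpB eAB subrr.
move/(ff_vanish F hAB)/(_ P hP)/eqP; rewrite evalpB zA sub0r oppr_eq0.
by rewrite (negbTE nB).
Qed.

Lemma M_const c : M (kappa c) -> c = 0.
Proof.
move=> h; apply/eqP/negP => /negP nc; apply: M_1.
by rewrite -(rmorph1 kappa) -(mulVf nc) rmorphM; apply: M_Ol => //; apply: O_const.
Qed.

Lemma O_unit f : O f -> ~ M f -> f != 0 /\ O f^-1.
Proof.
case=> d [A [B [hA hB nB ->]]] nM.
have nA : evP A != 0 by apply/negP => /eqP zA; apply: nM; exists d, A, B.
split; first by apply: mulf_neq0; [exact: ev_neq0 hA nA|apply: invr_neq0; exact: ev_neq0 hB nB].
by exists d, B, A; rewrite invf_div.
Qed.

(** An affine chart containing [P]; the generic point lies in it as well, since a form that is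
    nonzero at [P] is nonzero there. *)
Lemma coord_exists : exists2 j, pcoord P 0 j = 1 & pcoord (ff_gen F) 0 j != 0.
Proof.
have [j hj] := ppoint_nz P; exists j => //.
by rewrite -(evalpU kappa) (ev_neq0 (homogX1 _ j)) // evalpU hj oner_neq0.
Qed.

Lemma O_frac f : exists a b, [/\ O a, O b, b != 0 & f = a / b].
Proof.
have [j hj nj] := coord_exists.
have [d [A [B [hA hB nB ->]]]] := ff_quotient f.
have hO (D : {mpoly algC[n.+1]}) : D \is d.-homog -> O (ev D / ev ('X_j ^+ d)).
  move=> hD; exists d, D, ('X_j ^+ d); split => //; first exact: homogXn.
  by rewrite evalpXn evalpU hj expr1n oner_neq0.
have nX : ev ('X_j ^+ d) != 0 by rewrite evalpXn evalpU expf_neq0.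
exists (ev A / ev ('X_j ^+ d)), (ev B / ev ('X_j ^+ d)).
split; [exact: hO|exact: hO| |].
  by apply: mulf_neq0; [exact: nB|exact: invr_neq0].
by rewrite [X in _ = _ / X]mulrC invfM invrK mulrA divfK.
Qed.

(** * Taylor expansion and Nakayama's lemma in an affine chart *)

Section Coordinates.
Variable j : 'I_n.+1.
Hypotheses (hj : pcoord P 0 j = 1) (nj : pcoord (ff_gen F) 0 j != 0).
(** [w] holds the affine coordinate functions of the chart, [z] the same coordinates centred at [P],
    and [aev] evaluates the dehomogenized form. *)
Let w (i : 'I_n.+1) : K := pcoord (ff_gen F) 0 i / pcoord (ff_gen F) 0 j.
Let z (i : 'I_n.+1) : K := w i - kappa (pcoord P 0 i).
Let aev A : K := (map_mpoly kappa A).@[w].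

Let zM i : M (z i).
Proof.
exists 1%N, ('X_i - (pcoord P 0 i)%:MP * 'X_j), 'X_j; split.
- by apply: dhomogD; [exact: homogX1|rewrite dhomogN; apply: homogZ; exact: homogX1].
- exact: homogX1.
- by rewrite evalpB evalpM evalpC !evalpU hj mulr1 subrr.
- by rewrite evalpU hj oner_neq0.
- by rewrite evalpB evalpM evalpC !evalpU mulrBl mulfK.
Qed.

Let zj : z j = 0.
Proof. by rewrite /z /w hj divff // rmorph1 subrr. Qed.

Let aevE d A : A \is d.-homog -> ev A = pcoord (ff_gen F) 0 j ^+ d * aev A.
Proof.
move=> hA; rewrite /aev -(meval_homog _ _ (map_mpoly_homog kappa hA)).
by rewrite /evalp; apply: meval_eq => i; rewrite /w mulrC divfK.
Qed.

Let aevD A B : aev (A + B) = aev A + aev B.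
Proof. by rewrite /aev !rmorphD. Qed.

Let aevM A B : aev (A * B) = aev A * aev B.
Proof. by rewrite /aev !rmorphM. Qed.

(** The second-order remainder is kept as a combination of the [z i] with coefficients in the
    maximal ideal, which is the shape that [nakayama] consumes. *)
Let taylor A := exists2 r : 'I_n.+1 -> K, (forall i, M (r i)) &
  aev A = kappa (evP A) + \sum_i kappa (evP A^`M(i)) * z i + \sum_i r i * z i.

Let taylorC c : taylor c%:MP.
Proof.
exists (fun _ => 0) => [_|]; first exact: M_0.
rewrite /aev map_mpolyC mevalC evalpC !big1 ?addr0 // => i _; rewrite ?mul0r //.
by rewrite mderivC evalp0 rmorph0 mul0r.
Qed.

Let taylorX i : taylor 'X_i.
Proof.
exists (fun _ => 0) => [_|]; first exact: M_0.
rewrite /aev map_mpolyX mevalXU evalpU [X in _ + X]big1 => [|l _]; last by rewrite mul0r.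
rewrite (bigD1 i) //= big1 => [|l nl]; rewrite mderivX !mnm1E.
  have -> : (U_(i) - U_(i) = 0 :> 'X_{1..n.+1})%MM.
    by apply/mnmP => l; rewrite mnmBE subnn mnm0E.
  rewrite eqxx scale1r mpolyX0 evalp1 rmorph1 mul1r !addr0.
  by rewrite /z addrC subrK.
by rewrite eq_sym (negbTE nl) scale0r evalp0 rmorph0 mul0r.
Qed.

Let taylorD A B : taylor A -> taylor B -> taylor (A + B).
Proof.
case=> r hr eA [s hs eB]; exists (fun i => r i + s i) => [i|]; first exact: M_D.
rewrite aevD eA eB evalpD rmorphD /=.
under [X in _ = _ + X + _]eq_bigr do rewrite mderivD evalpD rmorphD mulrDl.
under [X in _ = _ + X]eq_bigr do rewrite mulrDl.
by rewrite !big_split /=; move: (\sum_i _) (\sum_i _) (\sum_i _) (\sum_i _) => *; ring.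
Qed.

Let taylorM A B : taylor A -> taylor B -> taylor (A * B).
Proof.
case=> r hr eA [s hs eB].
pose L' := \sum_i kappa (evP B^`M(i)) * z i + \sum_i s i * z i.
have ML' : M L'.
  apply: M_D; apply: M_sum => i; apply: M_Ol => //; first exact: O_const.
  exact: M_O.
pose a := kappa (evP A); pose b := kappa (evP B).
exists (fun i => a * s i + b * r i + (kappa (evP A^`M(i)) + r i) * L').
  move=> i; apply: M_D; first by apply: M_D; apply: M_Ol => //; apply: O_const.
  by apply: M_Ol => //; apply: O_D; [exact: O_const|exact: M_O].
rewrite aevM eA eB evalpM rmorphM /= first_order_mul; congr (_ + _ + _).
apply: eq_bigr => i _; rewrite mderivM evalpD !evalpM rmorphD !rmorphM.
by congr (_ * _); rewrite /a.
Qed.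

Let taylorP A : taylor A.
Proof.
elim/mpolyind: A => [|c m p _ _ IH]; first by rewrite -(mpolyC0 _ _); apply: taylorC.
apply: taylorD => //; rewrite -mul_mpolyC; apply: taylorM; first exact: taylorC.
rewrite mpolyXE_id; elim/big_ind: _ => [||i _]; first by rewrite -mpolyC1; apply: taylorC.
  exact: taylorM.
elim: (m i) => [|e IHe]; first by rewrite expr0 -mpolyC1; apply: taylorC.
by rewrite exprS; apply: taylorM => //; apply: taylorX.
Qed.

Let aev_O A : O (aev A).
Proof.
have [r hr ->] := taylorP A; apply: O_D; last first.
  by apply: O_sum => i; apply: O_M; apply: M_O.
apply: O_D; first exact: O_const.
by apply: O_sum => i; apply: O_M; [apply: O_const|apply: M_O].
Qed.

(** For f = A / B the Taylor expansion of A has constant term A(P) = 0, and the dehomogenized B is a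
    unit because its constant term is B(P). *)
Let M_gen f : M f -> exists2 r : 'I_n.+1 -> K, (forall i, O (r i)) & f = \sum_i r i * z i.
Proof.
case=> d [A [B [hA hB zA nB ->]]].
have [r hr eA] := taylorP A.
have eAB : ev A / ev B = aev A / aev B.
  by rewrite (aevE hA) (aevE hB) invfM mulrACA divff ?mul1r // expf_neq0.
have OB : O (aev B)^-1.
  suff: ~ M (aev B) by move/(O_unit (aev_O B)) => [].
  have [s hs ->] := taylorP B => h; have /eqP := nB; apply; apply: M_const.
  have -> : kappa (evP B) = kappa (evP B) + \sum_i kappa (evP B^`M(i)) * z i + \sum_i s i * z i
     - \sum_i kappa (evP B^`M(i)) * z i - \sum_i s i * z i.
    by move: (\sum_i _) (\sum_i _) => a b; ring.
  apply: M_B; first apply: M_B => //; apply: M_sum => i; apply: M_Ol => //.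
    exact: O_const.
  exact: M_O.
exists (fun i => (aev B)^-1 * (kappa (evP A^`M(i)) + r i)).
  by move=> i; apply: O_M => //; apply: O_D; [apply: O_const|apply: M_O].
rewrite eAB mulrC eA zA rmorph0 add0r -big_split mulr_sumr /=.
by apply: eq_bigr => i _; rewrite -mulrA mulrDl.
Qed.

(** Congruence modulo the maximal ideal, introduced to see that det (1 - S) is congruent to 1 when S
    has its entries in that ideal. *)
Let cong f g := [/\ O f, O g & M (f - g)].

Let congD f g f' g' : cong f g -> cong f' g' -> cong (f + f') (g + g').
Proof.
move=> [a b c] [a' b' c']; split; [exact: O_D|exact: O_D|].
by rewrite opprD addrACA; apply: M_D.
Qed.

Let congM f g f' g' : cong f g -> cong f' g' -> cong (f * f') (g * g').
Proof.
move=> [a b c] [a' b' c']; split; [exact: O_M|exact: O_M|].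
have -> : f * f' - g * g' = f * (f' - g') + (f - g) * g' by ring.
by apply: M_D; [exact: M_Ol|exact: M_Or].
Qed.

Let cong_det m (X Y : 'M[K]_m) : (forall i l, cong (X i l) (Y i l)) -> cong (\det X) (\det Y).
Proof.
move=> h; rewrite /determinant; elim/big_rec2: _ => [|s f g _ IH].
  by split; [exact: O_0|exact: O_0|rewrite subrr; exact: M_0].
apply: congD => //; apply: congM.
  have OS (b : bool) : O ((-1) ^+ b) by apply: O_X; apply: O_N; exact: O_1.
  by split=> //; rewrite subrr; exact: M_0.
elim/big_rec2: _ => [|i f' g' _ IH']; last exact: congM.
by split; [exact: O_1|exact: O_1|rewrite subrr; exact: M_0].
Qed.

Let O_det m (X : 'M[K]_m) : (forall i l, O (X i l)) -> O (\det X).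
Proof.
move=> h; have [] // : cong (\det X) (\det X).
by apply: cong_det => i l; split => //; rewrite subrr; exact: M_0.
Qed.

(* Nakayama's lemma, by Cramer's rule. *)
Let nakayama (S : 'M[K]_n.+1) (y : 'cV[K]_n.+1) (W : 'cV[algC]_n.+1) (t : K) :
  (forall i l, M (S i l)) -> y = map_mx kappa W *m t%:M + S *m y ->
  forall i, exists2 q, O q & y i 0 = q * t.
Proof.
move=> hS ey i; pose D := 1%:M - S.
have cD : cong (\det D) (\det (1%:M : 'M[K]_n.+1)).
  apply: cong_det => a b; rewrite !mxE.
  have O1 : O (a == b)%:R by case: (a == b); [exact: O_1|exact: O_0].
  split; [by apply: O_B => //; apply: M_O|by []|].
  by rewrite addrAC subrr sub0r; apply: M_N.
case: cD => OD _; rewrite det1 => MD.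
have [nD OVD] : \det D != 0 /\ O (\det D)^-1.
  apply: O_unit => // h; apply: M_1.
  have -> : 1 = \det D - (\det D - 1) by ring.
  exact: M_B.
have eD : D *m y = map_mx kappa W *m t%:M.
  by rewrite /D mulmxBl mul1mx {1}ey addrK.
have e2 : \det D *: y = \adj D *m (map_mx kappa W *m t%:M).
  by rewrite -eD mulmxA mul_adj_mx mul_scalar_mx.
exists ((\det D)^-1 * \sum_l (\adj D) i l * kappa (W l 0)).
  apply: O_M => //; apply: O_sum => l; apply: O_M; last exact: O_const.
  rewrite mxE /cofactor; apply: O_M; first by apply: O_X; apply: O_N; exact: O_1.
  apply: O_det => a b; rewrite !mxE; apply: O_B; last by apply: M_O.
  by case: (_ == _); [exact: O_1|exact: O_0].
have : (\det D *: y) i 0 = (\sum_l (\adj D) i l * kappa (W l 0)) * t.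
  rewrite e2 mxE mulr_suml; apply: eq_bigr => l _.
  by rewrite !mxE big_ord1 !mxE mulr1n mulrA.
by rewrite mxE -mulrA => <-; rewrite mulKf.
Qed.

Hypothesis hS : smooth_of_dim C 1.

Let jac := jacobian_matrix C P.
(** The extra row stands for the relation z_j = 0 of the chart, which removes the direction of the
    cone through [P]. *)
Let jac1 : 'M[algC]_(size (peqs C) + 1, n.+1) := col_mx jac (delta_mx 0 j).

Let homog_peq (i : 'I_(size (peqs C))) : exists d,
  map_mpoly (ratr : {rmorphism rat -> algC}) (peqs C)`_i \is d.-homog.
Proof.
have [d hd] := peqs_homogeneous (mem_nth 0 (ltn_ord i)).
by exists d; apply: map_mpoly_homog.
Qed.

Let jacE i l : jac i l = evP (map_mpoly ratr (peqs C)`_i)^`M(l).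
Proof.
by rewrite /jac mxE mderiv_map (evalp_map_mpoly (h := ratr)).
Qed.

Let peq0 (i : 'I_(size (peqs C))) : evP (map_mpoly ratr (peqs C)`_i) = 0.
Proof. by rewrite (evalp_map_mpoly (h := ratr)) //; apply: hP; apply: mem_nth. Qed.

Let jac_ker : jac *m (pcoord P)^T = 0.
Proof.
apply/matrixP => i k; rewrite [k]ord1 !mxE; have [d hd] := homog_peq i.
have : evP (\sum_l 'X_l * (map_mpoly ratr (peqs C)`_i)^`M(l)) = 0.
  by rewrite (euler_mderiv hd) -mulr_natl evalpM peq0 mulr0.
rewrite evalp_sum => e0; rewrite -[RHS]e0; apply: eq_bigr => l _.
by rewrite [X in _ * X]mxE evalpM evalpU jacE mulrC.
Qed.

(** Every row of [jac] annihilates the vector of [P] by Euler's identity, whereas the added row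
    takes the value 1 on it; so the rank grows from n - 1. *)
Let rank_jac1 : (n <= \rank jac1)%N.
Proof.
suff : (\rank jac < \rank jac1)%N by have := hS hP; rewrite -/jac; lia.
apply: (@leq_trans (\rank (jac + (delta_mx 0 j : 'rV[algC]_n.+1))%MS)); last first.
  by rewrite addsmxE.
apply: rank_ltmx; rewrite ltmxE addsmxSl /=; apply/negP => h.
have /submxP[X eX] : ((delta_mx 0 j : 'rV[algC]_n.+1) <= jac)%MS.
  by apply: submx_trans h; apply: addsmxSr.
have := congr1 (fun V => (V *m (pcoord P)^T) 0 0) eX.
rewrite -mulmxA jac_ker mulmx0 -rowE !mxE hj.
by move/eqP; rewrite oner_eq0.
Qed.

(** Linear algebra shows that modulo [jac1] the coordinates [z] depend on a single linear form t.
    The products with [jac1] are of second order on the curve, so Nakayama makes every [z i] a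
    multiple of t. *)
Lemma M_principal_at : exists2 t, M t & forall f, M f -> exists2 g, O g & f = g * t.
Proof.
pose N := pinvmx jac1.
(* Its columns lie in the kernel of [jac1], of dimension at most 1; hence it factors as a column [W]
   times a row [E], and t will be E z. *)
have rk : (\rank (1%:M - N *m jac1)%R <= 1)%N.
  have /mulmx0_rank_max : jac1 *m (1%:M - N *m jac1) = 0.
    by rewrite mulmxBr mulmx1 mulmxA mulmxKpV ?submx_refl // subrr.
  by move: rank_jac1; lia.
have [W [E eWE]] := rank_le1 rk.
pose y : 'cV[K]_n.+1 := \col_i z i.
(* An equation of the curve vanishes at [P] and at the generic point, so the linear part of its
   Taylor expansion is the opposite of the remainder. *)
have /fin_all_exists2[R MR eR] : forall i : 'I_(size (peqs C)),
    exists2 r : 'I_n.+1 -> K, (forall l, M (r l)) &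
    \sum_l kappa (jac i l) * z l = - \sum_l r l * z l.
  move=> i; have [r hr] := taylorP (map_mpoly ratr (peqs C)`_i).
  have [d hd] := homog_peq i.
  have -> : aev (map_mpoly ratr (peqs C)`_i) = 0.
    apply: (mulfI (expf_neq0 d nj)); rewrite mulr0 -(aevE hd).
    by apply/(ff_vanish F hd) => Q hQ; rewrite (evalp_map_mpoly (h := ratr)) //;
       apply: hQ; apply: mem_nth.
  rewrite peq0 rmorph0 add0r => e0; exists r => //; apply/eqP; rewrite -addr_eq0.
  by rewrite [X in _ == X]e0; under eq_bigr do rewrite jacE.
pose S1 : 'M[K]_(size (peqs C) + 1, n.+1) := col_mx (\matrix_(i, l) - R i l) 0.
have eS1 : map_mx kappa jac1 *m y = S1 *m y.
  rewrite /jac1 /S1 map_col_mx !mul_col_mx mul0mx; congr col_mx.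
    apply/matrixP => i l; rewrite !mxE; transitivity (\sum_l kappa (jac i l) * z l).
      by apply: eq_bigr => a _; rewrite !mxE.
    by rewrite eR -sumrN; apply: eq_bigr => a _; rewrite !mxE mulNr.
  by rewrite map_delta_mx -rowE; apply/rowP => l; rewrite !mxE zj.
have MS1 i l : M (S1 i l).
  rewrite mxE; case: (split i) => a; rewrite !mxE; last exact: M_0.
  exact: M_N.
pose t := (map_mx kappa E *m y) 0 0.
have Mt : M t.
  by rewrite /t mxE; apply: M_sum => l; apply: M_Ol => //; rewrite !mxE; [exact: O_const|exact: zM].
exists t => // f /M_gen[r Or ->].
have ey : y = map_mx kappa W *m t%:M + (map_mx kappa N *m S1) *m y.
  have -> : t%:M = map_mx kappa E *m y by rewrite [RHS]mx11_scalar.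
  rewrite mulmxA -map_mxM -eWE map_mxB map_mx1 mulmxBl mul1mx map_mxM.
  by rewrite -!mulmxA eS1 subrK.
have MNS i l : M ((map_mx kappa N *m S1) i l).
  by rewrite mxE; apply: M_sum => a; apply: M_Ol => //; rewrite mxE; exact: O_const.
have /fin_all_exists2[q Oq eq] := nakayama MNS ey.
exists (\sum_i r i * q i); first by apply: O_sum => i; apply: O_M.
by rewrite mulr_suml; apply: eq_bigr => i _; rewrite -mulrA -eq mxE.
Qed.

End Coordinates.

Lemma M_principal : smooth_of_dim C 1 ->
  exists2 t, M t & forall f, M f -> exists2 g, O g & f = g * t.
Proof. by move=> hS; have [j hj nj] := coord_exists; apply: (M_principal_at hj nj hS). Qed.

End LocalRing.

(** * Valuations of a quadratic extension of k(u) *)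

Section SimpleExtension.
Import GRing.Theory Num.Theory.
Local Open Scope ring_scope.
Variables (k F : fieldType) (f : {rmorphism k -> F}).
Implicit Types (x y z : F) (p q : {poly k}).

Definition hor p x : F := (map_poly f p).[x].

Lemma horD p q x : hor (p + q) x = hor p x + hor q x.
Proof. by rewrite /hor rmorphD hornerD. Qed.
Lemma horM p q x : hor (p * q) x = hor p x * hor q x.
Proof. by rewrite /hor rmorphM hornerM. Qed.
Lemma horN p x : hor (- p) x = - hor p x.
Proof. by rewrite /hor rmorphN hornerN. Qed.
Lemma horC c x : hor c%:P x = f c.
Proof. by rewrite /hor map_polyC hornerC. Qed.
Lemma horX x : hor 'X x = x.
Proof. by rewrite /hor map_polyX hornerX. Qed.
Lemma hor0 x : hor 0 x = 0.
Proof. by rewrite -(rmorph0 polyC) horC rmorph0. Qed.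
Lemma hor1 x : hor 1 x = 1.
Proof. by rewrite -(rmorph1 polyC) horC rmorph1. Qed.
Lemma horXn p e x : hor (p ^+ e) x = hor p x ^+ e.
Proof. by rewrite /hor rmorphXn hornerE. Qed.
Lemma hor_prod (I : Type) (r : seq I) (P : pred I) (G : I -> {poly k}) x :
  hor (\prod_(i <- r | P i) G i) x = \prod_(i <- r | P i) hor (G i) x.
Proof. exact: (big_morph (fun p => hor p x) (fun p q => horM p q x) (hor1 x)). Qed.

Lemma simple_extP x z : simple_ext f x z <->
  exists p q, hor q x != 0 /\ z = hor p x / hor q x.
Proof. by []. Qed.

Lemma ext_hor x p : simple_ext f x (hor p x).
Proof.
by apply/simple_extP; exists p, 1; rewrite hor1 oner_neq0 divr1.
Qed.

Lemma ext_const x c : simple_ext f x (f c).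
Proof. by rewrite -(horC c x); apply: ext_hor. Qed.

Lemma ext_gen x : simple_ext f x x.
Proof. by rewrite -{2}(horX x); apply: ext_hor. Qed.

Lemma ext_0 x : simple_ext f x 0.
Proof. by rewrite -(hor0 x); apply: ext_hor. Qed.

Lemma ext_1 x : simple_ext f x 1.
Proof. by rewrite -(hor1 x); apply: ext_hor. Qed.

Lemma ext_D x y z : simple_ext f x y -> simple_ext f x z -> simple_ext f x (y + z).
Proof.
move=> /simple_extP[p [q [nq ->]]] /simple_extP[p' [q' [nq' ->]]]; apply/simple_extP.
exists (p * q' + p' * q), (q * q').
by rewrite horD !horM mulf_neq0 //; split => //; apply: add_div.
Qed.

Lemma ext_M x y z : simple_ext f x y -> simple_ext f x z -> simple_ext f x (y * z).
Proof.
move=> /simple_extP[p [q [nq ->]]] /simple_extP[p' [q' [nq' ->]]]; apply/simple_extP.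
exists (p * p'), (q * q').
by rewrite !horM mulf_neq0 //; split => //; rewrite mulf_div.
Qed.

Lemma ext_N x y : simple_ext f x y -> simple_ext f x (- y).
Proof.
move=> h; rewrite -mulN1r; apply: ext_M => //.
by rewrite -(rmorph1 f) -rmorphN; apply: ext_const.
Qed.

Lemma ext_B x y z : simple_ext f x y -> simple_ext f x z -> simple_ext f x (y - z).
Proof. by move=> hy hz; apply: ext_D => //; apply: ext_N. Qed.

Lemma ext_V x y : simple_ext f x y -> simple_ext f x y^-1.
Proof.
move=> /simple_extP[p [q [nq ->]]].
have [p0|np] := eqVneq (hor p x) 0; first by rewrite p0 mul0r invr0; apply: ext_0.
by apply/simple_extP; exists q, p; rewrite invf_div.
Qed.

Lemma ext_trans x y z : simple_ext f x y -> simple_ext f y z -> simple_ext f x z.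
Proof.
move=> hy /simple_extP[p [q [_ ->]]].
have hp r : simple_ext f x (hor r y).
  elim/poly_ind: r => [|r c IH]; first by rewrite hor0; apply: ext_0.
  by rewrite horD horM horX horC; apply: ext_D; [apply: ext_M|apply: ext_const].
by apply: ext_M; [|apply: ext_V].
Qed.

Lemma ext_clear x m (a : 'I_m -> F) : (forall i, simple_ext f x (a i)) ->
  exists (d : {poly k}) (p : 'I_m -> {poly k}),
    hor d x != 0 /\ forall i, hor d x * a i = hor (p i) x.
Proof.
move=> /fin_all_exists[p] /fin_all_exists[q] /= hpq.
exists (\prod_i q i), (fun i => p i * \prod_(j | j != i) q j).
split=> [|i].
  by rewrite hor_prod; apply/prodf_neq0 => i _; case: (hpq i).
have [nq ->] := hpq i; rewrite horM hor_prod (bigD1 i) //= -hor_prod.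
by rewrite mulrC mulrA divfK.
Qed.

Lemma poly_split0 p : p != 0 -> exists l q, p = q * 'X^l /\ q.[0] != 0.
Proof.
move=> np; have [l [q]] := multiplicity_XsubC p 0; rewrite np /= => h ->.
by exists l, q; rewrite subr0; split => //; rewrite -rootE.
Qed.

Lemma poly_const0 p : exists q, p = q * 'X + p.[0]%:P.
Proof.
elim/poly_ind: p => [|p c _]; first by exists 0; rewrite mul0r add0r horner0 polyC0.
by exists p; rewrite !hornerE ?mulr0 ?add0r.
Qed.

(** As long as all coefficients vanish at 0 the relation can be divided by x; the size of one fixed
    nonzero coefficient bounds the number of divisions. *)
Lemma dep_norm x m (g : 'I_m -> F) (a : 'I_m -> {poly k}) : x != 0 ->
  (exists i, a i != 0) -> \sum_i hor (a i) x * g i = 0 ->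
  exists b : 'I_m -> {poly k},
    (exists i, (b i).[0] != 0) /\ \sum_i hor (b i) x * g i = 0.
Proof.
move=> nx [i0]; move sz : (size (a i0)) => s.
elim: s a sz => [|s IH] a sz na ha.
  by move/eqP: sz; rewrite size_poly_eq0 (negbTE na).
case: (classic (exists i, (a i).[0] != 0)) => [?|h0]; first by exists a.
have {}h0 i : exists q, a i = q * 'X.
  have [q eq] := poly_const0 (a i); exists q; rewrite eq.
  have -> : (a i).[0] = 0 by apply/eqP/negP => /negP ni; apply: h0; exists i.
  by rewrite addr0.
have [b hb] := fin_all_exists h0; apply: (IH b).
- apply/eqP; rewrite -eqSS -sz hb size_mulX //; apply/negP => /eqP b0.
  by move: na; rewrite hb b0 mul0r eqxx.
- by apply: contra_neq na; rewrite hb => ->; rewrite mul0r.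
- apply: (mulIf nx); rewrite mul0r -[RHS]ha mulr_suml.
  by apply: eq_bigr => i _; rewrite hb horM horX mulrAC.
Qed.

End SimpleExtension.

Section Transcendence.
Import GRing.Theory Num.Theory.
Local Open Scope ring_scope.

(** Over an algebraically closed field p splits, so a root of p in the larger field is one of its
    constant roots: a nonconstant element is transcendental. *)
Lemma hor_eq0 (K : fieldType) (f : {rmorphism algC -> K}) (x : K) (p : {poly algC}) :
  (forall c, x <> f c) -> hor f p x = 0 -> p = 0.
Proof.
move=> nx; have [r ->] := closed_field_poly_normal p.
have [->|nl] := eqVneq (lead_coef p) 0; first by rewrite scale0r.
rewrite -mul_polyC horM horC hor_prod => /eqP; rewrite mulf_eq0 fmorph_eq0 (negbTE nl) /=.
rewrite prodf_seq_eq0 => /hasP[c _ /=]; rewrite horD horN horC horX subr_eq0 => /eqP e.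
by case: (nx c).
Qed.

End Transcendence.

Section Generator.
Import GRing.Theory Num.Theory.
Local Open Scope ring_scope.
Variables (C : proj_scheme) (F : geom_function_field C).
Local Notation K := (ff_sort F).
Local Notation kappa := (ff_const F).

(* dc_dep encodes [F : algC(u)] <= 2, and dc_regular says that u is defined as a
   map to P^1 at every point. *)
Record double_cover (u : K) : Prop := DoubleCover {
  dc_nonconst : forall c, u <> kappa c;
  dc_dep : forall g : 'I_3 -> K, exists a : 'I_3 -> K,
    [/\ forall i, simple_ext kappa u (a i), exists i, a i != 0 & \sum_i a i * g i = 0];
  dc_regular : forall P, geom_points C P -> local_ring P u \/ maximal_ideal P u^-1
}.

(** Denominators are cleared and powers of x divided out, so that at a point where x vanishes the
    relation reduces modulo x to a nontrivial relation with constant coefficients. *)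
Lemma poly_dep u x (g : 'I_3 -> K) : double_cover u -> (forall c, x <> kappa c) ->
  simple_ext kappa x u ->
  exists b : 'I_3 -> {poly algC},
    (exists i, (b i).[0] != 0) /\ \sum_i hor kappa (b i) x * g i = 0.
Proof.
case=> _ dep _ nx xu; have [a [ha na a0]] := dep g.
have [d [p [nd dp]]] := ext_clear (fun i => ext_trans xu (ha i)).
apply: (@dep_norm _ _ _ _ _ _ p).
- by apply/eqP; rewrite -(rmorph0 kappa); apply: nx.
- have [i ni] := na; exists i; apply/eqP => pi0; move/eqP: (dp i).
  by rewrite pi0 hor0 mulf_eq0 (negbTE nd) (negbTE ni).
- under eq_bigr do rewrite -dp -mulrA.
  by rewrite -mulr_sumr a0 mulr0.
Qed.

End Generator.

Section Valuation.
Import GRing.Theory Num.Theory.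
Local Open Scope ring_scope.
Variables (C : proj_scheme) (F : geom_function_field C) (P : ppoint algC (pdim C)).
Hypothesis hP : geom_points C P.
Local Notation K := (ff_sort F).
Local Notation kappa := (ff_const F).
Local Notation O := (@local_ring C F P).
Local Notation M := (@maximal_ideal C F P).
Variable u : K.
Hypothesis dcu : double_cover u.
Implicit Types f g t : K.

Lemma O_hor p x : O x -> O (hor kappa p x).
Proof.
move=> Ox; elim/poly_ind: p => [|p c IH]; first by rewrite hor0; apply: O_0.
by rewrite horD horM horX horC; apply: O_D => //; [apply: O_M|apply: O_const].
Qed.

Lemma M_hor p x : M x -> M (hor kappa p x - kappa p.[0]).
Proof.
move=> Mx; have [q {1}->] := poly_const0 p.
rewrite horD horM horX horC addrK; apply: M_Ol => //.
by apply: O_hor; apply: M_O.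
Qed.

Definition O_units f := [/\ f != 0, O f & O f^-1].

Lemma O_units_hor p x : M x -> p.[0] != 0 -> O_units (hor kappa p x).
Proof.
move=> Mx np; have Oh := O_hor p (M_O Mx).
have [] // := O_unit hP Oh => h; have /eqP := np; apply; apply: (M_const (F := F) hP).
have -> : kappa p.[0] = hor kappa p x - (hor kappa p x - kappa p.[0]).
  by rewrite opprB addrC subrK.
by apply: M_B => //; apply: M_hor.
Qed.

Lemma O_units_M f g : O_units f -> O_units g -> O_units (f * g).
Proof.
case=> nf Of Vf [ng Og Vg]; split; [exact: mulf_neq0|exact: O_M|].
by rewrite invfM; apply: O_M.
Qed.

Lemma O_units_V f : O_units f -> O_units f^-1.
Proof. by case=> nf Of Vf; split; rewrite ?invr_eq0 ?invrK. Qed.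

Lemma O_units_1 : O_units 1.
Proof. by split; rewrite ?oner_neq0 ?invr1 //; apply: O_1. Qed.

Lemma O_units_X f e : O_units f -> O_units (f ^+ e).
Proof.
by move=> hf; elim: e => [|e IH]; [apply: O_units_1|rewrite exprS; apply: O_units_M].
Qed.

Lemma O_units_Xz f (e : int) : O_units f -> O_units (f ^ e).
Proof.
case: e => e hf; rewrite ?NegzE -?exprnN; first exact: O_units_X.
by apply: O_units_V; apply: O_units_X.
Qed.

Lemma O_units_notM f : O_units f -> ~ M f.
Proof.
by case=> nf Of Vf Mf; apply: (M_1 hP (F := F)); rewrite -(mulVf nf); apply: M_Ol.
Qed.

(** Take u - u(P) where u is regular and 1 / u at a pole. *)
Lemma local_parameter : exists x, [/\ M x, forall c, x <> kappa c & simple_ext kappa x u].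
Proof.
case: dcu => nu _ reg; case: (reg P hP) => [Ou|MV].
  have [a Ma] := O_value hP Ou; exists (u - kappa a); split => // [c e|].
    by apply: (nu (c + a)); rewrite rmorphD -e subrK.
  rewrite -{2}(subrK (kappa a) u); apply: ext_D; [exact: ext_gen|exact: ext_const].
exists u^-1; split => // [c e|].
  by apply: (nu c^-1); rewrite fmorphV -e invrK.
by rewrite -{2}[u]invrK; apply: ext_V; apply: ext_gen.
Qed.

Section Uniformizer.
Variable t : K.
Hypotheses (Mt : M t) (tgen : forall f, M f -> exists2 g, O g & f = g * t).

Let t_neq0 : t != 0.
Proof.
have [x [Mx nx _]] := local_parameter; apply/eqP => t0.
have [g _] := tgen Mx; rewrite t0 mulr0 => x0; apply: (nx 0); by rewrite rmorph0.
Qed.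

(* Both t and f are algebraic over algC(x), so that each divides a power of the
   other; this replaces the Krull intersection theorem. *)
Let dvd_param f : O f -> f != 0 -> exists N w, O w /\ t ^+ N = f * w.
Proof.
move=> Of nf; have [x [Mx nx xu]] := local_parameter.
(* Modulo x, a relation between 1, t, t^2 becomes p(t) in x O with p nonzero. In p = q X^l with q(0)
   nonzero, q(t) is a unit, so that t^l lies in x O. *)
have [l [w [Ow tl]]] : exists l w, O w /\ t ^+ l = x * w.
  have [b [[i0 nb] hb]] := poly_dep (fun i : 'I_3 => t ^+ i) dcu nx xu.
  pose p : {poly algC} := \poly_(i < 3) oapp (fun j => (b j).[0]) 0 (insub i).
  have np : p != 0.
    apply: contra_neq nb => p0; have := congr1 (fun q : {poly algC} => q`_i0) p0.
    by rewrite coef0 coef_poly ltn_ord valK.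
  have [l [q [ep nq]]] := poly_split0 np.
  have hpE : hor kappa p t = \sum_(i < 3) kappa (b i).[0] * t ^+ i.
    rewrite /hor (@horner_coef_wide _ 3) ?size_map_poly ?size_poly //.
    by apply: eq_bigr => i _; rewrite coef_map coef_poly ltn_ord valK.
  have [v Ov ev] : exists2 v, O v & hor kappa p t = x * v.
    have hq i : exists v, hor kappa (b i) x = x * hor kappa v x + kappa (b i).[0].
      have [v {1}->] := poly_const0 (b i); exists v.
      by rewrite horD horM horX horC mulrC.
    have [v hv] := fin_all_exists hq.
    exists (- \sum_(i < 3) hor kappa (v i) x * t ^+ i).
      apply: (O_N hP); apply: (O_sum hP) => i; apply: O_M; last by apply: O_X; apply: M_O.
      by apply: O_hor; apply: M_O.
    rewrite hpE mulrN mulr_sumr; apply/eqP; rewrite -addr_eq0 -big_split /=.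
    by rewrite -[X in _ == X]hb; apply/eqP; apply: eq_bigr => i _; rewrite hv; ring.
  have [nqt _ OV] := O_units_hor Mt nq.
  exists l, (v * (hor kappa q t)^-1); split; first exact: O_M.
  by rewrite mulrA -ev ep horM horXn horX mulrAC divff ?mul1r.
have [k [w' [Ow' xk]]] : exists k w, O w /\ x ^+ k = f * w.
  have [b [[i0 nb] hb]] := poly_dep (fun i : 'I_3 => f ^+ i) dcu nx xu.
  have Ob i : O (hor kappa (b i) x) by apply: O_hor; apply: M_O.
  (* In a relation between 1, f, f^2 let p be the first nonzero coefficient: after division by the
     corresponding power of f, p(x) is a multiple of f. *)
  have [p [w1 [np Ow1 e1]]] : exists p w, [/\ p != 0, O w & hor kappa p x = f * w].
    move: hb; rewrite !big_ord_recl big_ord0 /= /bump /= expr0 expr1 addr0 mulr1.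
    set i2 := fintype.lift ord0 (fintype.lift _ _); set i1 := fintype.lift _ _.
    have Ei : [\/ i0 = ord0, i0 = i1 | i0 = i2].
      by case: (i0) => [[|[|[|//]]] h]; [constructor 1|constructor 2|constructor 3]; apply: val_inj.
    move=> hb; have [b0|?] := eqVneq (b ord0) 0; last first.
      exists (b ord0), (- (hor kappa (b i1) x + hor kappa (b i2) x * f)); split => //.
        by apply: (O_N hP); apply: (O_D hP) => //; apply: O_M.
      by apply/eqP; rewrite -subr_eq0 -[X in _ == X]hb; apply/eqP; ring.
    have [b1|?] := eqVneq (b i1) 0; last first.
      exists (b i1), (- (hor kappa (b i2) x)); split => //; first exact: (O_N hP).
      apply: (mulIf nf); apply/eqP; rewrite -subr_eq0 -[X in _ == X]hb b0 hor0.
      by apply/eqP; ring.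
    move: hb; rewrite b0 b1 !hor0 mul0r !add0r => /eqP.
    rewrite mulf_eq0 expf_eq0 (negbTE nf) andbF orbF => /eqP /(hor_eq0 nx) b2.
    by case: Ei nb => ->; rewrite ?b0 ?b1 ?b2 horner0 eqxx.
  have [k [q [ep nq]]] := poly_split0 np.
  have [nqx _ OV] := O_units_hor Mx nq.
  exists k, (w1 * (hor kappa q x)^-1); split; first exact: O_M.
  by rewrite mulrA -e1 ep horM horXn horX mulrAC divff ?mul1r.
exists (l * k)%N, (w' * w ^+ k); split; first by apply: O_M => //; apply: O_X.
by rewrite exprM tl exprMn xk mulrA.
Qed.

(** Divide by t while the function lies in the maximal ideal; as t^N is a multiple of f, this stops
    after at most N divisions. *)
Let O_decomp f : O f -> f != 0 -> exists m v, O_units v /\ f = v * t ^+ m.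
Proof.
move=> Of nf; have [N [w [Ow e]]] := dvd_param Of nf.
elim: N f w Of nf Ow e => [|N IH] f w Of nf Ow e.
  exists 0%N, f; rewrite mulr1; split => //; split => //.
  by rewrite expr0 in e; rewrite -[f^-1]mulr1 e mulKf.
case: (classic (M f)) => [/tgen[g Og ef]|nM]; last first.
  by have [_ OV] := O_unit hP Of nM; exists 0%N, f; rewrite mulr1.
have ng : g != 0 by apply: contra_neq nf; rewrite ef => ->; rewrite mul0r.
have [|m [v [Uv eg]]] := IH g w Og ng Ow.
  by apply: (mulIf t_neq0); rewrite -exprSr e ef mulrAC.
by exists m.+1, v; rewrite ef eg exprSr mulrA.
Qed.

Lemma decomp_at f : f != 0 -> exists (m : int) v, O_units v /\ f = v * t ^ m.
Proof.
have [a [b [Oa Ob nb ->]]] := O_frac hP f => nf.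
have na : a != 0 by apply: contra_neq nf => ->; rewrite mul0r.
have [m [v [Uv ->]]] := O_decomp Oa na.
have [m' [v' [Uv' ->]]] := O_decomp Ob nb.
exists (m%:Z - m'%:Z), (v * v'^-1); split.
  by apply: O_units_M => //; apply: O_units_V.
by rewrite expfzDr // -exprnN invfM -!exprnP; ring.
Qed.

Lemma param_neq0 : t != 0. Proof. exact: t_neq0. Qed.

End Uniformizer.

End Valuation.

(** A total version of [ord], obtained by choice. It is meaningless at f = 0, which is why [vge]
    treats 0 separately. *)
Definition vord (C : proj_scheme) (F : geom_function_field C)
  (P : ppoint algC (pdim C)) (f : ff_sort F) : int :=
  epsilon (inhabits (0%R : int)) (ord P f).

(** * The discrete valuation at a point of the curve *)

Section Order.
Import GRing.Theory Num.Theory Order.TTheory.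
Local Open Scope ring_scope.
Variables (C : proj_scheme) (F : geom_function_field C).
Hypothesis hS : smooth_of_dim C 1.
Local Notation K := (ff_sort F).
Local Notation kappa := (ff_const F).
Variable u : K.
Hypothesis dcu : double_cover u.
Implicit Types (f g t : K) (P : ppoint algC (pdim C)).

Definition vge P (m : int) f := f = 0 \/ m <= vord P f.

Section AtPoint.
Variable P : ppoint algC (pdim C).
Hypothesis hP : geom_points C P.
Local Notation O := (@local_ring C F P).
Local Notation M := (@maximal_ideal C F P).
Local Notation U := (@O_units C F P).
Local Notation v := (@vord C F P).

Lemma uniformizer_ex : exists t : K, uniformizer P t.
Proof. by have [t Mt tg] := M_principal F hP hS; exists t. Qed.

Lemma uniformizer_neq0 t : uniformizer P t -> t != 0.
Proof. by case=> Mt tg; apply: (param_neq0 hP dcu tg). Qed.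

Lemma unit_val_eq0 t (m : int) : uniformizer P t -> U (t ^ m) -> m = 0.
Proof.
move=> ut; have nt := uniformizer_neq0 ut; case: ut => Mt _.
have MX k : M (t ^+ k.+1).
  by rewrite exprS; apply: M_Or => //; apply: O_X => //; apply: M_O.
case: m => [[|k]|k] // h; first by case: (O_units_notM hP h); apply: MX.
by case: (O_units_notM hP (O_units_V h)); rewrite NegzE -exprnN invrK; apply: MX.
Qed.

Lemma unif_ratio t t' : uniformizer P t -> uniformizer P t' ->
  exists2 g, U g & t' = g * t.
Proof.
move=> ut ut'; have nt := uniformizer_neq0 ut; have nt' := uniformizer_neq0 ut'.
case: ut ut' => Mt tg [Mt' tg']; have [g Og e] := tg _ Mt'.
have [g' Og' e'] := tg' _ Mt; exists g => //.
have gg : g' * g = 1 by apply: (mulIf nt); rewrite -mulrA -e -e' mul1r.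
have ng : g != 0 by apply/eqP => g0; move/eqP: gg; rewrite g0 mulr0 eq_sym oner_eq0.
by split => //; rewrite -[g^-1]mul1r -gg mulfK.
Qed.

Lemma ord_at t f m : uniformizer P t -> ord P f m -> exists2 w, U w & f = w * t ^ m.
Proof.
move=> ut [t' [w [ut' nw Ow Vw ->]]]; have [g Ug ->] := unif_ratio ut ut'.
exists (w * g ^ m); last by rewrite expfzMl mulrA.
by apply: O_units_M => //; apply: O_units_Xz.
Qed.

Lemma ord_intro t w m : uniformizer P t -> U w -> ord P (w * t ^ m) m.
Proof. by move=> ut [nw Ow Vw]; exists t, w. Qed.

Lemma ord_ex f : f != 0 -> exists m, ord P f m.
Proof.
have [t ut] := uniformizer_ex => nf; case: (ut) => Mt tg.
have [m [w [Uw ->]]] := decomp_at hP dcu Mt tg nf.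
by exists m; apply: ord_intro.
Qed.

Lemma ord_neq0 f m : ord P f m -> f != 0.
Proof.
have [t ut] := uniformizer_ex => /(ord_at ut)[w [nw _ _] ->].
by rewrite mulf_neq0 // expfz_neq0 // uniformizer_neq0.
Qed.

Lemma ord_uniq f m m' : ord P f m -> ord P f m' -> m = m'.
Proof.
have [t ut] := uniformizer_ex; have nt := uniformizer_neq0 ut.
move=> /(ord_at ut)[w Uw ->] /(ord_at ut)[w' Uw' e].
apply/eqP; rewrite -subr_eq0; apply/eqP/(unit_val_eq0 ut).
have -> : t ^ (m - m') = w^-1 * w'.
  have [nw _ _] := Uw; rewrite expfzDr // -[t ^ m](mulKf nw) e -invr_expz.
  by rewrite mulrA mulfK // expfz_neq0.
by apply: O_units_M => //; apply: O_units_V.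
Qed.

Lemma vordP f : f != 0 -> ord P f (v f).
Proof. by move=> nf; apply: epsilon_spec; apply: ord_ex. Qed.

Lemma vordE f m : ord P f m -> v f = m.
Proof. by move=> h; apply: ord_uniq (h); apply: vordP; apply: ord_neq0 h. Qed.

Lemma vord_decomp t f : uniformizer P t -> f != 0 -> exists2 w, U w & f = w * t ^ v f.
Proof. by move=> ut nf; apply: ord_at => //; apply: vordP. Qed.

Lemma vordM f g : f != 0 -> g != 0 -> v (f * g) = v f + v g.
Proof.
have [t ut] := uniformizer_ex; have nt := uniformizer_neq0 ut => nf ng.
have [w Uw ef] := vord_decomp ut nf; have [w' Uw' eg] := vord_decomp ut ng.
apply: vordE; rewrite {1}ef {1}eg mulrACA -expfzDr //.
by apply: ord_intro => //; apply: O_units_M.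
Qed.

Lemma vord_unit f : U f -> v f = 0.
Proof.
have [t ut] := uniformizer_ex => Uf; apply: vordE.
by rewrite -[f]mulr1 -(expr0z t); apply: ord_intro.
Qed.

Lemma vord1 : v 1 = 0.
Proof. by apply: vord_unit; apply: O_units_1. Qed.

Lemma vordV f : f != 0 -> v f^-1 = - v f.
Proof.
move=> nf; have := vordM nf (invr_neq0 nf); rewrite divff // vord1 => e.
by apply/eqP; rewrite -addr_eq0 addrC -e.
Qed.

Lemma vordX f e : f != 0 -> v (f ^+ e) = v f *+ e.
Proof.
move=> nf; elim: e => [|e IH]; first by rewrite vord1.
by rewrite exprS vordM ?expf_neq0 // IH mulrS.
Qed.

Lemma vord_const c : c != 0 -> v (kappa c) = 0.
Proof.
by move=> nc; apply: vord_unit; split; rewrite ?fmorph_eq0 // -?fmorphV; apply: O_const.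
Qed.

Lemma vordN f : v (- f) = v f.
Proof.
have [->|nf] := eqVneq f 0; first by rewrite oppr0.
rewrite -mulN1r vordM ?oppr_eq0 ?oner_neq0 //.
by rewrite -(rmorph1 kappa) -rmorphN vord_const ?add0r // oppr_eq0 oner_neq0.
Qed.

Lemma vgeP t m f : uniformizer P t -> vge P m f <-> exists2 o, O o & f = o * t ^ m.
Proof.
move=> ut; have nt := uniformizer_neq0 ut; split=> [[->|h]|[o Oo ->]].
- by exists 0; [exact: O_0|rewrite mul0r].
- have [->|nf] := eqVneq f 0; first by exists 0; [exact: O_0|rewrite mul0r].
  have [w [_ Ow _] ->] := vord_decomp ut nf; exists (w * t ^ (v f - m)).
    apply: O_M => //; have : 0 <= v f - m by rewrite subr_ge0.
    by case: (v f - m) => // k _; apply: O_X => //; apply: M_O; case: ut.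
  by rewrite -mulrA -expfzDr // subrK.
- have [->|no] := eqVneq o 0; [by left; rewrite mul0r|right].
  rewrite vordM ?expfz_neq0 // -[t ^ m]mul1r (vordE (ord_intro _ ut (O_units_1 _ _))).
  rewrite lerDr; have [w Uw eo] := vord_decomp ut no; case evo: (v o) => [k|k] //.
  case: (O_units_notM hP Uw).
  have -> : w = t ^+ k.+1 * o by rewrite eo evo NegzE -exprnN mulrCA divff ?mulr1 // expf_neq0.
  by apply: M_Or => //; rewrite exprS; apply: M_Or; [case: ut|apply: O_X => //; apply: M_O; case: ut].
Qed.

Lemma vge_D m f g : vge P m f -> vge P m g -> vge P m (f + g).
Proof.
have [t ut] := uniformizer_ex; rewrite !(vgeP _ _ ut) => -[o Oo ->] [o' Oo' ->].
by exists (o + o'); [exact: O_D|rewrite mulrDl].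
Qed.

Lemma vge_M m m' f g : vge P m f -> vge P m' g -> vge P (m + m') (f * g).
Proof.
have [t ut] := uniformizer_ex; have nt := uniformizer_neq0 ut.
rewrite !(vgeP _ _ ut) => -[o Oo ->] [o' Oo' ->].
by exists (o * o'); [exact: O_M|rewrite expfzDr // mulrACA].
Qed.

Lemma vge_sum m (I : Type) (r : seq I) (p : pred I) (G : I -> K) :
  (forall i, p i -> vge P m (G i)) -> vge P m (\sum_(i <- r | p i) G i).
Proof. by move=> h; elim/big_ind: _ => //; [left|apply: vge_D]. Qed.

Lemma vge_le m m' f : m' <= m -> vge P m f -> vge P m' f.
Proof. by move=> le [->|h]; [left|right; apply: le_trans h]. Qed.

Lemma vge0 f : vge P 0 f <-> O f.
Proof.
have [t ut] := uniformizer_ex; rewrite (vgeP _ _ ut); split=> [[o Oo ->]|Of].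
  by rewrite mulr1.
by exists f; rewrite ?mulr1.
Qed.

Lemma vge1 f : vge P 1 f <-> M f.
Proof.
have [t ut] := uniformizer_ex; rewrite (vgeP _ _ ut); case: ut => Mt tg.
by split=> [[o Oo ->]|/tg//]; apply: M_Ol.
Qed.

Lemma vge_const m c : m <= 0 -> vge P m (kappa c).
Proof. by move=> le; apply: vge_le le _; apply/vge0; apply: O_const. Qed.

Lemma vge_scale m c f : vge P m f -> vge P m (kappa c * f).
Proof. by move=> h; rewrite -[m]add0r; apply: vge_M => //; apply: vge_const. Qed.

Lemma vge_N m f : vge P m f -> vge P m (- f).
Proof. by case=> [->|h]; [left; rewrite oppr0|right; rewrite vordN]. Qed.

Lemma vge_vord f : vge P (v f) f.
Proof. by right. Qed.

Lemma vge_neq0 m f : f != 0 -> vge P m f -> m <= v f.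
Proof. by move=> /eqP nf []. Qed.

(** Equality case of the ultrametric inequality: otherwise f = (f + g) - g would have order greater
    than its own. *)
Lemma vord_lead f g : f != 0 -> vge P (v f + 1) g -> f + g != 0 /\ v (f + g) = v f.
Proof.
move=> nf hg; have nfg : f + g != 0.
  apply/eqP => e0; have : vge P (v f + 1) f.
    have ef : f = - g by apply/eqP; rewrite -addr_eq0 e0.
    by rewrite {2}ef; apply: vge_N.
  by move/(vge_neq0 nf); rewrite gerDl.
split=> //; apply/eqP; rewrite eq_le; apply/andP; split.
  rewrite leNgt; apply/negP => lt; have : vge P (v f + 1) f.
    rewrite -{2}[f](addrK g).
    by apply: vge_D; [right; rewrite lezD1|exact: vge_N].
  by move/(vge_neq0 nf); rewrite gerDl.
apply: (vge_neq0 nfg); apply: vge_D; first exact: vge_vord.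
by apply: vge_le hg; rewrite lerDl.
Qed.

End AtPoint.

Lemma riemann_roch_vge (D : {freeg (ppoint algC (pdim C)) / int}) f :
  riemann_roch_space D f <-> forall P, geom_points C P -> vge P (- coeff P D) f.
Proof.
split=> [[->|h] P hP|h]; [by left| |].
  by have [m /(vordE hP) <- le] := h P hP; right.
have [->|nf] := eqVneq f 0; [by left|right=> P hP].
by exists (vord P f); [exact: vordP|apply: vge_neq0 (h P hP)].
Qed.

End Order.

(** * Fibres of the double cover *)

Section Avoid.
Import GRing.Theory Num.Theory.
Local Open Scope ring_scope.

Lemma nat_avoid (R : numDomainType) (s : seq R) : exists m : nat, m%:R \notin s.
Proof.
apply: NNPP => h; pose l : seq R := [seq i%:R | i <- iota 0 (size s).+1].
suff : (size l <= size s)%N by rewrite size_map size_iota ltnn.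
apply: uniq_leq_size.
  by rewrite map_inj_uniq ?iota_uniq // => a b /eqP; rewrite eqr_nat => /eqP.
move=> _ /mapP[i _ ->]; apply/negPn/negP => ni; apply: h; by exists i.
Qed.

Lemma int_bound (T : eqType) (s : seq T) (b : T -> int) :
  exists N : nat, forall x, x \in s -> b x <= N%:Z.
Proof.
elim: s => [|y s [N hN]]; first by exists 0%N.
exists (N + `|b y|)%N => x; rewrite inE => /orP[/eqP ->|/hN h]; lia.
Qed.

End Avoid.

Section LinearForms.
Import GRing.Theory Num.Theory.
Local Open Scope ring_scope.
Variable n : nat.
Implicit Types P Q R : ppoint algC n.

(** Points are added one at a time: A + m X_i, with X_i nonzero at the new point, is good for all
    natural numbers m outside a finite set. *)
Lemma form_nonvanishing (s : seq (ppoint algC n)) :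
  exists2 A : {mpoly algC[n.+1]}, A \is 1.-homog & forall P, P \in s -> evalp idfun A P != 0.
Proof.
elim: s => [|Q s [A hA nA]]; first by exists 0; [exact: dhomog0|].
have [i hi] := ppoint_nz Q.
have [m] := nat_avoid (- evalp idfun A Q :: [seq - evalp idfun A P / pcoord P 0 i | P <- s]).
rewrite inE negb_or => /andP[mQ ms].
exists (A + (m%:R)%:MP * 'X_i).
  by apply: dhomogD => //; apply: homogZ; apply: homogX1.
move=> P; rewrite evalpD evalpM evalpC evalpU inE => /orP[/eqP ->|Ps].
  by rewrite hi mulr1; apply: contra_neq mQ => /eqP; rewrite addr_eq0 => /eqP ->; rewrite opprK.
have [->|ni] := eqVneq (pcoord P 0 i) 0; first by rewrite mulr0 addr0 nA.
apply/eqP => /eqP; rewrite addrC addr_eq0 => /eqP e; move/negP: ms; apply.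
by apply/mapP; exists P => //; rewrite -e mulfK.
Qed.

Lemma form_separating P Q : P <> Q ->
  exists2 A : {mpoly algC[n.+1]}, A \is 1.-homog & evalp idfun A P != 0 /\ evalp idfun A Q = 0.
Proof.
move=> nPQ; apply: NNPP => h; apply: nPQ; apply: ppoint_sep => i j.
apply: NNPP => nij; apply: h.
exists ((pcoord Q 0 j)%:MP * 'X_i - (pcoord Q 0 i)%:MP * 'X_j).
  by apply: dhomogD; rewrite ?dhomogN; apply: homogZ; apply: homogX1.
rewrite !evalpB !evalpM !evalpC !evalpU; split; last by rewrite mulrC subrr.
by rewrite subr_eq0; apply/eqP => e; apply: nij; rewrite mulrC [RHS]mulrC.
Qed.

End LinearForms.

Section Fibres.
Import GRing.Theory Num.Theory Order.TTheory.
Local Open Scope ring_scope.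
Variables (C : proj_scheme) (F : geom_function_field C).
Hypothesis hS : smooth_of_dim C 1.
Local Notation K := (ff_sort F).
Local Notation kappa := (ff_const F).
Local Notation pt := (ppoint algC (pdim C)).
Local Notation ev A := (evalp (ff_const F) A (ff_gen F)).
Variable u : K.
Hypothesis dcu : double_cover u.
Implicit Types (f g t : K) (P Q R : pt) (s : seq pt).

(** A product of quotients m / l of linear forms, with one m for each R other than [Q], vanishing at
    R and not at [Q], and a common l that vanishes nowhere on the list or at [Q]. *)
Lemma separating_function s Q : (forall P, P \in s -> geom_points C P) -> geom_points C Q ->
  exists f, O_units Q f /\ forall R, R \in s -> R <> Q -> maximal_ideal R f.
Proof.
move=> gs gQ; have [l hl nl] := form_nonvanishing (Q :: s).
have nlQ : evalp idfun l Q != 0 by apply: nl; rewrite inE eqxx.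
suff [f [Uf Of h]] : exists f, [/\ O_units Q f, forall R, R \in s -> local_ring R f &
    forall R, R \in s -> R <> Q -> maximal_ideal R f] by exists f.
have : {subset s <= s} by [].
(* The induction runs over the points where f must vanish; regularity is required on the whole of
   [s] throughout, so that later factors do not spoil earlier zeros. *)
move: {1 4}s; elim=> [|R0 s1 IH] ss.
  by exists 1; split => [|R _|//]; [exact: O_units_1|exact: O_1].
have [|f [Uf Of h]] := IH; first by move=> R hR; apply: ss; rewrite inE hR orbT.
have R0s : R0 \in s by apply: ss; rewrite inE eqxx.
case: (classic (R0 = Q)) => [e|ne].
  exists f; split => // R; rewrite inE => /orP[/eqP -> /(_ e)//|]; exact: h.
have [m hm [mQ mR0]] := form_separating (nesym ne).
exists (f * (ev m / ev l)).
have Om R : R \in s -> local_ring R (ev m / ev l).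
  by move=> hR; exists 1%N, m, l; split => //; apply: nl; rewrite inE hR orbT.
split.
- apply: O_units_M => //.
  have nM : ~ maximal_ideal Q (ev m / ev l).
    case=> d [A [B [hA hB A0 B0 e]]].
    have c : ev (m * B - A * l) = 0.
      rewrite evalpB !evalpM; apply/eqP; rewrite subr_eq0; apply/eqP.
      by apply: div_cross e; [exact: ev_neq0 hl nlQ|exact: ev_neq0 hB B0].
    have hh : m * B - A * l \is (1 + d).-homog by apply: homogCross.
    move/(ff_vanish F hh): c => /(_ Q gQ) /eqP.
    by rewrite evalpB !evalpM A0 mul0r subr0 mulf_eq0 (negbTE mQ) (negbTE B0).
  have OQ : local_ring Q (ev m / ev l) by exists 1%N, m, l.
  by have [] := O_unit gQ OQ nM.
- by move=> R hR; apply: O_M; [exact: Of|exact: Om].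
- move=> R; rewrite inE => /orP[/eqP -> _|hR nR].
    apply: M_Ol; first exact: Of.
    by exists 1%N, m, l; split => //; apply: nl; rewrite inE R0s orbT.
  by apply: M_Or; [exact: h|apply: Om; apply: ss; rewrite inE hR orbT].
Qed.

(** Weak approximation: t^j has the right order at [Q], and a high power of a function that is a
    unit at [Q] and vanishes at the other points corrects it there. *)
Lemma approximation s Q (j : int) (e : nat) : (forall P, P \in s -> geom_points C P) ->
  geom_points C Q -> exists g, [/\ g != 0, vord Q g = j &
    forall R, R \in s -> R <> Q -> vge R e%:Z g].
Proof.
move=> gs gQ; have [f [Uf Mf]] := separating_function gs gQ.
have [t ut] := uniformizer_ex F hS gQ; have nt := uniformizer_neq0 dcu gQ ut.
have ntj : t ^ j != 0 by rewrite expfz_neq0.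
have [N hN] := int_bound s (fun R => e%:Z - vord R (t ^ j)).
have nf : f != 0 by case: Uf.
exists (f ^+ N * t ^ j); split; first by rewrite mulf_neq0 // expf_neq0.
  by apply: (vordE hS dcu gQ); apply: ord_intro => //; apply: O_units_X.
move=> R hR nR; have gR := gs R hR; right.
rewrite (vordM hS dcu gR) ?expf_neq0 // (vordX hS dcu gR) //.
have : 1 <= vord R f by apply: vge_neq0 => //; apply/(vge1 hS dcu gR); apply: Mf.
have := hN R hR; move: (vord R f) (vord R _) => a b; rewrite -mulr_natr; nia.
Qed.

Lemma vge_hor P x (p : {poly algC}) : geom_points C P -> 0 < vord P x ->
  vge P (vord P x) (hor kappa p x - kappa p.[0]).
Proof.
move=> gP hx; have Ox : local_ring P x.
  by apply/(vge0 hS dcu gP); right; apply: ltW.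
have [q {1}->] := poly_const0 p; rewrite horD horM horX horC addrK.
rewrite -{1}[vord P x]add0r; apply: (vge_M hS dcu gP); last exact: vge_vord.
by apply/(vge0 hS dcu gP); apply: O_hor.
Qed.

(** If the zeros of x counted with multiplicity were three or more, there would be three pairs (Q,
    j) with j < v_Q(x), and functions of order j at Q, small at the other zeros. These are
    independent modulo x, whereas any three functions are dependent over k(x). *)
Lemma fibre_bound x s : (forall c, x <> kappa c) -> simple_ext kappa x u -> uniq s ->
  (forall P, P \in s -> geom_points C P /\ 0 < vord P x) -> \sum_(P <- s) vord P x <= 2.
Proof.
move=> nx xu us hs; rewrite leNgt; apply/negP => big.
have gs P : P \in s -> geom_points C P by move/hs => [].
pose L := [seq (Q, j) | Q <- s, j <- iota 0 `|vord Q x|].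
have sL : (3 <= size L)%N.
  have : (size L)%:Z = \sum_(P <- s) vord P x.
    rewrite size_allpairs_dep sumnE big_map (big_morph Posz PoszD (erefl _)).
    by apply: eq_big_seq => P /hs[_ h]; rewrite size_iota; lia.
  by lia.
have uL : uniq L.
  apply: allpairs_uniq_dep => //; first by move=> *; apply: iota_uniq.
  by move=> [a b] [c d] /= _ _ [-> ->].
have inL Q j : (Q, j) \in L -> Q \in s /\ (j%:Z < vord Q x).
  case/allpairsPdep => Q' [j' [hQ]]; rewrite mem_iota => /andP[_ lt] [-> ->].
  by split=> //; have [_] := hs _ hQ; lia.
pose p (i : 'I_3) := tnth (in_tuple L) (widen_ord sL i).
have pL i : p i \in L by apply: mem_tnth.
have p_inj : injective p.
  by move=> a b; rewrite /p => /(tuple_uniqP (in_tuple L) uL) /(congr1 val) /= e; apply: val_inj.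
have [E hE] := int_bound s (fun Q => vord Q x).
have /fin_all_exists[g hg] : forall i, exists g, [/\ g != 0, vord (p i).1 g = (p i).2%:Z &
    forall R, R \in s -> R <> (p i).1 -> vge R E%:Z g].
  move=> i; apply: approximation => //; case: (p i) (pL i) => Q j /inL[]; by move=> /gs.
have [b [[i0 nb] hb]] := poly_dep g dcu nx xu.
(* Among the terms with nonzero constant coefficient, the one of least j dominates at its own point:
   terms at the same point have larger j, and the others are small there. *)
case: (arg_minnP (P := fun i => (b i).[0] != 0) (fun i => (p i).2) nb) => i ni imin.
have [ps jlt] : (p i).1 \in s /\ ((p i).2%:Z < vord (p i).1 x).
  by apply: inL; rewrite -surjective_pairing.
have [gi vi _] := hg i; have gP := gs _ ps.
pose S := \sum_i kappa (b i).[0] * g i.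
have [nS vS] : S != 0 /\ vord (p i).1 S = (p i).2%:Z.
  have nk : kappa (b i).[0] * g i != 0 by rewrite mulf_neq0 // fmorph_eq0.
  have vk : vord (p i).1 (kappa (b i).[0] * g i) = (p i).2%:Z.
    by rewrite (vordM hS dcu gP) ?fmorph_eq0 // (vord_const hS dcu gP) // add0r.
  rewrite /S (bigD1 i) //= -vk; apply: (vord_lead hS dcu gP) => //; rewrite vk.
  apply: (vge_sum hS dcu gP) => // l nl; have [->|nbl] := eqVneq (b l).[0] 0.
    by left; rewrite rmorph0 mul0r.
  apply: (vge_scale hS dcu gP) => //; have [gl vl Rl] := hg l.
  have le := imin l nbl; case: (classic ((p i).1 = (p l).1)) => e.
    right; rewrite e vl; suff : (p l).2 <> (p i).2.
      by move: le; move: (p i).2 (p l).2; clear => a b; lia.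
    move=> e2; move/eqP: nl; apply; apply: p_inj.
    by rewrite (surjective_pairing (p l)) e2 -e -surjective_pairing.
  apply: vge_le (Rl _ ps e); move: jlt (hE _ ps).
  by move: (p i).2 (vord _ x); clear => a b; lia.
(* The relation rewrites S as a combination of the b_l(x) - b_l(0), all divisible by x at this
   point; this contradicts the order j < v(x) just found. *)
have : vge (p i).1 (vord (p i).1 x) S.
  have -> : S = - \sum_l (hor kappa (b l) x - kappa (b l).[0]) * g l.
    apply/eqP; rewrite -addr_eq0 -big_split /= -[X in _ == X]hb; apply/eqP.
    by apply: eq_bigr => l _; ring.
  apply: (vge_N hS dcu gP) => //; apply: (vge_sum hS dcu gP) => // l _; rewrite -[vord _ x]addr0.
  apply: (vge_M hS dcu gP) => //; first by apply: vge_hor => //; have [_] := hs _ ps.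
  have [gl vl Rl] := hg l; case: (classic ((p i).1 = (p l).1)) => e.
    by right; rewrite e vl.
  by apply: vge_le (Rl _ ps e).
by move/(vge_neq0 nS); rewrite vS leNgt jlt.
Qed.

End Fibres.

(** * Riemann-Roch spaces *)

Section Dimension.
Import GRing.Theory Num.Theory Order.TTheory.
Local Open Scope ring_scope.
Variables (C : proj_scheme) (F : geom_function_field C).
Local Notation K := (ff_sort F).
Local Notation kappa := (ff_const F).
Local Notation pt := (ppoint algC (pdim C)).
Local Notation RR := (@riemann_roch_space C F).

Definition indep N (g : 'I_N -> K) :=
  forall c : 'I_N -> algC, \sum_i kappa (c i) * g i = 0 -> forall i, c i = 0.

(** An upper bound for the dimension that requires no basis, so that it passes from L(D) to L(D + E)
    without any finiteness argument. *)
Definition dim_le (V : K -> Prop) (r : int) :=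
  forall N (g : 'I_N -> K), (forall i, V (g i)) -> indep g -> N%:Z <= r.

Lemma dim_over_le V l : dim_over (@constants C F) V l -> dim_le V l.
Proof.
case=> b [span _] N g Vg ig; rewrite lez_nat leqNgt; apply/negP => lN.
have : forall i, exists a : 'I_l -> algC, g i = \sum_j kappa (a j) * b j.
  move=> i; have [c [hc ->]] := (span (g i)).1 (Vg i).
  have [a ha] := fin_all_exists hc; exists a.
  by apply: eq_bigr => j _; rewrite ha.
move=> /fin_all_exists[a ha].
pose A : 'M[algC]_(N, l) := \matrix_(i, j) a i j.
have : kermx A != 0.
  rewrite kermx_eq0 /row_free neq_ltn; apply/orP; left.
  by apply: leq_ltn_trans lN; apply: rank_leq_col.
move=> /rowV0Pn[c /sub_kermxP cA nc]; case/eqP: nc.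
apply/rowP => i; rewrite [RHS]mxE; apply: (ig (fun i => c 0 i)).
under eq_bigr do rewrite ha mulr_sumr.
rewrite exchange_big big1 //= => j _.
under eq_bigr do rewrite mulrA -rmorphM.
rewrite -mulr_suml -rmorph_sum; have := congr1 (fun X : 'rV_l => X 0 j) cA.
rewrite !mxE => e0; rewrite [X in kappa X](_ : _ = 0) ?rmorph0 ?mul0r // -[RHS]e0.
by apply: eq_bigr => i0 _; rewrite mxE.
Qed.

Lemma coeff_sum (I : Type) (r : seq I) (G : I -> {freeg pt / int}) P :
  coeff P (\sum_(i <- r) G i) = \sum_(i <- r) coeff P (G i).
Proof. by apply: (big_morph (coeff P)) => [D E|]; rewrite ?coeffD ?coeff0. Qed.

Lemma deg_sum (I : Type) (r : seq I) (G : I -> {freeg pt / int}) :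
  deg (\sum_(i <- r) G i) = \sum_(i <- r) deg (G i).
Proof. by apply: (big_morph (@deg pt)) => [D E|]; rewrite ?degD ?deg0. Qed.

Lemma deg_coeff (D : {freeg pt / int}) : deg D = \sum_(P <- dom D) coeff P D.
Proof. by rewrite -{1}[D]freeg_sumE deg_sum; apply: eq_bigr => P _; rewrite degU. Qed.

Hypothesis hS : smooth_of_dim C 1.
Variable u : K.
Hypothesis dcu : double_cover u.
Implicit Types (f g t : K) (P Q R : pt) (D E : {freeg pt / int}).

(** The leading coefficient at [P] is a linear form on L(D + P) with kernel L(D). Subtracting
    multiples of one pivot turns N + 1 independent functions of L(D + P) into N independent
    functions of L(D). *)
Lemma dim_le_point D P r : geom_points C P -> dim_le (RR D) r -> dim_le (RR (D + << P >>)) (r + 1).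
Proof.
move=> gP hD [|N] g Vg ig.
  have : 0%:Z <= r by apply: (hD 0%N (fun _ => 0)) => [[]|c _ []].
  by clear; lia.
suff [k [e he]] : exists k (e : 'I_N -> algC), forall i, RR D (g (fintype.lift k i) - kappa (e i) * g k).
  have : N%:Z <= r; last by clear; lia.
  apply: (hD _ _ he) => c hc i.
  pose c' j := if unlift k j is Some i then c i else - \sum_i c i * e i.
  have : \sum_j kappa (c' j) * g j = 0.
    rewrite (bigD1_ord k) //= /c' unlift_none -[RHS]hc.
    under eq_bigr do rewrite liftK.
    under [RHS]eq_bigr do rewrite mulrBr mulrA -rmorphM.
    by rewrite sumrB -mulr_suml -rmorph_sum rmorphN mulNr addrC.
  by move/ig/(_ (fintype.lift k i)); rewrite /c' liftK.
have [t ut] := uniformizer_ex F hS gP; have nt := uniformizer_neq0 dcu gP ut.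
pose m := - coeff P D.
have : forall i, exists a, exists2 o, maximal_ideal P (o - kappa a) & g i = o * t ^ (m - 1).
  move=> i; have /(_ P gP) := (riemann_roch_vge hS dcu _ _).1 (Vg i).
  rewrite coeffD coeffU eqxx mulr1 opprD -/m => /(vgeP hS dcu gP _ _ ut)[o Oo ->].
  by have [a Ma] := O_value gP Oo; exists a, o.
move=> /fin_all_exists[a] /fin_all_exists2[o Mo go].
(* The pivot is a function with nonzero leading coefficient; if there is none, all functions already
   lie in L(D) and any pivot will do. *)
have [k [e ke]] : exists k (e : 'I_N -> algC), forall i, a (fintype.lift k i) = e i * a k.
  case: (classic (exists k, a k != 0)) => [[k nk]|h].
    by exists k, (fun i => a (fintype.lift k i) / a k) => i; rewrite divfK.
  have a0 i : a i = 0 by apply/eqP/negP => /negP ni; apply: h; exists i.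
  by exists ord0, (fun=> 0) => i; rewrite !a0 mulr0.
exists k, e => i; apply/(riemann_roch_vge hS dcu) => Q gQ.
case: (classic (P = Q)) => [<-|nPQ].
  rewrite -/m !go mulrA -mulrBl.
  rewrite {1}(_ : m = 1 + (m - 1)); last by rewrite addrC subrK.
  apply: (vge_M hS dcu gP); last by apply/(vgeP hS dcu gP _ _ ut); exists 1; [exact: O_1|rewrite mul1r].
  apply/(vge1 hS dcu gP).
  have -> : o (fintype.lift k i) - kappa (e i) * o k =
    (o (fintype.lift k i) - kappa (a (fintype.lift k i))) - kappa (e i) * (o k - kappa (a k)).
    by rewrite ke rmorphM; ring.
  by apply: M_B => //; apply: M_Ol => //; apply: O_const.
have VQ j : vge Q (- coeff Q D) (g j).
  have /(_ Q gQ) := (riemann_roch_vge hS dcu _ _).1 (Vg j).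
  by rewrite coeffD coeffU (introF eqP nPQ) mulr0 addr0.
by apply: (vge_D hS dcu gQ) => //; apply: (vge_N hS dcu gQ); apply: (vge_scale hS dcu gQ).
Qed.

(** One point at a time. In other words deg - l does not decrease when an effective divisor is
    added, which is how a lower bound on deg D + 1 - l(D) is carried to larger divisors. *)
Lemma dim_le_effective D E r : is_divisor E -> (forall P, 0 <= coeff P E) ->
  dim_le (RR D) r -> dim_le (RR (D + E)) (r + deg E).
Proof.
move=> dE pE hD.
move sz : `|deg E|%N => N; elim: N E r dE pE hD sz => [|N IH] E r dE pE hD sz.
  have d0 : deg E = 0 by move: sz; clear; lia.
  have pE' : fgle 0 E by apply/fgposP.
  by rewrite d0 (fgpos_eq0P pE' d0) !addr0.
have : dom E != [::].
  by rewrite dom_eq0; apply/eqP => E0; move: sz; rewrite E0 deg0.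
case eD : (dom E) => [//|P s] _.
have Pd : P \in dom E by rewrite eD inE eqxx.
have cP : 1 <= coeff P E.
  by have := pE P; move: Pd; rewrite mem_dom; move: (coeff P E); clear => z; lia.
have dpos : deg E = N.+1%:Z.
  have : 0 <= deg E by rewrite deg_coeff; apply: sumr_ge0 => Q _; apply: pE.
  by move: sz; clear; lia.
have -> : D + E = (D + (E - << P >>)) + << P >> by rewrite -addrA subrK.
have -> : r + deg E = (r + deg (E - << P >>)) + 1 by rewrite degB degU addrA subrK.
apply: dim_le_point; first exact: dE.
apply: IH => //.
- move=> Q; rewrite mem_dom coeffB coeffU; have [<- _|nPQ] := eqVneq P Q; first exact: dE.
  by rewrite mulr0 subr0 -mem_dom; apply: dE.
- move=> Q; rewrite coeffB coeffU; have [<-|nPQ] := eqVneq P Q.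
    by rewrite mulr1 subr_ge0.
  by rewrite mulr0 subr0; exact: pE.
- by rewrite degB degU dpos; clear; lia.
Qed.

End Dimension.

(** * Zeros and poles of u, and the dimension of L(k (P1 + P2)) *)

Section Hyperelliptic.
Import GRing.Theory Num.Theory Order.TTheory.
Local Open Scope ring_scope.
Variables (C : proj_scheme) (F : geom_function_field C).
Local Notation K := (ff_sort F).
Local Notation kappa := (ff_const F).
Local Notation pt := (ppoint algC (pdim C)).
Local Notation RR := (@riemann_roch_space C F).
Local Notation gp := (geom_points C).
Hypothesis hS : smooth_of_dim C 1.
Variable u : K.
Hypothesis dcu : double_cover u.
Implicit Types (f g t : K) (P Q R : pt) (D E : {freeg pt / int}).

Lemma u_neq0 : u != 0.
Proof. by apply/eqP => u0; apply: (dc_nonconst dcu (c := 0)); rewrite u0 rmorph0. Qed.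

Lemma shift_nonconst a c : u - kappa a <> kappa c.
Proof. by move=> e; apply: (dc_nonconst dcu (c := c + a)); rewrite rmorphD -e subrK. Qed.

Lemma shift_neq0 a : u - kappa a != 0.
Proof. by apply/eqP => e; apply: (@shift_nonconst a 0); rewrite e rmorph0. Qed.

Lemma shift_ext a : simple_ext kappa (u - kappa a) u.
Proof.
rewrite -{2}(subrK (kappa a) u); apply: ext_D; [exact: ext_gen|exact: ext_const].
Qed.

Lemma shift_regular P a : gp P -> local_ring P u -> 0 <= vord P (u - kappa a).
Proof.
move=> gP Ou; apply: (vge_neq0 (shift_neq0 a)); apply/(vge0 hS dcu gP).
by apply: O_B => //; apply: O_const.
Qed.

Lemma regular_value P : gp P -> local_ring P u -> exists a, 0 < vord P (u - kappa a).
Proof.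
move=> gP /(O_value gP)[a /(vge1 hS dcu gP)].
by move=> /(vge_neq0 (shift_neq0 a)) h; exists a.
Qed.

(** A list that does not exhaust [S] can be extended, and the bound forbids extending beyond length
    k. *)
Lemma finite_fibre (S : pt -> Prop) k :
  (forall s, uniq s -> (forall P, P \in s -> S P) -> (size s <= k)%N) ->
  exists2 s, uniq s & forall P, P \in s <-> S P.
Proof.
move=> hk; apply: NNPP => h.
have : forall j, exists s, [/\ uniq s, forall P, P \in s -> S P & size s = j].
  elim=> [|j [s [us hs <-]]]; first by exists nil.
  have [P hP nP] : exists2 P, S P & P \notin s.
    apply: NNPP => h'; apply: h; exists s => // P; split=> [/hs//|hP].
    by apply/negPn/negP => nP; apply: h'; exists P.
  exists (P :: s); split => //=; first by rewrite nP.
  by move=> Q; rewrite inE => /orP[/eqP -> //|/hs].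
by move=> /(_ k.+1)[s [us hs ss]]; have := hk s us hs; rewrite ss ltnn.
Qed.

(** The divisor of zeros of u - a; [Num.max 0] cuts off the poles, and [fibre_bound] gives both the
    finiteness of the support and the degree. *)
Lemma fibre_divisor a : exists Z : {freeg pt / int},
  [/\ is_divisor Z, deg Z <= 2 &
      forall P, gp P -> coeff P Z = Num.max 0 (vord P (u - kappa a))].
Proof.
pose S P := gp P /\ 0 < vord P (u - kappa a).
have bd s : uniq s -> (forall P, P \in s -> S P) -> \sum_(P <- s) vord P (u - kappa a) <= 2.
  by move=> us hs; apply: (fibre_bound hS dcu (@shift_nonconst a) (shift_ext a)).
have [|s us hs] := @finite_fibre S 2.
  move=> s us hs; have := bd s us hs.
  have : (size s)%:Z <= \sum_(P <- s) vord P (u - kappa a).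
    have -> : (size s)%:Z = \sum_(P <- s) 1 by rewrite big_const_seq count_predT iter_addr_0 natz.
    by rewrite big_seq [X in _ <= X]big_seq; apply: ler_sum => P /hs[_].
  by move: (\sum_(P <- s) _) => z; clear; lia.
exists (\sum_(P <- s) << vord P (u - kappa a) *g P >>).
have cZ P : coeff P (\sum_(P <- s) << vord P (u - kappa a) *g P >>)
    = if P \in s then vord P (u - kappa a) else 0.
  rewrite coeff_sum; under eq_bigr do rewrite coeffU.
  case: ifP => [Ps|nPs].
    rewrite (bigD1_seq P) //= eqxx mulr1 big1 ?addr0 // => Q /negbTE ->.
    by rewrite mulr0.
  rewrite big_seq big1 // => Q Qs; rewrite (_ : (Q == P) = false) ?mulr0 //.
  by apply: contraFF nPs => /eqP <-.
split=> [P||P gP].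
- by rewrite mem_dom cZ; case: ifP => [/hs[]|_ /eqP].
- rewrite deg_sum; under eq_bigr do rewrite degU.
  by apply: bd => // P /hs.
- rewrite cZ; case: ifPn => [/hs[_ h]|nPs]; first by rewrite max_r // ltW.
  rewrite max_l // leNgt; apply/negP => h; move/negP: nPs; apply; by apply/hs.
Qed.

Lemma zero_divisor (s : seq algC) : exists Z : {freeg pt / int},
  [/\ is_divisor Z, deg Z <= 2 *+ size s &
      forall P, gp P -> coeff P Z = \sum_(a <- s) Num.max 0 (vord P (u - kappa a))].
Proof.
elim: s => [|a s [Z [dZ degZ cZ]]].
  exists 0; split=> [P||P _]; rewrite ?dom0 ?deg0 //.
  by rewrite coeff0 big_nil.
have [Y [dY degY cY]] := fibre_divisor a; exists (Y + Z); split=> [P||P gP].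
- by move=> /domD_subset; rewrite mem_cat => /orP[/dY|/dZ].
- by rewrite degD mulrS lerD.
- by rewrite coeffD big_cons cY // cZ.
Qed.

(** For every point P of the list, N copies of the value u(P) are taken; each copy contributes at
    least 1 at P. *)
Lemma zero_divisor_dominates (s : seq pt) (N : nat) :
  (forall P, P \in s -> gp P /\ local_ring P u) ->
  exists l : seq algC, forall P, P \in s ->
    N%:Z <= \sum_(a <- l) Num.max 0 (vord P (u - kappa a)).
Proof.
have pos P (l : seq algC) : 0 <= \sum_(a <- l) Num.max 0 (vord P (u - kappa a)).
  by apply: sumr_ge0 => a _; rewrite le_max lexx.
elim: s => [|Q s IH] hs; first by exists nil.
have [|l hl] := IH; first by move=> P hP; apply: hs; rewrite inE hP orbT.
have [gQ Ou] : gp Q /\ local_ring Q u by apply: hs; rewrite inE eqxx.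
have [a ha] := regular_value gQ Ou.
exists (nseq N a ++ l) => P; rewrite inE big_cat /= => /orP[/eqP ->|/hl h]; last first.
  by rewrite -[N%:Z]add0r; apply: lerD.
rewrite -[N%:Z]addr0; apply: lerD => //.
have -> : N%:Z = \sum_(b <- nseq N a) 1.
  by rewrite big_const_seq count_predT size_nseq iter_addr_0 natz.
rewrite big_seq [X in _ <= X]big_seq; apply: ler_sum => b.
rewrite mem_nseq => /andP[_ /eqP ->].
by rewrite le_max; apply/orP; right; exact: ha.
Qed.

Lemma vord_prod_shift P (l : seq algC) : gp P ->
  vord P (\prod_(a <- l) (u - kappa a)) = \sum_(a <- l) vord P (u - kappa a).
Proof.
move=> gP; elim: l => [|a l IH]; first by rewrite !big_nil (vord1 hS dcu gP).
rewrite !big_cons (vordM hS dcu gP) ?IH ?shift_neq0 //.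
by rewrite prodf_seq_neq0; apply/allP => b _; rewrite shift_neq0.
Qed.

Variables P1 P2 : pt.
Hypotheses (gP1 : gp P1) (gP2 : gp P2) (nP12 : P1 <> P2).
Hypotheses (pole1 : 0 < vord P1 u^-1) (pole2 : 0 < vord P2 u^-1).

Lemma inv_nonconst c : u^-1 <> kappa c.
Proof. by move=> e; apply: (dc_nonconst dcu (c := c^-1)); rewrite fmorphV -e invrK. Qed.

Lemma inv_ext : simple_ext kappa u^-1 u.
Proof. by rewrite -{2}[u]invrK; apply: ext_V; apply: ext_gen. Qed.

(** The orders of 1 / u at the two points are positive with sum at most 2, so both are 1. *)
Lemma vord_u_pole P : P = P1 \/ P = P2 -> vord P u = -1.
Proof.
have /(fibre_bound hS dcu inv_nonconst inv_ext) : uniq [:: P1; P2].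
  by rewrite /= inE andbT; apply/eqP.
move=> h; have {h} : \sum_(P <- [:: P1; P2]) vord P u^-1 <= 2.
  by apply: h => Q; rewrite !inE => /orP[]/eqP ->.
rewrite !big_cons big_nil addr0 => le.
have e Q : gp Q -> vord Q u = - vord Q u^-1.
  by move=> gQ; rewrite (vordV hS dcu gQ u_neq0) opprK.
by case=> ->; rewrite e //; move: pole1 pole2 le;
  move: (vord P1 _) (vord P2 _); clear => a b; lia.
Qed.

(** A third pole of u would raise the number of zeros of 1 / u to three. *)
Lemma pole_or_regular P : gp P -> (P = P1 \/ P = P2) \/ (P <> P1 /\ P <> P2 /\ local_ring P u).
Proof.
move=> gP; case: (classic (P = P1)) => [->|n1]; first by left; left.
case: (classic (P = P2)) => [->|n2]; first by left; right.
case: (dc_regular dcu gP) => [h|]; first by right.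
move=> /(vge1 hS dcu gP)/(vge_neq0 (invr_neq0 u_neq0)) h.
have /(fibre_bound hS dcu inv_nonconst inv_ext) : uniq [:: P; P1; P2].
  by rewrite /= !inE andbT negb_or; apply/andP; split; [apply/andP; split|]; apply/eqP.
move=> h'; have {h'} : \sum_(P <- [:: P; P1; P2]) vord P u^-1 <= 2.
  by apply: h' => Q; rewrite !inE => /or3P[]/eqP ->.
rewrite !big_cons big_nil addr0; move: h pole1 pole2.
by move: (vord P _) (vord P1 _) (vord P2 _); clear => a b c; lia.
Qed.

Lemma regular_not_pole P : gp P -> local_ring P u -> P <> P1 /\ P <> P2.
Proof.
move=> gP /(vge0 hS dcu gP)/(vge_neq0 u_neq0) h.
by split=> e; move: h; rewrite vord_u_pole //; [left|right].
Qed.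

(** This is L(k (P1 + P2)): by [pole_or_regular] and [regular_not_pole], the points where u is
    regular are exactly those other than P1 and P2. *)
Definition pole_space (k : nat) f := forall P, gp P ->
  (P = P1 \/ P = P2 -> vge P (- k%:Z) f) /\ (local_ring P u -> vge P 0 f).

Lemma vord_shift_pole a P : P = P1 \/ P = P2 -> vord P (u - kappa a) = -1.
Proof.
move=> hP; have gP : gp P by case: hP => ->.
have e := vord_u_pole hP; rewrite -e.
have [] // : u - kappa a != 0 /\ vord P (u - kappa a) = vord P u.
apply: (vord_lead hS dcu gP u_neq0); rewrite -rmorphN; apply: (vge_const hS dcu gP).
by rewrite e.
Qed.

(* With h = prod (u - a) vanishing enough on the support of D, one has
   D <= (zeros of h) + n (P1 + P2), and L of the right-hand side is
   h^-1 L((deg h + n) (P1 + P2)). *)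
Lemma pole_space_bound D l : is_divisor D ->
  dim_over (@constants C F) (RR D) l -> 2 <= deg D + 1 - l%:Z ->
  exists k0 : nat, forall k N (g : 'I_N -> K), (k0 <= k)%N ->
    (forall i, pole_space k (g i)) -> indep g -> (N < k.*2)%N.
Proof.
move=> dD /dim_over_le hD gen.
pose reg := [seq P <- dom D | if excluded_middle_informative (local_ring P u) then true else false].
have regP P : P \in reg -> gp P /\ local_ring P u.
  by rewrite mem_filter; case: excluded_middle_informative => //= Ou /dD.
have [n0 hn0] := int_bound (dom D) (fun P => coeff P D).
have cD P : coeff P D <= n0%:Z.
  have [/hn0//|/coeff_outdom ->] := boolP (P \in dom D); by clear; lia.
have [s hs] := zero_divisor_dominates n0 regP.
have [Z [dZ degZ cZ]] := zero_divisor s.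
pose h := \prod_(a <- s) (u - kappa a).
have nh : h != 0 by rewrite prodf_seq_neq0; apply/allP => b _; rewrite shift_neq0.
(* [h] has a pole of order [size s] at P1 and at P2, so dividing a function of L(k (P1 + P2)) by [h]
   leaves poles of order at most n there. The choice of k0 ensures n >= n0, the bound for the
   coefficients of D. *)
exists (size s + n0)%N => k N g le gk ig; pose n := (k - size s)%N.
have ek : k = (size s + n)%N by rewrite /n subnKC // (leq_trans _ le) // leq_addr.
have le0 : (n0 <= n)%N by move: le; rewrite ek leq_add2l.
clearbody n; pose D' := Z + (<< n%:Z *g P1 >> + << n%:Z *g P2 >>).
have cH P : coeff P (<< n%:Z *g P1 >> + << n%:Z *g P2 >>) =
    if (P == P1) || (P == P2) then n%:Z else 0.
  rewrite coeffD !coeffU eq_sym [P2 == P]eq_sym; case: (eqVneq P P1) => [->|_] /=.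
    by rewrite (introF eqP nP12) mulr1 mulr0 addr0.
  by case: (eqVneq P P2) => _; rewrite ?mulr1 !mulr0 ?addr0 ?add0r.
have cZreg P : gp P -> local_ring P u -> coeff P Z = vord P h.
  move=> gP Ou; rewrite cZ // /h vord_prod_shift //; apply: eq_bigr => a _.
  by rewrite max_r //; apply: shift_regular.
have cZpole P : P = P1 \/ P = P2 -> coeff P Z = 0 /\ vord P h = - (size s)%:Z.
  move=> hP; have gP : gp P by case: hP => ->.
  rewrite cZ // /h vord_prod_shift //; split.
    by rewrite big1 // => a _; rewrite vord_shift_pole.
  under eq_bigr do rewrite vord_shift_pole //.
  by rewrite big_const_seq count_predT iter_addr_0 mulNrn natz.
have Zpos P : 0 <= coeff P Z.
  have [/dZ gP|/coeff_outdom -> //] := boolP (P \in dom Z).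
  by rewrite cZ //; apply: sumr_ge0 => a _; rewrite le_max lexx.
have n0n : n0%:Z <= n%:Z by rewrite lez_nat.
have pE P : 0 <= coeff P (D' - D).
  rewrite coeffB subr_ge0 /D' coeffD cH; case: ifPn => [_|].
    by rewrite -[coeff P D]add0r; apply: lerD => //; apply: le_trans (cD P) n0n.
  rewrite negb_or addr0 => /andP[/eqP n1 /eqP n2].
  have [Pd|/coeff_outdom -> //] := boolP (P \in dom D).
  case: (pole_or_regular (dD _ Pd)) => [[//|//]|[_ [_ Ou]]].
  rewrite cZ; last exact: dD.
  apply: le_trans (cD P) _; apply: hs; rewrite mem_filter Pd andbT.
  by case: excluded_middle_informative.
have dE : is_divisor (D' - D).
  move=> P; rewrite mem_dom coeffB coeffD cH => nz.
  have [/dZ //|/coeff_outdom z0] := boolP (P \in dom Z).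
  have [/dD //|/coeff_outdom d0] := boolP (P \in dom D).
  move: nz; rewrite z0 d0; case: ifPn => [/orP[]/eqP -> //|_].
  by rewrite addr0 subr0 eqxx.
have := dim_le_effective hS dcu dE pE hD; rewrite addrC subrK.
move=> /(_ N (fun i => g i / h)) bd.
have : N%:Z <= l%:Z + deg (D' - D).
  apply: bd => [i|c hc]; last first.
    apply: ig; apply: (mulIf (invr_neq0 nh)); rewrite mul0r -[RHS]hc mulr_suml.
    by apply: eq_bigr => i _; rewrite mulrA.
  apply/(riemann_roch_vge hS dcu) => P gP; have [hp hr] := gk i P gP.
  case: (pole_or_regular gP) => [hP|[n1 [n2 Ou]]].
    have [z0 vh] := cZpole P hP.
    have -> : - coeff P D' = - k%:Z + (size s)%:Z.
      rewrite /D' coeffD cH z0; have -> : (P == P1) || (P == P2).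
        by apply/orP; case: hP => ->; rewrite eqxx; [left|right].
      by rewrite ek; clear; lia.
    apply: (vge_M hS dcu gP); first exact: hp.
    by right; rewrite (vordV hS dcu gP nh) vh opprK.
  have -> : - coeff P D' = 0 - vord P h.
    rewrite /D' coeffD cH (introF eqP n1) (introF eqP n2) /= addr0 sub0r.
    by rewrite cZreg.
  apply: (vge_M hS dcu gP); first exact: hr.
  by right; rewrite (vordV hS dcu gP nh).
(* N <= l + deg Z + 2 n - deg D, where deg Z <= 2 [size s] and l <= deg D - 1; so N <= 2 k - 1. *)
rewrite degB /D' !degD !degU -ltz_nat; move: degZ gen.
rewrite -mulr_natr natz ek; move: (deg Z) (deg D) (size s) => z d m.
by clear; lia.
Qed.

End Hyperelliptic.

(** * Functions with poles bounded by 2 (P1 + P2) *)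

Section PolarPart.
Import GRing.Theory Num.Theory Order.TTheory.
Local Open Scope ring_scope.
Variables (C : proj_scheme) (F : geom_function_field C).
Local Notation K := (ff_sort F).
Local Notation kappa := (ff_const F).
Local Notation pt := (ppoint algC (pdim C)).
Local Notation RR := (@riemann_roch_space C F).
Local Notation gp := (geom_points C).
Implicit Types (f g t x : K) (P Q R : pt) (D E : {freeg pt / int}).

Lemma poly_of_family N (c : 'I_N -> algC) : exists p : {poly algC},
  (forall i : 'I_N, p`_i = c i) /\ forall x, hor kappa p x = \sum_i kappa (c i) * x ^+ i.
Proof.
pose p : {poly algC} := \poly_(i < N) oapp c 0 (insub i).
have pE (i : 'I_N) : p`_i = c i by rewrite coef_poly ltn_ord valK.
exists p; split=> // x; rewrite /hor (@horner_coef_wide _ N) ?size_map_poly ?size_poly //.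
by apply: eq_bigr => i _; rewrite coef_map pE.
Qed.

Lemma indep_powers x N : (forall c, x <> kappa c) -> indep (fun i : 'I_N => x ^+ i).
Proof.
move=> nx c hc i; have [p [pE hp]] := poly_of_family c.
by rewrite -pE; have -> : p = 0; [apply: (hor_eq0 nx); rewrite hp|rewrite coef0].
Qed.

Hypothesis hS : smooth_of_dim C 1.
Variable u : K.
Hypothesis dcu : double_cover u.

(** At a simple pole of u the leading term dominates; [1 - size p] is minus the degree of p, and it
    is the same at P1 and P2. *)
Lemma vord_hor_pole P (p : {poly algC}) : gp P -> vord P u = -1 -> p != 0 ->
  vord P (hor kappa p u) = 1 - (size p)%:Z.
Proof.
move=> gP vu; elim/poly_ind: p => [|p c IH]; first by rewrite eqxx.
have [->|np _] := eqVneq p 0.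
  rewrite mul0r add0r polyC_eq0 => nc; rewrite horC size_polyC nc.
  by rewrite (vord_const hS dcu gP) // subrr.
have nh q : q != 0 -> hor kappa q u != 0.
  by move=> nq; apply: contra_neq nq; apply: hor_eq0; apply: dc_nonconst dcu.
rewrite size_MXaddC (negbTE np) /= horD horM horX horC.
have nu := u_neq0 dcu; have nm : hor kappa p u * u != 0 by rewrite mulf_neq0 // nh.
have vm : vord P (hor kappa p u * u) = 1 - (size p).+1%:Z.
  by rewrite (vordM hS dcu gP) ?nh // IH // vu; move: (size p); clear; lia.
rewrite -vm; apply: (vord_lead hS dcu gP nm _).2; apply: (vge_const hS dcu gP).
by rewrite vm; move: np; rewrite -size_poly_gt0; move: (size p); clear; lia.
Qed.

Variables P1 P2 : pt.
Hypotheses (gP1 : gp P1) (gP2 : gp P2) (nP12 : P1 <> P2).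
Hypotheses (pole1 : 0 < vord P1 u^-1) (pole2 : 0 < vord P2 u^-1).
Let vpole P := vord_u_pole hS dcu gP1 gP2 nP12 pole1 pole2 (P := P).

Lemma pole_space_u (k i : nat) : (i <= k)%N -> pole_space u P1 P2 k (u ^+ i).
Proof.
move=> ik P gP; split=> [hP|Ou].
  right; rewrite (vordX hS dcu gP) ?(u_neq0 dcu) // (vpole hP) mulNrn natz.
  by move: ik; clear; lia.
by apply/(vge0 hS dcu gP); apply: O_X.
Qed.

Lemma pole_space_M (k i : nat) f g :
  pole_space u P1 P2 k f -> pole_space u P1 P2 i g -> pole_space u P1 P2 (k + i) (f * g).
Proof.
move=> hf hg P gP; have [a b] := hf P gP; have [a' b'] := hg P gP; split=> [hP|Ou].
  by rewrite PoszD opprD; apply: (vge_M hS dcu gP); [exact: a|exact: a'].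
by rewrite -[0]addr0; apply: (vge_M hS dcu gP); [exact: b|exact: b'].
Qed.

Hypothesis dim_bound : exists k0 : nat, forall k N (g : 'I_N -> K), (k0 <= k)%N ->
    (forall i, pole_space u P1 P2 k (g i)) -> indep g -> (N < k.*2)%N.

Lemma pole_space2_ext f : pole_space u P1 P2 2 f -> simple_ext kappa u f.
Proof.
move=> hf; have [k0 bd] := dim_bound; apply: NNPP => nf.
(* With k = k0 + 2 these are k + 1 powers of u and k - 1 products f u^b, hence 2 k functions in L(k
   (P1 + P2)), one more than [dim_bound] allows. *)
pose g (i : 'I_(k0.+3 + k0.+1)) : K :=
  match fintype.split i with inl a => u ^+ a | inr b => f * u ^+ b end.
suff : (k0.+3 + k0.+1 < k0.+2.*2)%N by clear; lia.
apply: (bd _ _ g) => [|i|c].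
- by clear; lia.
- rewrite /g; case: (fintype.split i) => a; first by apply: pole_space_u; rewrite -ltnS.
  by rewrite -[k0.+2]/(2 + k0)%N; apply: pole_space_M => //; apply: pole_space_u; rewrite -ltnS.
rewrite big_split_ord /=; under eq_bigr do rewrite /g (unsplitK (inl _)).
under [X in _ + X]eq_bigr do rewrite /g (unsplitK (inr _)) mulrCA.
rewrite -mulr_sumr.
have [p [pE <-]] := poly_of_family (fun i : 'I_k0.+3 => c (lshift _ i)).
have [q [qE <-]] := poly_of_family (fun i : 'I_k0.+1 => c (rshift _ i)).
move=> e0; have q0 : q = 0.
  apply: (hor_eq0 (dc_nonconst dcu)); apply/eqP/negP => /negP nq; apply: nf.
  have -> : f = - hor kappa p u / hor kappa q u.
    by apply: (canRL (mulfK nq)); apply/eqP; rewrite -addr_eq0 addrC e0.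
  by apply: ext_M; [apply: ext_N; apply: ext_hor|apply: ext_V; apply: ext_hor].
have p0 : p = 0.
  by apply: (hor_eq0 (dc_nonconst dcu)); rewrite -[RHS]e0 q0 hor0 mulr0 addr0.
move=> i; case: (fintype.splitP i) => j ej.
  have -> : i = lshift _ j by apply: val_inj.
  by rewrite -pE p0 coef0.
have -> : i = rshift _ j by apply: val_inj.
by rewrite -qE q0 coef0.
Qed.

(* A pole a of f outside P1 and P2 would make 1/(u - a) regular at every point,
   and then all its powers would lie in the bounded space. *)
Lemma pole_space2_poly f : pole_space u P1 P2 2 f ->
  exists2 p : {poly algC}, (size p <= 3)%N & f = hor kappa p u.
Proof.
move=> hf; have [p [q [nq ef]]] := (simple_extP _ _ _).1 (pole_space2_ext hf).
have [p' [q' [cop nq' {}ef]]] : exists p q, [/\ coprimep p q, hor kappa q u != 0 & f = hor kappa p u / hor kappa q u].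
  have nq0 : q != 0 by apply: contra_neq nq => ->; rewrite hor0.
  have nd : gcdp p q != 0 by rewrite gcdp_eq0 negb_and nq0 orbT.
  have nhd : hor kappa (gcdp p q) u != 0.
    by apply: contra_neq nd; apply: hor_eq0; apply: dc_nonconst dcu.
  have ep : p = p %/ gcdp p q * gcdp p q by rewrite divpK // dvdp_gcdl.
  have eq : q = q %/ gcdp p q * gcdp p q by rewrite divpK // dvdp_gcdr.
  exists (p %/ gcdp p q), (q %/ gcdp p q); split.
  - by apply: coprimep_div_gcd; rewrite nq0 orbT.
  - by apply: contra_neq nq => h; rewrite eq horM h mul0r.
  - have -> : f = hor kappa (p %/ gcdp p q) u * hor kappa (gcdp p q) u /
                 (hor kappa (q %/ gcdp p q) u * hor kappa (gcdp p q) u).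
      by rewrite -!horM -ep -eq.
    by rewrite -mulf_div divff // mulr1.
have [sq|/closed_rootP[a ra]] := eqVneq (size q') 1%N.
  have [c nc ec] := size_poly1P _ (introT eqP sq).
  have ef' : f = hor kappa ((c^-1)%:P * p') u.
    by rewrite ef ec horM !horC fmorphV mulrC.
  exists ((c^-1)%:P * p') => //; rewrite leqNgt; apply/negP => big.
  have np : (c^-1)%:P * p' != 0 by rewrite -size_poly_gt0; apply: leq_trans big.
  have nf : f != 0.
    by rewrite ef'; apply: contra_neq np; apply: hor_eq0; apply: dc_nonconst dcu.
  have [/(_ (or_introl erefl)) /(vge_neq0 nf) h _] := hf P1 gP1.
  move: h; rewrite ef' (vord_hor_pole gP1 (vpole (or_introl erefl)) np).
  by move: big; move: (size _); clear; lia.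
have pa : p'.[a] != 0 by apply: (coprimep_root _ ra); rewrite coprimep_sym.
(* At a point with u = a the function f is regular, so p'(u) = f q'(u) would vanish there, although
   p'(a) is nonzero by coprimality. *)
have noP P : gp P -> local_ring P u -> vord P (u - kappa a) = 0.
  move=> gP Ou; apply/eqP; rewrite eq_le (shift_regular hS dcu _ gP Ou) andbT leNgt.
  apply/negP => lt; have Mu : maximal_ideal P (u - kappa a).
    by apply/(vge1 hS dcu gP); right.
  have Mh r : maximal_ideal P (hor kappa r u - kappa r.[a]).
    have /factor_theorem[s es] : root (r - r.[a]%:P) a.
      by rewrite rootE !hornerE subrr.
    have -> : hor kappa r u - kappa r.[a] = hor kappa s u * (u - kappa a).
      by rewrite -(horC kappa r.[a] u) -horN -horD es horM horD horN horX horC.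
    by apply: M_Ol => //; apply: O_hor.
  apply: (M_1 (F := F) gP); have [_ /(_ Ou) /(vge0 hS dcu gP) Of] := hf P gP.
  have Mq : maximal_ideal P (hor kappa q' u).
    by have := Mh q'; rewrite (eqP ra) rmorph0 subr0.
  have Mp : maximal_ideal P (hor kappa p' u) by rewrite -(divfK nq' (hor kappa p' u)) -ef; apply: M_Ol.
  have Mc : maximal_ideal P (kappa p'.[a]).
    by rewrite -[kappa _](subKr (hor kappa p' u)); apply: M_B.
  by have /eqP := pa; case; apply: (M_const (F := F) gP).
pose w := (u - kappa a)^-1.
have nw c : w <> kappa c.
  move=> e; apply: (@shift_nonconst _ _ _ dcu a c^-1); by rewrite fmorphV -e invrK.
have [k0 bd] := dim_bound.
have : (k0.*2 < k0.*2)%N; last by rewrite ltnn.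
apply: (bd k0 _ (fun i : 'I_k0.*2 => w ^+ i)) => // [i P gP|]; last exact: indep_powers.
have w0 : 0 <= vord P w.
  rewrite /w (vordV hS dcu gP (shift_neq0 dcu a)).
  have [hP|[_ [_ Ou]]] := pole_or_regular hS dcu gP1 gP2 nP12 pole1 pole2 gP.
    by rewrite (vord_shift_pole hS dcu gP1 gP2 nP12 pole1 pole2).
  by rewrite noP.
have h0 : vge P 0 (w ^+ i).
  by apply/(vge0 hS dcu gP); apply: O_X => //; apply/(vge0 hS dcu gP); right.
by split=> // _; apply: vge_le h0; rewrite oppr_le0.
Qed.

End PolarPart.

(** * A quadratic model of the function field and its specializations *)

Section LinearDependence.
Import GRing.Theory Num.Theory.
Local Open Scope ring_scope.
Variables (k F : fieldType) (f : {rmorphism k -> F}) (x : F).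
Local Notation S := (simple_ext f x).

(** Two linear equations in three unknowns: the cross product is a solution if its last entry is
    nonzero. Otherwise the first two columns are dependent, and (a1, - a0, 0), (b1, - b0, 0) or (1,
    0, 0) works. *)
Lemma dep3_plane (a b : 'I_3 -> F) : (forall i, S (a i)) -> (forall i, S (b i)) ->
  exists c : 'I_3 -> F, [/\ forall i, S (c i), exists i, c i != 0,
    \sum_i c i * a i = 0 & \sum_i c i * b i = 0].
Proof.
move=> Sa Sb; pose i1 : 'I_3 := inord 1; pose i2 : 'I_3 := inord 2.
pose vec (c0 c1 c2 : F) (i : 'I_3) := nth 0 [:: c0; c1; c2] i.
have vS c0 c1 c2 : S c0 -> S c1 -> S c2 -> forall i, S (vec c0 c1 c2 i).
  by move=> s0 s1 s2; case=> [[|[|[|//]]] h]; rewrite /vec /=.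
have sumE (g : 'I_3 -> F) c0 c1 c2 : \sum_i vec c0 c1 c2 i * g i = c0 * g ord0 + c1 * g i1 + c2 * g i2.
  rewrite !big_ord_recl big_ord0 addr0 addrA /vec /=.
  by congr (_ + _ * g _ + _ * g _); apply: val_inj; rewrite /= inordK.
have v0 c0 c1 c2 : vec c0 c1 c2 ord0 = c0 by [].
have v1 c0 c1 c2 : vec c0 c1 c2 i1 = c1 by rewrite /vec inordK.
have v2 c0 c1 c2 : vec c0 c1 c2 i2 = c2 by rewrite /vec inordK.
set a0 := a ord0; set a1 := a i1; set a2 := a i2.
set b0 := b ord0; set b1 := b i1; set b2 := b i2.
have [Sa0 Sa1 Sa2] : [/\ S a0, S a1 & S a2] by split; apply: Sa.
have [Sb0 Sb1 Sb2] : [/\ S b0, S b1 & S b2] by split; apply: Sb.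
have cr p q r s : S p -> S q -> S r -> S s -> S (p * q - r * s).
  by move=> *; apply: ext_B; apply: ext_M.
have [h01|n] := eqVneq (a0 * b1 - a1 * b0) 0; last first.
  exists (vec (a1 * b2 - a2 * b1) (a2 * b0 - a0 * b2) (a0 * b1 - a1 * b0)); split.
  - by apply: vS; apply: cr.
  - by exists i2; rewrite v2.
  - by rewrite sumE -/a0 -/a1 -/a2; ring.
  - by rewrite sumE -/b0 -/b1 -/b2; ring.
have [a00|n] := eqVneq a0 0; last first.
  exists (vec a1 (- a0) 0); split.
  - by apply: vS => //; [apply: ext_N|apply: ext_0].
  - by exists i1; rewrite v1 oppr_eq0.
  - by rewrite sumE -/a0 -/a1 -/a2; ring.
  - rewrite sumE -/b0 -/b1 -/b2; transitivity (- (a0 * b1 - a1 * b0)); first by ring.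
    by rewrite h01 oppr0.
have [b00|n] := eqVneq b0 0; last first.
  exists (vec b1 (- b0) 0); split.
  - by apply: vS => //; [apply: ext_N|apply: ext_0].
  - by exists i1; rewrite v1 oppr_eq0.
  - by rewrite sumE -/a0 -/a1 -/a2; transitivity (a0 * b1 - a1 * b0); first by ring.
  - by rewrite sumE -/b0 -/b1 -/b2; ring.
exists (vec 1 0 0); split.
- by apply: vS; [apply: ext_1|apply: ext_0|apply: ext_0].
- by exists ord0; rewrite oner_neq0.
- by rewrite sumE -/a0 -/a1 -/a2 a00; ring.
- by rewrite sumE -/b0 -/b1 -/b2 b00; ring.
Qed.

(* Completing the square in a basis containing 1. *)
Lemma quadratic_generator : (2%:R : F) != 0 -> dim_over S (fun _ => True) 2 ->
  exists (y : F) (p : {poly k}), [/\ y ^+ 2 = hor f p x, ~ S y &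
    forall z, exists a b, [/\ S a, S b & z = a + b * y]].
Proof.
move=> n2 [b [span ind]].
have sp z : exists c0 c1, [/\ S c0, S c1 & z = c0 * b ord0 + c1 * b ord_max].
  have [c [Sc ->]] := (span z).1 I; exists (c ord0), (c ord_max); split => //.
  by rewrite big_ord_recl big_ord1; congr (_ + c _ * b _); apply: val_inj.
have id2 c0 c1 : S c0 -> S c1 -> c0 * b ord0 + c1 * b ord_max = 0 -> c0 = 0 /\ c1 = 0.
  move=> S0 S1 e; pose c (i : 'I_2) := if i == ord0 then c0 else c1.
  have Sc i : S (c i) by rewrite /c; case: eqP.
  have h : \sum_i c i * b i = 0.
    by rewrite big_ord_recl big_ord1 -[RHS]e; congr (_ + _ * b _); apply: val_inj.
  by split; [have := ind c Sc h ord0|have := ind c Sc h ord_max].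
have nS : ~ (S (b ord0) /\ S (b ord_max)).
  case=> Sb0 Sb1; have [|_ /eqP] := id2 (b ord_max) (- b ord0) Sb1 (ext_N Sb0).
    by ring.
  rewrite oppr_eq0 => /eqP b0; have [|/eqP] := id2 1 0 (ext_1 _ _) (ext_0 _ _).
    by rewrite b0 mulr0 mul0r addr0.
  by rewrite oner_eq0.
have [y0 hy0] : exists y, forall z, exists a b, [/\ S a, S b & z = a + b * y].
  have [e0 [e1 [S0 S1 e]]] := sp 1.
  have [e00|ne0] := eqVneq e0 0.
    have ne1 : e1 != 0.
      by apply/eqP => e10; move/eqP: e; rewrite e00 e10 !mul0r addr0 oner_eq0.
    exists (b ord0) => z; have [c0 [c1 [Sc0 Sc1 ->]]] := sp z.
    exists (c1 / e1), c0; split=> //; first by apply: ext_M => //; apply: ext_V.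
    have -> : b ord_max = e1^-1 by apply: (mulfI ne1); rewrite divff // e e00 mul0r add0r.
    by rewrite addrC.
  exists (b ord_max) => z; have [c0 [c1 [Sc0 Sc1 ->]]] := sp z.
  exists (c0 / e0), (c1 - c0 / e0 * e1); split.
  - by apply: ext_M => //; apply: ext_V.
  - by apply: ext_B => //; apply: ext_M => //; apply: ext_M => //; apply: ext_V.
  - have -> : b ord0 = e0^-1 * (1 - e1 * b ord_max) by rewrite e addrK mulKf.
    by ring.
have ny0 : ~ S y0.
  by move=> Sy; apply: nS; split; [have [a [c [Sa Sc ->]]] := hy0 (b ord0)|
     have [a [c [Sa Sc ->]]] := hy0 (b ord_max)]; apply: ext_D => //; apply: ext_M.
have [a [c [Sa Sc ey]]] := hy0 (y0 ^+ 2).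
have S2 : S (2%:R)^-1 by apply: ext_V; rewrite -(rmorph_nat f); apply: ext_const.
have Sh : S (c / 2%:R) by apply: ext_M.
have Sd : S (a + (c / 2%:R) ^+ 2) by apply: ext_D => //; rewrite expr2; apply: ext_M.
have [p [q [nq ed]]] := (simple_extP _ _ _).1 Sd.
have Sq : S (hor f q x) by apply: ext_hor.
(* The completed square has the value p / q in k(x); multiplying the generator by q makes it the
   polynomial p q. *)
exists ((y0 - c / 2%:R) * hor f q x), (p * q); split.
- rewrite exprMn; have -> : (y0 - c / 2%:R) ^+ 2 = a + (c / 2%:R) ^+ 2.
    have -> : (y0 - c / 2%:R) ^+ 2 = y0 ^+ 2 - c * y0 + (c / 2%:R) ^+ 2 by field.
    by rewrite ey; ring.
  by rewrite ed horM expr2 mulrA divfK.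
- move=> h; apply: ny0; have -> : y0 = (y0 - c / 2%:R) * hor f q x / hor f q x + c / 2%:R.
    by rewrite mulfK // subrK.
  by apply: ext_D => //; apply: ext_M => //; apply: ext_V.
- move=> z; have [a' [b' [Sa' Sb' ->]]] := hy0 z.
  exists (a' + b' * (c / 2%:R)), (b' / hor f q x); split.
  - by apply: ext_D => //; apply: ext_M.
  - by apply: ext_M => //; apply: ext_V.
  - by move: (c / _) (hor f q x) nq => w H nH; field.
Qed.

End LinearDependence.

Section RatMorphisms.
Import GRing.Theory Num.Theory.
Local Open Scope ring_scope.

Lemma rat_rmorph_uniq (L : fieldType) (f g : {rmorphism rat -> L}) : f =1 g.
Proof.
move=> a; rewrite -[a]divq_num_den !fmorph_div.
by congr (_ / _); rewrite !rmorph_int.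
Qed.

Lemma ratr_idfun (a : rat) : (ratr : {rmorphism rat -> algC}) a =
  (idfun : {rmorphism algC -> algC}) ((ratr : {rmorphism rat -> algC}) a).
Proof. by []. Qed.

Lemma poly_nonroot (k : numFieldType) (p : {poly k}) : p != 0 -> exists m : nat, p.[m%:R] != 0.
Proof.
move=> np; apply: NNPP => h; pose l : seq k := [seq i%:R | i <- iota 0 (size p)].
suff : (size l < size p)%N by rewrite size_map size_iota ltnn.
apply: max_poly_roots => //.
  apply/allP => _ /mapP[i _ ->]; apply/negPn/negP => ni; apply: h; by exists i.
by rewrite map_inj_uniq ?iota_uniq // => a b /eqP; rewrite eqr_nat => /eqP.
Qed.

End RatMorphisms.

(** In a chain of length 1 the smaller set is nonempty and the larger one contains it strictly. *)
Lemma curve_two_points (C : proj_scheme) : krull_dim (geom_points C) 1 ->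
  exists P Q, [/\ geom_points C P, geom_points C Q & P <> Q].
Proof.
case=> [[Z [hZ sZ]] _].
have [_ [[P ZP] _] Z0C] := hZ 0%N isT.
have [_ _ Z1C] := hZ 1%N isT.
have [_ ns] := sZ 0%N isT.
apply: NNPP => h; apply: ns => Q ZQ; case: (classic (Q = P)) => [-> //|nQP].
by case: h; exists Q, P; split => //; [apply: Z1C|apply: Z0C].
Qed.

Section Model.
Import GRing.Theory Num.Theory Order.TTheory.
Local Open Scope ring_scope.
Variables (C : proj_scheme) (F : geom_function_field C) (E : rat_function_field C).
Local Notation n := (pdim C).
Local Notation K := (ff_sort F).
Local Notation kappa := (ff_const F).
Local Notation k0 := (ff_const E).
Local Notation xi i := (pcoord (ff_gen E) 0 i).
Local Notation Xi i := (pcoord (ff_gen F) 0 i).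
Local Notation evE A := (evalp k0 A (ff_gen E)).
Local Notation evF A := (evalp kappa (map_mpoly ratr A) (ff_gen F)).
Variable theta : {rmorphism ff_sort E -> K}.
Hypothesis thetaP : forall d (A B : {mpoly rat[n.+1]}), A \is d.-homog -> B \is d.-homog ->
  evE B != 0 -> theta (evE A / evE B) = evF A / evF B.
Variable x : ff_sort E.
Hypothesis hx : dim_over (simple_ext k0 x) (fun _ => True) 2.
Hypothesis hC : krull_dim (geom_points C) 1.
Local Notation X := (theta x).

Lemma theta_hor p z : theta (hor k0 p z) = hor kappa (map_poly ratr p) (theta z).
Proof.
rewrite /hor -horner_map -!map_poly_comp /=; congr _.[_].
apply: eq_map_poly => a /=.
exact: (rat_rmorph_uniq (theta \o k0) (kappa \o (ratr : {rmorphism rat -> algC}))).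
Qed.

Lemma theta_ext z w : simple_ext k0 z w -> simple_ext kappa (theta z) (theta w).
Proof.
move=> /simple_extP[p [q [nq ->]]]; rewrite fmorph_div !theta_hor.
by apply: ext_M; [|apply: ext_V]; apply: ext_hor.
Qed.

(** [theta] is known on quotients of forms of equal degree only; dividing by the coordinate
    normalized to 1 in the geometric field brings the coordinates into this shape. *)
Lemma theta_coords : exists2 j, xi j != 0 & forall i, Xi i = theta (xi i / xi j).
Proof.
have [j hj] := ppoint_nz (ff_gen F).
have evFX i : evF 'X_i = Xi i by rewrite map_mpolyX evalpU.
have nj : xi j != 0.
  rewrite -(evalpU k0); apply/negP => /eqP e0.
  have := (ff_compare_eq0 ratr_idfun E F (homogX1 _ j)).1 e0.
  by rewrite evFX hj => /eqP; rewrite oner_eq0.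
exists j => // i; rewrite -(evalpU k0) -[X in _ / X](evalpU k0).
rewrite (thetaP (homogX1 _ i) (homogX1 _ j)) ?evalpU //.
by rewrite !evFX hj divr1.
Qed.

(** The linear forms c_j X_i - c_i X_j would vanish at the generic point, hence on the whole curve,
    which would be a single point. *)
Lemma const_coords_absurd (c : 'I_n.+1 -> algC) : (forall i, Xi i = kappa (c i)) -> False.
Proof.
move=> hc; have [P [Q [gP gQ nPQ]]] := curve_two_points hC; apply: nPQ.
have prop R : geom_points C R -> forall i j, pcoord R 0 i * c j = pcoord R 0 j * c i.
  move=> gR i j; pose A : {mpoly algC[n.+1]} := (c j)%:MP * 'X_i - (c i)%:MP * 'X_j.
  have hA : A \is 1.-homog.
    by apply: dhomogD; rewrite ?dhomogN; apply: homogZ; apply: homogX1.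
  have : evalp kappa A (ff_gen F) = 0.
    by rewrite evalpB !evalpM !evalpC !evalpU !hc mulrC subrr.
  move/(ff_vanish F hA)/(_ R gR); rewrite evalpB !evalpM !evalpC !evalpU => /eqP.
  by rewrite subr_eq0 => /eqP e; rewrite mulrC e mulrC.
have [l hl] := ppoint_nz (ff_gen F).
have cl : c l = 1 by apply: (fmorph_inj kappa); rewrite -hc hl rmorph1.
have pr R : geom_points C R -> forall i, pcoord R 0 i = pcoord R 0 l * c i.
  by move=> gR i; rewrite -(prop R gR) cl mulr1.
by apply: ppoint_sep => i j; rewrite (pr P gP i) (pr Q gQ j) (pr P gP j) (pr Q gQ i); ring.
Qed.

(** If x became constant, so would y, a root of a quadratic polynomial with constant coefficients,
    and with them all coordinates of the generic point. *)
Lemma x_transcendental c : X <> kappa c.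
Proof.
move=> eX; have n2 : (2%:R : ff_sort E) != 0 by rewrite -(rmorph_nat k0) fmorph_eq0.
have [y [p [ey nSy sp]]] := quadratic_generator n2 hx.
have cS z : simple_ext k0 x z -> exists a, theta z = kappa a.
  move=> /theta_ext; rewrite eX => /simple_extP[r [s [_ ->]]].
  by exists (r.[c] / s.[c]); rewrite fmorph_div /hor !horner_map.
have cy : exists a, theta y = kappa a.
  apply: NNPP => h; have ny a : theta y <> kappa a by move=> e; apply: h; exists a.
  have [a ea] := cS _ (ext_hor k0 x p).
  have := @hor_eq0 _ kappa (theta y) ('X^2 - a%:P) ny.
  rewrite horD horXn horX horN horC -rmorphXn ey ea subrr => /(_ erefl) /eqP.
  by rewrite -size_poly_eq0 size_XnsubC.
have cz z : exists a, theta z = kappa a.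
  have [a [b [Sa Sb ->]]] := sp z; have [[a' ea] [b' eb]] := (cS a Sa, cS b Sb).
  by have [y' e] := cy; exists (a' + b' * y'); rewrite !rmorphD !rmorphM ea eb e.
have [j nj hj] := theta_coords.
have : forall i, exists a, Xi i = kappa a by move=> i; rewrite hj; apply: cz.
by move=> /fin_all_exists[a]; apply: const_coords_absurd.
Qed.

Lemma hor_rat_eq0 (p : {poly rat}) : hor k0 p x = 0 -> p = 0.
Proof.
move=> /(congr1 theta); rewrite theta_hor rmorph0 => /(hor_eq0 x_transcendental)/eqP.
by rewrite map_poly_eq0 => /eqP.
Qed.

(** The set T = S + S Y, with S = algC(x) and Y the image of y, is a field containing the constants
    and the coordinates of the generic point, hence everything; three vectors in a space spanned by
    1 and Y are dependent. *)
Lemma geom_dep (g : 'I_3 -> K) : exists a : 'I_3 -> K,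
  [/\ forall i, simple_ext kappa X (a i), exists i, a i != 0 & \sum_i a i * g i = 0].
Proof.
have n2 : (2%:R : ff_sort E) != 0 by rewrite -(rmorph_nat k0) fmorph_eq0.
have [y [p [ey nSy sp]]] := quadratic_generator n2 hx.
pose S := simple_ext kappa X; pose Y := theta y.
have SD : S (Y ^+ 2) by rewrite /Y -rmorphXn ey; apply: theta_ext; apply: ext_hor.
pose T z := exists a b, [/\ S a, S b & z = a + b * Y].
have TS z : S z -> T z by exists z, 0; split => //; [apply: ext_0|rewrite mul0r addr0].
have TD z w : T z -> T w -> T (z + w).
  move=> [a [b [Sa Sb ->]]] [a' [b' [Sa' Sb' ->]]]; exists (a + a'), (b + b').
  by split; [apply: ext_D|apply: ext_D|ring].
have TM z w : T z -> T w -> T (z * w).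
  move=> [a [b [Sa Sb ->]]] [a' [b' [Sa' Sb' ->]]].
  exists (a * a' + b * b' * Y ^+ 2), (a * b' + b * a').
  by split; [apply: ext_D; apply: ext_M => //; apply: ext_M|apply: ext_D; apply: ext_M|ring].
have TV z : T z -> T z^-1.
  move=> [a [b [Sa Sb ->]]]; have [->|nz] := eqVneq (a + b * Y) 0.
    by rewrite invr0; apply: TS; apply: ext_0.
  have SN : S (a ^+ 2 - b ^+ 2 * Y ^+ 2).
    by apply: ext_B; [rewrite expr2; apply: ext_M|apply: ext_M => //; rewrite expr2; apply: ext_M].
  have eN : a ^+ 2 - b ^+ 2 * Y ^+ 2 = (a - b * Y) * (a + b * Y) by ring.
  (* Inversion through the conjugate a - b Y; if that is 0, then a + b Y = 2 a already lies in S. *)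
  have [z0|nc] := eqVneq (a - b * Y) 0.
    apply: TS; apply: ext_V; have -> : a + b * Y = a + a - (a - b * Y) by ring.
    by rewrite z0 subr0; apply: ext_D.
  have -> : (a + b * Y)^-1 = (a ^+ 2 - b ^+ 2 * Y ^+ 2)^-1 * (a - b * Y).
    by rewrite eN invfM mulrAC mulVf // mul1r.
  apply: TM; first by apply: TS; apply: ext_V.
  by exists a, (- b); split => //; [apply: ext_N|ring].
have Ttheta z : T (theta z).
  have [a [b [Sa Sb ->]]] := sp z; exists (theta a), (theta b).
  by split; [apply: theta_ext|apply: theta_ext|rewrite rmorphD rmorphM].
have [j nj hj] := theta_coords.
have TXi i : T (Xi i) by rewrite hj.
have Tev (A : {mpoly algC[n.+1]}) : T (evalp kappa A (ff_gen F)).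
  elim/mpolyind: A => [|c m q _ _ IH]; first by rewrite evalp0; apply: TS; apply: ext_0.
  rewrite evalpD; apply: (TD); last exact: IH.
  rewrite -mul_mpolyC evalpM evalpC; apply: (TM).
    by apply: TS; apply: ext_const.
  rewrite /evalp map_mpolyX mevalX; apply: (big_ind T) => [||i _].
  - by apply: TS; apply: ext_1.
  - exact: TM.
  elim: (m i) => [|e IHe]; first by rewrite expr0; apply: TS; apply: ext_1.
  by rewrite exprS; apply: TM.
have TK z : T z.
  have [d [A [B [_ _ _ ->]]]] := ff_quotient z.
  by apply: TM; [|apply: TV]; apply: Tev.
have /fin_all_exists[a] : forall i, exists a, exists b, [/\ S a, S b & g i = a + b * Y] by move=> i; apply: TK.
move=> /fin_all_exists[b hab].
have Sa i : S (a i) by have [] := hab i.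
have Sb i : S (b i) by have [] := hab i.
have [c [Sc nc ca cb]] := dep3_plane Sa Sb; exists c; split => //.
transitivity (\sum_i c i * a i + (\sum_i c i * b i) * Y); last by rewrite ca cb mul0r addr0.
rewrite mulr_suml -big_split; apply: eq_bigr => i _ /=.
by have [_ _ ->] := hab i; ring.
Qed.

End Model.

(** * The hyperelliptic map at the points of the curve, and its fibre above a rational value *)

Section CoverAtPoints.
Import GRing.Theory Num.Theory Order.TTheory.
Local Open Scope ring_scope.
Variables (C : proj_scheme) (F : geom_function_field C) (E : rat_function_field C).
Local Notation n := (pdim C).
Local Notation K := (ff_sort F).
Local Notation kappa := (ff_const F).
Local Notation k0 := (ff_const E).
Local Notation xi i := (pcoord (ff_gen E) 0 i).
Local Notation evE A := (evalp k0 A (ff_gen E)).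
Local Notation evF A := (evalp kappa (map_mpoly ratr A) (ff_gen F)).
Variable theta : {rmorphism ff_sort E -> K}.
Hypothesis thetaP : forall d (A B : {mpoly rat[n.+1]}), A \is d.-homog -> B \is d.-homog ->
  evE B != 0 -> theta (evE A / evE B) = evF A / evF B.
Variable x : ff_sort E.
Hypothesis hx : dim_over (simple_ext k0 x) (fun _ => True) 2.
Hypothesis hC : krull_dim (geom_points C) 1.
Local Notation X := (theta x).
Variables (phi : ppoint algC n -> ppoint algC 1) (A B : {mpoly rat[n.+1]}).
Hypotheses (hphi : is_morphism phi) (rep : represents phi A B) (nB : evE B != 0).
Hypothesis xE : x = evE A / evE B.
Local Notation rtr := (ratr : {rmorphism rat -> algC}).

Lemma cross_vanish (A' B' : {mpoly rat[n.+1]}) P : represents phi A' B' -> geom_points C P ->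
  evalp rtr (A * B' - A' * B) P = 0.
Proof.
move=> rep' gP; have e := rep.2 P gP; have e' := rep'.2 P gP.
rewrite evalpB !evalpM; have [i hi] := ppoint_nz (phi P).
have : i = 0 \/ i = 1 by case: i {hi} => [[|[|//]]] h; [left|right]; apply: val_inj.
case=> ei; rewrite ei in hi; move: e e'; rewrite hi !mulr1.
  by move=> <- <-; ring.
by move=> -> ->; ring.
Qed.

(** Two representations of [phi] are proportional at every point, hence at the generic point. The
    relation is stated as A' = x B', which stays valid if B' vanishes on the curve. *)
Lemma rep_at P : geom_points C P -> exists d (A' B' : {mpoly rat[n.+1]}),
  [/\ A' \is d.-homog, B' \is d.-homog, evE A' = x * evE B', evF A' = X * evF B' &
      evalp rtr A' P != 0 \/ evalp rtr B' P != 0].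
Proof.
move=> gP; have [A' [B' [rep' nz]]] := hphi gP.
have [[d hA' hB'] _] := rep'; have [[e hA hB] _] := rep.
exists d, A', B'; split => //.
  have hh : A * B' - A' * B \is (e + d).-homog by apply: homogCross.
  have : evE (A * B' - A' * B) = 0 by apply/(ff_vanish E hh) => Q; apply: cross_vanish.
  by rewrite evalpB !evalpM => /subr0_eq h; rewrite xE; apply: cross_solve.
have hh : A * B' - A' * B \is (e + d).-homog by apply: homogCross.
have nBF : evF B != 0.
  by apply: contra_neq nB; move/(ff_compare_eq0 ratr_idfun E F hB).
have : evF (A * B' - A' * B) = 0.
  apply/(ff_vanish F (map_mpoly_homog _ hh)) => Q gQ.
  by rewrite (evalp_map_mpoly (h := rtr)) //; apply: cross_vanish.
rewrite rmorphB !rmorphM evalpB !evalpM => /subr0_eq h.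
by rewrite xE (thetaP hA hB nB); apply: cross_solve.
Qed.

Lemma evP_map (D : {mpoly rat[n.+1]}) (P : ppoint algC n) :
  evalp idfun (map_mpoly ratr D) P = evalp rtr D P.
Proof. exact: evalp_map_mpoly. Qed.

Lemma X_regular P : geom_points C P -> local_ring P X \/ maximal_ideal P X^-1.
Proof.
move=> gP; have [d [A' [B' [hA' hB' _ eX nz]]]] := rep_at gP.
have mA := map_mpoly_homog rtr hA'; have mB := map_mpoly_homog rtr hB'.
have [zB|nzB] := eqVneq (evalp rtr B' P) 0.
  have nA : evalp rtr A' P != 0 by case: nz => //; rewrite zB eqxx.
  right; exists d, (map_mpoly ratr B'), (map_mpoly ratr A'); rewrite !evP_map; split => //.
  have nAF : evF A' != 0 by apply: (ev_neq0 F gP mA); rewrite evP_map.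
  have nX : X != 0 by apply: contra_neq nAF; rewrite eX => ->; rewrite mul0r.
  have nBF : evF B' != 0 by apply: contra_neq nAF; rewrite eX => ->; rewrite mulr0.
  by rewrite eX invfM mulrC mulfVK.
left; exists d, (map_mpoly ratr A'), (map_mpoly ratr B'); rewrite !evP_map; split => //.
have nBF : evF B' != 0 by apply: (ev_neq0 F gP mB); rewrite evP_map.
by rewrite eX mulfK.
Qed.

Lemma double_cover_X : double_cover X.
Proof.
split; [exact: (x_transcendental thetaP hx hC)|exact: (geom_dep thetaP hx)|exact: X_regular].
Qed.

(** The coordinates are expanded in the basis 1, y with a common denominator. Were all [q i] zero,
    the coordinates, and with them Q(C) including y, would lie in Q(x). *)
Lemma rational_model : exists (y : ff_sort E) (f d : {poly rat}) (p q : 'I_n.+1 -> {poly rat}),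
  [/\ y ^+ 2 = hor k0 f x, ~ simple_ext k0 x y, hor k0 d x != 0,
      forall i, xi i * hor k0 d x = hor k0 (p i) x + hor k0 (q i) x * y &
      exists i, q i != 0].
Proof.
have n2 : (2%:R : ff_sort E) != 0 by rewrite -(rmorph_nat k0) fmorph_eq0.
have [y [f [ey nSy sp]]] := quadratic_generator n2 hx.
pose S := simple_ext k0 x.
have /fin_all_exists[a] : forall i : 'I_n.+1, exists a b, [/\ S a, S b & xi i = a + b * y].
  by move=> i; apply: sp.
move=> /fin_all_exists[b hab].
have [d1 [p1 [nd1 e1]]] : exists d p, hor k0 d x != 0 /\ forall i, hor k0 d x * a i = hor k0 (p i) x.
  by apply: ext_clear => i; have [] := hab i.
have [d2 [q1 [nd2 e2]]] : exists d p, hor k0 d x != 0 /\ forall i, hor k0 d x * b i = hor k0 (p i) x.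
  by apply: ext_clear => i; have [] := hab i.
exists y, f, (d1 * d2), (fun i => p1 i * d2), (fun i => q1 i * d1); split => //.
- by rewrite horM mulf_neq0.
- by move=> i; have [_ _ ->] := hab i; rewrite !horM -e1 -e2; ring.
apply: NNPP => h; apply: nSy.
have nd10 : d1 != 0 by apply: contra_neq nd1 => ->; rewrite hor0.
have q0 i : q1 i = 0.
  apply/eqP/negP => /negP nq; apply: h; exists i.
  by rewrite mulf_neq0.
have Sxi i : S (xi i).
  have [Sa _ ->] := hab i; have -> : b i = 0.
    by apply: (mulfI nd2); rewrite e2 q0 hor0 mulr0.
  by rewrite mul0r addr0.
have Sev (D : {mpoly rat[n.+1]}) : S (evE D).
  elim/mpolyind: D => [|c m q _ _ IH]; first by rewrite evalp0; apply: ext_0.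
  rewrite evalpD; apply: ext_D; last exact: IH.
  rewrite -mul_mpolyC evalpM evalpC; apply: ext_M; first exact: ext_const.
  rewrite /evalp map_mpolyX mevalX; apply: (big_ind S) => [||i _]; [exact: ext_1|exact: ext_M|].
  elim: (m i) => [|e IHe]; first by rewrite expr0; apply: ext_1.
  by rewrite exprS; apply: ext_M; [exact: Sxi|exact: IHe].
have [e [A' [B' [_ _ _ ->]]]] := ff_quotient y.
by apply: ext_M; [|apply: ext_V]; apply: Sev.
Qed.

Section Specialization.
Variables (y : ff_sort E) (f d : {poly rat}) (p q : 'I_n.+1 -> {poly rat}).
Hypotheses (ey : y ^+ 2 = hor k0 f x) (nSy : ~ simple_ext k0 x y) (nd : hor k0 d x != 0).
Hypothesis exi : forall i, xi i * hor k0 d x = hor k0 (p i) x + hor k0 (q i) x * y.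
Variable c : rat.
Hypothesis dc : d.[c] != 0.
Variables (L : fieldType) (rho : {rmorphism rat -> L}) (eps : L).
Hypothesis eeps : eps ^+ 2 = rho f.[c].

(* The specialization x := c, y := eps. *)
Definition specializes (z : ff_sort E) (w : L) := exists (a b : {poly rat}) (e : nat),
  z * hor k0 d x ^+ e = hor k0 a x + hor k0 b x * y /\
  w * rho d.[c] ^+ e = rho a.[c] + rho b.[c] * eps.

Let ndc : rho d.[c] != 0. Proof. by rewrite fmorph_eq0. Qed.

Lemma specializes_D z w z' w' : specializes z w -> specializes z' w' ->
  specializes (z + z') (w + w').
Proof.
move=> [a [b [e [h1 h2]]]] [a' [b' [e' [h1' h2']]]].
exists (a * d ^+ e' + a' * d ^+ e), (b * d ^+ e' + b' * d ^+ e), (e + e')%N.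
rewrite !horD !horM !horXn !hornerE /= !rmorphD !rmorphM !rmorphXn !exprD; split.
  transitivity (z * hor k0 d x ^+ e * hor k0 d x ^+ e' + z' * hor k0 d x ^+ e' * hor k0 d x ^+ e).
    by ring.
  by rewrite h1 h1'; ring.
transitivity (w * rho d.[c] ^+ e * rho d.[c] ^+ e' + w' * rho d.[c] ^+ e' * rho d.[c] ^+ e).
  by ring.
by rewrite h2 h2'; ring.
Qed.

Lemma specializes_M z w z' w' : specializes z w -> specializes z' w' ->
  specializes (z * z') (w * w').
Proof.
move=> [a [b [e [h1 h2]]]] [a' [b' [e' [h1' h2']]]].
exists (a * a' + b * b' * f), (a * b' + b * a'), (e + e')%N.
rewrite !horD !horM !hornerE /= !rmorphD !rmorphM !exprD mulrACA h1 h1' mulrACA h2 h2' -ey -eeps.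
by split; ring.
Qed.

Lemma specializes_const a : specializes (k0 a) (rho a).
Proof.
exists a%:P, 0, 0%N; rewrite horC hor0 !hornerE /= rmorph0.
by split; rewrite ?mul0r ?addr0 ?mulr1.
Qed.

Lemma specializes_x : specializes x (rho c).
Proof.
exists 'X, 0, 0%N; rewrite horX hor0 !hornerE /= rmorph0.
by split; rewrite ?mul0r ?addr0 ?mulr1.
Qed.

(** Since 1 and y are independent over Q(x) and x is transcendental, both polynomials a and b are 0;
    d(c) is nonzero, so w is 0. This makes the relation single-valued. *)
Lemma specializes_0 w : specializes 0 w -> w = 0.
Proof.
move=> [a [b [e [h1 h2]]]]; move: h1; rewrite mul0r => h1.
have b0 : b = 0.
  apply: (hor_rat_eq0 thetaP hx hC); apply/eqP/negP => /negP nb; apply: nSy.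
  have -> : y = - hor k0 a x / hor k0 b x.
    apply: (canRL (mulfK nb)); apply/eqP; rewrite -addr_eq0 mulrC addrC -h1; exact/eqP.
  by apply: ext_M; [apply: ext_N|apply: ext_V]; apply: ext_hor.
have a0 : a = 0.
  by apply: (hor_rat_eq0 thetaP hx hC); rewrite [RHS]h1 b0 hor0 mul0r addr0.
move: h2; rewrite a0 b0 !horner0 rmorph0 mul0r addr0 => /eqP.
by rewrite mulf_eq0 expf_eq0 (negbTE ndc) andbF orbF => /eqP.
Qed.

Lemma specializes_N z w : specializes z w -> specializes (- z) (- w).
Proof.
move=> h; rewrite -mulN1r -[- w]mulN1r; apply: specializes_M => //.
by rewrite -(rmorph1 k0) -(rmorph1 rho) -!rmorphN; apply: specializes_const.
Qed.

Lemma specializes_uniq z w w' : specializes z w -> specializes z w' -> w = w'.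
Proof.
move=> h /specializes_N h'; apply/eqP; rewrite -subr_eq0; apply/eqP.
by apply: specializes_0; rewrite -(subrr z); apply: specializes_D.
Qed.

Definition spec_row : 'rV[L]_n.+1 :=
  \row_i (rho ((p i).[c] / d.[c]) + rho ((q i).[c] / d.[c]) * eps).

Lemma specializes_xi i : specializes (xi i) (spec_row 0 i).
Proof.
exists (p i), (q i), 1%N; rewrite !expr1 exi mxE; split => //.
by rewrite !fmorph_div; field; exact: ndc.
Qed.

Lemma spec_normalized : normalized spec_row.
Proof.
have /existsP[i /andP[/eqP xi1 /forallP xi0]] := pcoord_normalized (ff_gen E).
apply/existsP; exists i; apply/andP; split; [apply/eqP|apply/forallP => j; apply/implyP => ji; apply/eqP].
  apply: (specializes_uniq (specializes_xi i)); rewrite xi1 -(rmorph1 k0) -(rmorph1 rho).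
  exact: specializes_const.
apply: (specializes_uniq (specializes_xi j)); rewrite (eqP (implyP (xi0 j) ji)).
rewrite -(rmorph0 k0) -(rmorph0 rho); exact: specializes_const.
Qed.

Definition spec_point : ppoint L n := PPoint spec_normalized.

Lemma specializes_ev (D : {mpoly rat[n.+1]}) : specializes (evE D) (evalp rho D spec_point).
Proof.
have S1 : specializes 1 1 by rewrite -(rmorph1 k0) -(rmorph1 rho); apply: specializes_const.
elim/mpolyind: D => [|a m r _ _ IH].
  by rewrite !evalp0 -(rmorph0 k0) -(rmorph0 rho); apply: specializes_const.
rewrite !evalpD; apply: specializes_D; last exact: IH.
rewrite -mul_mpolyC !evalpM !evalpC; apply: specializes_M; first exact: specializes_const.
rewrite /evalp !map_mpolyX !mevalX; apply: (big_ind2 specializes) => [//|z w z' w'|i _].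
  exact: specializes_M.
elim: (m i) => [|e IHe]; first by rewrite !expr0.
by rewrite !exprS; apply: specializes_M => //; exact: specializes_xi.
Qed.

Lemma spec_on_scheme : on_scheme rho spec_point.
Proof.
move=> D hD; have [e he] := peqs_homogeneous hD; apply: specializes_0.
suff <- : evE D = 0 by apply: specializes_ev.
by apply/(ff_vanish E he) => Q; apply.
Qed.

Lemma spec_x (A' B' : {mpoly rat[n.+1]}) : evE A' = x * evE B' ->
  evalp rho A' spec_point = rho c * evalp rho B' spec_point.
Proof.
move=> e; apply: (specializes_uniq (specializes_ev A')); rewrite e.
by apply: specializes_M; [exact: specializes_x|exact: specializes_ev].
Qed.

End Specialization.

Definition spec_coords (r s : 'I_n.+1 -> rat) (L : fieldType) (rho : {rmorphism rat -> L})
  (eps : L) (P : ppoint L n) := forall i, pcoord P 0 i = rho (r i) + rho (s i) * eps.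

(** The coordinates r_i + s_i eps are uniform in the field that contains eps: [algC] gives P1 and
    P2, a number field gives its new point. Some s_i is nonzero, so the point determines eps. *)
Lemma specialization : exists (c delta : rat) (r s : 'I_n.+1 -> rat),
  [/\ delta != 0, exists i, s i != 0,
    forall (L : fieldType) (rho : {rmorphism rat -> L}) (eps : L), eps ^+ 2 = rho delta ->
      exists2 P : ppoint L n, spec_coords r s rho eps P & on_scheme rho P &
    forall (eps : algC) (P : ppoint algC n), eps ^+ 2 = ratr delta ->
      spec_coords r s rtr eps P -> geom_points C P /\ maximal_ideal P (X - kappa (ratr c))].
Proof.
have [y [f [d [p [q [ey nSy nd exi [i0 nq]]]]]]] := rational_model.
have nf : f != 0.
  apply/eqP => f0; apply: nSy; move: ey; rewrite f0 hor0 => /eqP.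
  by rewrite expf_eq0 /= => /eqP ->; apply: ext_0.
have nd0 : d != 0 by apply: contra_neq nd => ->; rewrite hor0.
(* The value c must avoid the zeros of d (denominators), of f (so that delta is nonzero) and of one
   [q i] (so that eps occurs in a coordinate). *)
have [m] := poly_nonroot (mulf_neq0 nd0 (mulf_neq0 nf nq)).
rewrite !hornerE !mulf_eq0 !negb_or => /andP[/andP[dc fc] qc].
pose c : rat := m%:R.
exists c, f.[c], (fun i => (p i).[c] / d.[c]), (fun i => (q i).[c] / d.[c]); split => //.
- by exists i0; rewrite mulf_neq0 // invr_eq0.
- move=> L rho eps eeps; exists (spec_point ey nSy exi dc eeps).
    by move=> i; rewrite /= mxE.
  exact: spec_on_scheme.
move=> eps P eeps hP.
have eP : P = spec_point ey nSy exi dc eeps by apply: val_inj; apply/rowP => i /=; rewrite mxE hP.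
have gP : geom_points C P by rewrite eP; apply: spec_on_scheme.
split => //; have [e [A' [B' [hA' hB' eA eX nz]]]] := rep_at gP.
(* The generic relation A' = x B' specializes to A'(P) = c B'(P); hence B'(P) is nonzero, for
   otherwise both would vanish. *)
have hv : evalp rtr A' P = ratr c * evalp rtr B' P by rewrite eP; apply: spec_x.
have nB' : evalp rtr B' P != 0.
  by case: nz => // nA; apply: contra_neq nA => h; rewrite hv h mulr0.
have mB := map_mpoly_homog rtr hB'; have mA := map_mpoly_homog rtr hA'.
exists e, (map_mpoly rtr A' - (ratr c)%:MP * map_mpoly rtr B'), (map_mpoly rtr B'); split => //.
- by apply: dhomogD => //; rewrite dhomogN; apply: homogZ.
- by rewrite evalpB evalpM evalpC !evP_map hv subrr.
- by rewrite evP_map.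
rewrite evalpB evalpM evalpC eX -mulrBl mulfK //.
by apply: (ev_neq0 F gP mB); rewrite evP_map.
Qed.

End CoverAtPoints.

(** * Number fields *)

Section Embeddings.
Import GRing.Theory Num.Theory.
Local Open Scope ring_scope.
Variable K : fieldExtType rat.
Local Notation alg p := (map_poly (in_alg K) p).
Local Notation rt p := (map_poly (ratr : {rmorphism rat -> algC}) p).

Lemma num_field_pchar0 : [pchar K] =i pred0.
Proof. by move=> p; rewrite -(pchar_num rat) (fmorph_pchar (in_alg K)). Qed.

Lemma rmorph_in_alg (L : fieldType) (f : {rmorphism K -> L}) (g : {rmorphism rat -> L}) a :
  f (in_alg K a) = g a.
Proof. exact: (rat_rmorph_uniq (f \o in_alg K) g). Qed.

Lemma rmorph_horner_alg (L : fieldType) (f : {rmorphism K -> L}) (g : {rmorphism rat -> L})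
  (p : {poly rat}) z : f (alg p).[z] = (map_poly g p).[f z].
Proof.
rewrite -horner_map -map_poly_comp; congr _.[_].
by apply: eq_map_poly => a; apply: rmorph_in_alg.
Qed.

Section Root.
Variables (t : K) (m : {poly rat}) (r : algC).
Hypotheses (tgen : forall v, exists p : {poly rat}, v = (alg p).[t]).
Hypothesis mdvd : forall p : {poly rat}, (alg p).[t] = 0 -> m %| p.
Hypothesis mr : root (rt m) r.

Let rel (v : K) (w : algC) := exists p : {poly rat}, v = (alg p).[t] /\ w = (rt p).[r].

Let rel_fun v w w' : rel v w -> rel v w' -> w = w'.
Proof.
move=> [p [ep ->]] [q [eq ->]]; apply/eqP; rewrite -subr_eq0 -hornerN -hornerD -rmorphB.
have /mdvd : (alg (p - q)).[t] = 0 by rewrite rmorphB hornerD hornerN -ep -eq subrr.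
case/dvdpP => s ->; rewrite rmorphM hornerM (eqP mr) mulr0 //.
Qed.

Let rel_ex v : exists w, rel v w.
Proof. by have [p ->] := tgen v; exists (rt p).[r], p. Qed.

Let emb v := proj1_sig (constructive_indefinite_description _ (rel_ex v)).

Let embP v : rel v (emb v).
Proof. by rewrite /emb; case: constructive_indefinite_description. Qed.

Let emb_additive : additive emb.
Proof.
move=> v w; apply: rel_fun (embP _) _; have [p [ep ->]] := embP v; have [q [eq ->]] := embP w.
by exists (p - q); rewrite !rmorphB !hornerD !hornerN -ep -eq.
Qed.

Let emb_multiplicative : multiplicative emb.
Proof.
split=> [v w|]; apply: rel_fun (embP _) _; last by exists 1; rewrite !rmorph1 !hornerC.
have [p [ep ->]] := embP v; have [q [eq ->]] := embP w.
by exists (p * q); rewrite !rmorphM !hornerM -ep -eq.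
Qed.

(** p(t) is sent to p(r); this is well defined since m divides every polynomial that vanishes at
    t. *)
Lemma root_embedding : exists f : {rmorphism K -> algC}, f t = r.
Proof.
pose aM := GRing.isAdditive.Build _ _ emb emb_additive.
pose mM := GRing.isMultiplicative.Build _ _ emb emb_multiplicative.
pose h : {rmorphism K -> algC} := HB.pack emb aM mM.
exists h; apply: rel_fun (embP _) _; exists 'X.
by rewrite !map_polyX !hornerX.
Qed.

End Root.

(** One embedding for each root of the minimal polynomial of a primitive element. An endomorphism of
    [algC] permutes these roots, hence the embeddings, which makes the sum of the conjugates of a
    point Galois-invariant. *)
Lemma num_field_embeddings : exists sigma : 'I_(\dim {:K}) -> {rmorphism K -> algC},
  (forall v, <<1; v>>%VS = fullv -> injective (fun i => sigma i v)) /\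
  (forall s : {rmorphism algC -> algC}, exists2 pi : 'I_(\dim {:K}) -> 'I_(\dim {:K}),
     injective pi & forall i v, s (sigma i v) = sigma (pi i) v).
Proof.
have sep : separable 1 {:K} by apply/separableP => y _; apply: pcharf0_separable num_field_pchar0 _.
have := eq_adjoin_separable_generator sep (sub1v _).
set t := separable_generator _ _ => gen.
have tgen v : exists p : {poly rat}, v = (alg p).[t].
  by apply/Fadjoin1_polyP; rewrite -gen memvf.
have [m em] := polyOver1P (minPolyOver 1 t).
have mdvd (p : {poly rat}) : (alg p).[t] = 0 -> m %| p.
  move=> p0; rewrite -(dvdp_map (in_alg K)) -em; apply: minPoly_dvdp; last exact/eqP.
  by apply/polyOver1P; exists p.
have szm : size m = (\dim {:K}).+1.
  have -> : size m = size (minPoly 1 t) by rewrite em size_map_poly.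
  by rewrite size_minPoly gen dim_Fadjoin dimv1 muln1.
have sepm : separable_poly (rt m).
  rewrite separable_map -(separable_map (in_alg K)) -em.
  exact: pcharf0_separable num_field_pchar0 t.
have [rs ers] := closed_field_poly_normal (rt m).
have nl : lead_coef (rt m) != 0 by rewrite lead_coef_eq0 -size_poly_eq0 size_map_poly szm.
have urs : uniq rs.
  move: sepm; rewrite ers -mul_polyC separable_mul => /and3P[_ h _].
  by rewrite separable_prod_XsubC in h.
have srs : size rs = \dim {:K}.
  by have := szm; rewrite -(size_map_poly (ratr : {rmorphism rat -> algC})) ers
    size_scale // size_prod_XsubC => -[].
have rootE z : (z \in rs) = root (rt m) z by rewrite ers rootZ // root_prod_XsubC.
pose r (i : 'I_(\dim {:K})) := rs`_i.
have /fin_all_exists[sigma hs] : forall i, exists f : {rmorphism K -> algC}, f t = r i.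
  move=> i; apply: (root_embedding tgen mdvd); rewrite -rootE mem_nth //.
  by rewrite srs.
have r_inj : injective r.
  move=> i j /eqP; rewrite /r nth_uniq ?srs // => /eqP e; exact: val_inj.
exists sigma; split=> [v gv i j eij|s].
  have [p ep] : exists p : {poly rat}, t = (alg p).[v] by apply/Fadjoin1_polyP; rewrite gv memvf.
  apply: r_inj; rewrite -!hs {2}ep ep !(rmorph_horner_alg _ (ratr : {rmorphism rat -> algC})).
  by rewrite eij.
have /fin_all_exists[pi hpi] : forall i, exists j, s (r i) = r j.
  move=> i; have : s (r i) \in rs.
    rewrite rootE /root; have <- : s (rt m).[r i] = (rt m).[s (r i)].
      rewrite -horner_map -map_poly_comp; congr _.[_]; apply: eq_map_poly => a /=.
      exact: fmorph_rat.
    have : r i \in rs by rewrite mem_nth // srs.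
    by rewrite rootE => /eqP ->; rewrite rmorph0.
  move=> /(nthP 0)[j lj ej]; rewrite srs in lj; by exists (Ordinal lj).
exists pi => [i j e|i v]; first by apply: r_inj; apply: (fmorph_inj s); rewrite !hpi e.
have [p ->] := tgen v.
have := rmorph_horner_alg (s \o sigma i) (ratr : {rmorphism rat -> algC}) p t => /= ->.
by rewrite (rmorph_horner_alg _ (ratr : {rmorphism rat -> algC})) !hs hpi.
Qed.

End Embeddings.

Section Adjunction.
Import GRing.Theory Num.Theory.
Local Open Scope ring_scope.
Variables (K : fieldExtType rat) (E : {subfield K}) (x : K).
Hypotheses (nx : x \notin E) (x2 : x ^+ 2 \in E).

Lemma sqrt_adjoin_degree : adjoin_degree E x = 2%N.
Proof.
have le : (adjoin_degree E x <= 2)%N.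
  have : minPoly E x %| 'X^2 - (x ^+ 2)%:P.
    apply: minPoly_dvdp; last by rewrite rootE !hornerE subrr.
    by rewrite rpredB ?rpredX ?polyOverX // polyOverC.
  move=> /dvdp_leq; rewrite -size_poly_eq0 size_XnsubC // => /(_ isT).
  by rewrite size_minPoly.
have := adjoin_deg_eq1 E x; rewrite (negbTE nx).
have : (0 < adjoin_degree E x)%N by [].
by move: le; case: (adjoin_degree E x) => [|[|[|]]].
Qed.

Lemma sqrt_adjoin_elt v : v \in <<E; x>>%VS -> exists a b, [/\ a \in E, b \in E & v = a + b * x].
Proof.
move=> hv; have := Fadjoin_poly_eq hv; have := Fadjoin_polyOver E x v.
have := size_Fadjoin_poly E x v; rewrite sqrt_adjoin_degree.
move: (Fadjoin_poly E x v) => p sp /polyOverP pE <-.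
exists p`_0, p`_1; split => //.
by rewrite (horner_coef_wide _ sp) !big_ord_recl big_ord0 /= expr0 mulr1 expr1 addr0.
Qed.

End Adjunction.

Section PrimeValuation.
Import GRing.Theory Num.Theory.
Local Open Scope ring_scope.

(** The p-adic valuation is even on the left and 1 on the right. *)
Lemma prime_nonsquare p (N D : int) (a : rat) : prime p -> N != 0 -> ~~ (p %| `|N|)%N ->
  ~~ (p %| `|D|)%N -> a ^+ 2 * D%:~R <> p%:R * N%:~R.
Proof.
move=> pp nN pN pD e.
have nD : D != 0 by apply: contraNneq pD => ->; rewrite dvdn0.
have na : a != 0.
  apply/eqP => a0; move: e; rewrite a0 expr0n mul0r => /esym/eqP.
  by rewrite mulf_eq0 pnatr_eq0 intr_eq0 (negbTE nN) orbF => /eqP p0; move: pp; rewrite p0.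
have : numq a * numq a * D = p%:Z * N * (denq a * denq a).
  apply: (intr_inj (R := rat)); rewrite !intrM.
  have nd : (denq a)%:~R != 0 :> rat by rewrite intr_eq0 denq_eq0.
  have -> : (p%:Z)%:~R = p%:R :> rat by [].
  rewrite (mulrA _ (denq a)%:~R) -e; have -> : (numq a)%:~R = a * (denq a)%:~R by rewrite -{2}[a]divq_num_den divfK.
  by ring.
move/(congr1 (fun z => logn p `|z|)); rewrite !abszM.
have a1 : (0 < `|numq a|)%N by rewrite absz_gt0 numq_eq0.
have a2 : (0 < `|denq a|)%N by rewrite absz_gt0 denq_eq0.
have a3 : (0 < `|N|)%N by rewrite absz_gt0.
have a4 : (0 < `|D|)%N by rewrite absz_gt0.
rewrite !lognM ?expn_gt0 ?muln_gt0 ?a1 ?a2 ?a3 ?a4 ?(prime_gt0 pp) //.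
have -> : logn p p = 1%N by rewrite logn_prime // eqxx.
have /eqP -> : logn p `|N| == 0%N by rewrite lognE pp a3 (negbTE pN).
have /eqP -> : logn p `|D| == 0%N by rewrite lognE pp a4 (negbTE pD).
move: (logn _ _) (logn _ _) => i j; clear; lia.
Qed.

End PrimeValuation.

(** * The biquadratic fields Q(eps, sqrt p) *)

Section Biquadratic.
Import GRing.Theory Num.Theory.
Local Open Scope ring_scope.
Variables (delta : rat) (eps : algC).
Hypotheses (eeps : eps ^+ 2 = ratr delta) (neps : forall a : rat, eps <> ratr a).

Definition biquad (p : nat) : fieldExtType rat :=
  projT1 (num_field_exists [:: eps; sqrtC p%:R]).

Section InField.
Variables (K : fieldExtType rat) (e : K).
Hypotheses (ee : e ^+ 2 = in_alg K delta) (ne : forall a, e <> in_alg K a).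

Lemma mem1P (v : K) : v \in 1%VS -> exists a, v = in_alg K a.
Proof. by move=> /vlineP[a ->]; exists a. Qed.

Lemma in_alg_mem (E : {subfield K}) a : in_alg K a \in E.
Proof. by rewrite rpredZ ?mem1v. Qed.

Lemma in_alg_eq (a b : rat) : in_alg K a = in_alg K b -> a = b.
Proof. exact: fmorph_inj. Qed.

Lemma two_neq0 : (2%:R : K) != 0.
Proof. by rewrite -(rmorph_nat (in_alg K)) fmorph_eq0. Qed.

(** The cross term 2 a b x of the square lies in E although x does not. *)
Lemma sqrt_split (E : {subfield K}) (x a b : K) : x \notin E -> x ^+ 2 \in E ->
  a \in E -> b \in E -> (a + b * x) ^+ 2 \in E -> a = 0 \/ b = 0.
Proof.
move=> nx x2 aE bE h; have [->|na] := eqVneq a 0; first by left.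
have [->|nb] := eqVneq b 0; [by right|case/negP: nx].
have -> : x = ((a + b * x) ^+ 2 - (a ^+ 2 + b ^+ 2 * x ^+ 2)) / (2%:R * a * b).
  by have n2 := two_neq0; field; rewrite na nb n2.
have E2 : (2%:R : K) \in E by rewrite rpred_nat.
apply: rpred_div; last by apply: rpredM => //; apply: rpredM.
by apply: rpredB => //; apply: rpredD; [apply: rpredX|apply: rpredM => //; apply: rpredX].
Qed.

Lemma e_notin1 : e \notin (1%AS : {subfield K}).
Proof. by apply/negP => /mem1P[a /ne]. Qed.

(** By [sqrt_split] a square root of r in Q(e) is rational or of the form b e; in the second case r
    delta is the square of b delta. *)
Lemma nonsquare_quadratic (r : rat) : (forall a : rat, a ^+ 2 <> r) ->
  (forall a : rat, a ^+ 2 <> r * delta) -> forall v, v \in <<1; e>>%VS -> v ^+ 2 <> in_alg K r.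
Proof.
move=> n1 n2 v hv ev.
have e2 : e ^+ 2 \in (1%AS : {subfield K}) by rewrite ee; apply: in_alg_mem.
have [a [b [a1 b1 ev']]] := sqrt_adjoin_elt e_notin1 e2 hv.
have h : (a + b * e) ^+ 2 \in (1%AS : {subfield K}) by rewrite -ev' ev; apply: in_alg_mem.
have [a' ea] := mem1P a1; have [b' eb] := mem1P b1.
case: (sqrt_split e_notin1 e2 a1 b1 h) => z0.
  apply: (n2 (b' * delta)); apply: in_alg_eq.
  have -> : in_alg K (r * delta) = v ^+ 2 * e ^+ 2 by rewrite ev ee -rmorphM.
  rewrite ev' z0 eb add0r ee !expr2 !rmorphM /=.
  have ee2 : e * e = delta%:A by exact: ee.
  transitivity (b'%:A * b'%:A * (e * e * delta%:A)); last by ring.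
  by rewrite ee2; ring.
apply: (n1 a'); apply: in_alg_eq.
by rewrite -ev ev' z0 mul0r addr0 ea -rmorphXn.
Qed.

End InField.

(** Used with q = 1, to keep sqrt p out of Q(eps), and with q another prime, to tell the fields
    apart. *)
Lemma nonsquare_p (p q : nat) : prime p -> ~~ (p %| `|numq delta|)%N ->
  ~~ (p %| `|denq delta|)%N -> (0 < q)%N -> ~~ (p %| q)%N ->
  (forall a : rat, a ^+ 2 <> (p * q)%:R) /\ (forall a : rat, a ^+ 2 <> (p * q)%:R * delta).
Proof.
move=> pp pN pD q0 pq; have delta_neq0 : delta != 0 by apply: contraNneq pN => ->.
split=> a e.
  apply: (@prime_nonsquare p q%:Z 1 a) => //; first by rewrite -lt0n in q0 *; case: q q0 {pq e}.
    by rewrite dvdn1; apply: contraTneq pp => ->.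
  by rewrite e natrM mulr1.
apply: (@prime_nonsquare p (q%:Z * numq delta) (denq delta) a) => //.
- by rewrite mulf_neq0 ?numq_eq0 ?delta_neq0 //; case: q q0 {pq e}.
- by rewrite abszM Euclid_dvdM // negb_or pq.
have ed : delta * (denq delta)%:~R = (numq delta)%:~R.
  by rewrite -{1}[delta]divq_num_den divfK // intr_eq0 denq_eq0.
by rewrite e natrM -!mulrA ed intrM.
Qed.

Variables (p : nat).
Hypotheses (pp : prime p) (pN : ~~ (p %| `|numq delta|)%N) (pD : ~~ (p %| `|denq delta|)%N).

Lemma biquad_gen : exists e w : biquad p,
  [/\ e ^+ 2 = in_alg _ delta, w ^+ 2 = p%:R, forall a, e <> in_alg _ a &
      <<1 & [:: e; w]>>%VS = fullv].
Proof.
rewrite /biquad; case: num_field_exists => K [f [s1 es gen]] /=.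
case: s1 es gen => [|e [|w [|]]] //= [fe fw] gen; exists e, w; split => // [||a ea].
- apply: (fmorph_inj f); rewrite rmorphXn fe eeps.
  by rewrite (rmorph_in_alg f (ratr : {rmorphism rat -> algC})).
- by apply: (fmorph_inj f); rewrite rmorphXn fw sqrtCK rmorph_nat.
- by apply: (neps (a := a)); rewrite -fe ea (rmorph_in_alg f (ratr : {rmorphism rat -> algC})).
Qed.

Lemma biquad_structure : exists e w : biquad p,
  [/\ e ^+ 2 = in_alg _ delta, w ^+ 2 = p%:R, forall a, e <> in_alg _ a,
      w \notin <<1; e>>%VS & <<<<1; e>>; w>>%VS = fullv].
Proof.
have [e [w [ee ew ne gen]]] := biquad_gen; exists e, w; split => //.
  have p1 : ~~ (p %| 1)%N by rewrite dvdn1; apply: contraTneq pp => ->.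
  apply/negP => hw; have [n1 n2] := @nonsquare_p p 1 pp pN pD isT p1.
  by apply: (nonsquare_quadratic ee ne n1 n2 hw); rewrite muln1 rmorph_nat.
by rewrite -gen adjoin_cons adjoin_seq1.
Qed.

Lemma biquad_dim : \dim {: biquad p} = 4%N.
Proof.
have [e [w [ee ew ne nw <-]]] := biquad_structure.
have e2 : e ^+ 2 \in (1%AS : {subfield biquad p}) by rewrite ee; apply: in_alg_mem.
have w2 : w ^+ 2 \in (<<1; e>>%AS : {subfield biquad p}) by rewrite ew rpred_nat.
rewrite (dim_Fadjoin <<1; e>>%AS) (sqrt_adjoin_degree nw w2).
by rewrite (dim_Fadjoin 1%AS) (sqrt_adjoin_degree (e_notin1 ne) e2) dimv1.
Qed.

Lemma biquad_imprimitive : imprimitive_field (biquad p).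
Proof.
have [e [w [ee ew ne nw _]]] := biquad_structure; exists <<1; e>>%AS; split=> h.
  by have := memv_adjoin 1 e; rewrite h => /(negP (e_notin1 ne)).
by case/negP: nw; rewrite h memvf.
Qed.

(** A square root of q would lie in Q(eps) or be b sqrt p with b in Q(eps); then q or p q would be a
    square in Q(eps), the latter being the square of b p. *)
Lemma biquad_nonsquare (q : nat) (v : biquad p) : prime q -> q != p ->
  ~~ (q %| `|numq delta|)%N -> ~~ (q %| `|denq delta|)%N -> v ^+ 2 <> q%:R.
Proof.
move=> qp qNp qN qD ev; have [e [w [ee ew ne nw gen]]] := biquad_structure.
have w2 : w ^+ 2 \in (<<1; e>>%AS : {subfield biquad p}) by rewrite ew rpred_nat.
have [a [b [aE bE ev']]] : exists a b, [/\ a \in <<1; e>>%VS, b \in <<1; e>>%VS & v = a + b * w].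
  by apply: (sqrt_adjoin_elt (E := <<1; e>>%AS) nw w2); rewrite gen memvf.
have hE : (a + b * w) ^+ 2 \in (<<1; e>>%AS : {subfield biquad p}) by rewrite -ev' ev rpred_nat.
have q1 : ~~ (q %| 1)%N by rewrite dvdn1; apply: contraTneq qp => ->.
have qp' : ~~ (q %| p)%N by rewrite dvdn_prime2.
case: (sqrt_split nw w2 aE bE hE) => z0.
  have [n1 n2] := nonsquare_p qp qN qD (prime_gt0 pp) qp'.
  apply: (nonsquare_quadratic ee ne n1 n2 (v := b * p%:R)).
    by apply: (rpredM (s := <<1; e>>%AS)) => //; apply: rpred_nat.
  rewrite rmorph_nat natrM -ev ev' z0 add0r [RHS]mulrC !exprMn ew; ring.
have [n1 n2] := @nonsquare_p q 1 qp qN qD isT q1.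
apply: (nonsquare_quadratic ee ne n1 n2 aE).
by rewrite muln1 rmorph_nat -ev ev' z0 mul0r addr0.
Qed.

End Biquadratic.

Section BiquadraticFamily.
Import GRing.Theory Num.Theory.
Local Open Scope ring_scope.

Lemma biquadratic_fields (delta : rat) (eps : algC) :
  eps ^+ 2 = ratr delta -> (forall a : rat, eps <> ratr a) -> delta != 0 ->
  exists K : nat -> fieldExtType rat,
    (forall i, [/\ \dim {: K i} = 4%N, imprimitive_field (K i) &
       exists2 e : K i, e ^+ 2 = in_alg (K i) delta & forall a, e <> in_alg (K i) a]) /\
    (forall i j, i <> j -> ~ isomorphic_fields (K i) (K j)).
Proof.
(* Primes above B divide neither the numerator nor the denominator of delta; iterating [next] from B
   gives a strictly increasing sequence of such primes. *)
move=> eeps neps nd; pose B := (`|numq delta| + `|denq delta|)%N.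
pose next (m : nat) := s2val (prime_above m); pose pr i := iter i.+1 next B.
have nextP m : (m < next m)%N /\ prime (next m).
  by rewrite /next; case: (prime_above m).
have prB i : (B < pr i)%N.
  elim: i => [|i IH]; first by have [] := nextP B.
  by apply: ltn_trans IH _; have [] := nextP (pr i).
have prp i : prime (pr i) by have [] := nextP (iter i next B).
have ndvd i m : (0 < m <= B)%N -> ~~ (pr i %| m)%N.
  move=> /andP[m0 mB]; apply/negP => /(dvdn_leq m0) le.
  by have := prB i; rewrite ltnNge (leq_trans le mB).
have pN i : ~~ (pr i %| `|numq delta|)%N.
  by apply: ndvd; rewrite absz_gt0 numq_eq0 nd leq_addr.
have pD i : ~~ (pr i %| `|denq delta|)%N.
  by apply: ndvd; rewrite absz_gt0 denq_eq0 leq_addl.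
have pr_lt i j : (i < j)%N -> (pr i < pr j)%N.
  by elim: j => // j IH; rewrite ltnS leq_eqVlt => /orP[/eqP ->|/IH h];
     [have [] := nextP (pr j)|apply: ltn_trans h _; have [] := nextP (pr j)].
have pr_inj i j : i <> j -> pr i != pr j.
  by move=> nij; case: (ltngtP i j) nij => // [/pr_lt|/pr_lt]; rewrite neq_ltn => ->; rewrite ?orbT.
exists (fun i => biquad eps (pr i)); split=> [i|i j nij [f _]].
  split; [exact: (biquad_dim eeps neps)|exact: (biquad_imprimitive eeps neps)|].
  by have [e [w [ee _ ne _]]] := biquad_gen eeps neps (pr i); exists e.
have [e [w [_ ew _ _]]] := biquad_gen eeps neps (pr i).
(* An isomorphism would carry the square root of [pr i] into the field built from [pr j]. *)
apply: (biquad_nonsquare eeps neps (prp j) (pN j) (pD j) (prp i) _ (pN i) (pD i) (v := f w)).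
  exact: pr_inj.
by rewrite -rmorphXn ew rmorph_nat.
Qed.

End BiquadraticFamily.

(** * Proof of the theorem *)

Section InverseShift.
Import GRing.Theory Num.Theory Order.TTheory.
Local Open Scope ring_scope.
Variables (C : proj_scheme) (F : geom_function_field C).
Local Notation kappa := (ff_const F).

Lemma double_cover_inv_shift (x : ff_sort F) c : double_cover x -> double_cover (x - kappa c)^-1.
Proof.
move=> dx; have nc := @shift_nonconst _ _ _ dx c; have n0 := shift_neq0 dx c.
set u := (x - kappa c)^-1.
have xu : simple_ext kappa u x.
  have -> : x = u^-1 + kappa c by rewrite invrK subrK.
  by apply: ext_D; [apply: ext_V; apply: ext_gen|apply: ext_const].
split=> [a e|g|P gP].
- by apply: (nc a^-1); rewrite fmorphV -e invrK.
- have [a [ha na a0]] := dc_dep dx g; exists a; split => // i.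
  exact: ext_trans xu (ha i).
case: (dc_regular dx gP) => [Ox|MV].
  have Ou : local_ring P (x - kappa c) by apply: O_B => //; apply: O_const.
  case: (classic (maximal_ideal P (x - kappa c))) => [h|nM]; first by right; rewrite invrK.
  by left; have [] := O_unit gP Ou nM.
have nx : x != 0 by apply/eqP => x0; apply: (dc_nonconst dx (c := 0)); rewrite x0 rmorph0.
(* At a pole of x, 1 / (x - c) is x^-1 times the inverse of the unit 1 - c x^-1, hence regular. *)
have O1 : local_ring P (1 - kappa c * x^-1).
  by apply: (O_B gP); [exact: O_1|apply: O_M; [exact: O_const|exact: M_O]].
have nM : ~ maximal_ideal P (1 - kappa c * x^-1).
  move=> h; apply: (M_1 (F := F) gP).
  rewrite -[1](subrK (kappa c * x^-1)); apply: (M_D gP) => //.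
  by apply: M_Ol => //; apply: O_const.
have [n1 OV] := O_unit gP O1 nM; left.
have -> : u = x^-1 * (1 - kappa c * x^-1)^-1.
  by rewrite /u -invfM; congr (_^-1); rewrite mulrBr mulr1 mulrCA divff // mulr1.
by apply: O_M => //; apply: M_O.
Qed.

End InverseShift.

Section Transfer.
Import GRing.Theory Num.Theory Order.TTheory.
Local Open Scope ring_scope.
Variables (C : proj_scheme) (F' F : geom_function_field C).

(** [principal] supplies a function in a presentation of its own; the comparison map carries local
    rings, maximal ideals and uniformizers over to the fixed presentation. *)
Lemma ord_transfer (f : ff_sort F') : f != 0 ->
  exists2 g : ff_sort F, g != 0 & forall P m, geom_points C P -> ord P f m -> ord P g m.
Proof.
have mid (A : {mpoly algC[(pdim C).+1]}) : map_mpoly idfun A = A.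
  by apply/mpolyP => m; rewrite mcoeff_map_mpoly.
have ji : forall a : algC, (idfun : {rmorphism algC -> algC}) a =
    (idfun : {rmorphism algC -> algC}) ((idfun : {rmorphism algC -> algC}) a) by [].
have [h hP] := ff_compare ji F' F.
have {}hP d (A B : {mpoly algC[(pdim C).+1]}) : A \is d.-homog -> B \is d.-homog ->
    evalp (ff_const F') B (ff_gen F') != 0 ->
    h (evalp (ff_const F') A (ff_gen F') / evalp (ff_const F') B (ff_gen F')) =
    evalp (ff_const F) A (ff_gen F) / evalp (ff_const F) B (ff_gen F).
  by move=> hA hB nB; have := hP d A B hA hB nB; rewrite !mid => e; exact: e.
move=> nf; exists (h f) => [|P m gP]; first by rewrite fmorph_eq0.
have hO w : local_ring P w -> local_ring P (h w).
  case=> d [A [B [hA hB nB ->]]]; exists d, A, B; split => //.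
  by rewrite (hP d) //; apply: ev_neq0 hB nB.
have hM w : maximal_ideal P w -> maximal_ideal P (h w).
  case=> d [A [B [hA hB zA nB ->]]]; exists d, A, B; split => //.
  by rewrite (hP d) //; apply: ev_neq0 hB nB.
case=> t [w [[Mt tg] nw Ow Vw ->]]; exists (h t), (h w); split; last 1 first.
- by rewrite rmorphM fmorphXz.
- split; first exact: hM.
  move=> z [d [A [B [hA hB zA nB ->]]]].
  have nB' := ev_neq0 F' gP hB nB; rewrite -(hP d) //.
  have [|g Og ->] := tg (evalp (ff_const F') A (ff_gen F') / evalp (ff_const F') B (ff_gen F')).
    by exists d, A, B.
  by exists (h g); [exact: hO|rewrite rmorphM].
- by rewrite fmorph_eq0.
- exact: hO.
- by rewrite -fmorphV; apply: hO.
Qed.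

End Transfer.

Section HyperellipticModel.
Import GRing.Theory Num.Theory Order.TTheory.
Local Open Scope ring_scope.
Local Notation rtr := (ratr : {rmorphism rat -> algC}).

(* The fibre of the hyperelliptic map above the rational point c consists of the
   points with coordinates r_i + s_i eps, eps^2 = delta, and u is the function
   1 / (x - c). *)
Record rational_fibre (C : proj_scheme) (F : geom_function_field C)
  (u : ff_sort F) (delta : rat) (r s : 'I_(pdim C).+1 -> rat) : Prop := RationalFibre {
  rf_cover : double_cover u;
  rf_delta : delta != 0;
  rf_nonconst : exists i, s i != 0;
  rf_point : forall (L : fieldType) (rho : {rmorphism rat -> L}) (eps : L),
    eps ^+ 2 = rho delta ->
    exists2 P : ppoint L (pdim C), spec_coords r s rho eps P & on_scheme rho P;
  rf_pole : forall (eps : algC) (P : ppoint algC (pdim C)), eps ^+ 2 = ratr delta ->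
    spec_coords r s rtr eps P -> geom_points C P /\ maximal_ideal P u^-1;
  rf_value : forall (K : fieldType) (i : {rmorphism rat -> K}) (P : ppoint K (pdim C)),
    on_scheme i P -> forall sigma0 : {rmorphism K -> algC},
    exists v : option K, forall sigma : {rmorphism K -> algC},
      if v is Some a then maximal_ideal (map_ppoint sigma P) (u - ff_const F (sigma a))
      else maximal_ideal (map_ppoint sigma P) u^-1
}.

Lemma map_on_scheme (C : proj_scheme) (K L : fieldType) (i : {rmorphism rat -> K})
  (j : {rmorphism rat -> L}) (sigma : {rmorphism K -> L}) (P : ppoint K (pdim C)) :
  on_scheme i P -> on_scheme j (map_ppoint sigma P).
Proof.
move=> hP A hA; rewrite (evalp_map (f := i)) ?hP ?rmorph0 // => a.
exact: (rat_rmorph_uniq j (sigma \o i)).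
Qed.

(** For [rf_value]: if x = A' / B' near one conjugate of P, then u(P) = B' / (A' - c B') is an
    element of K or infinite. As A' and B' have rational coefficients, the same pair serves at all
    conjugates, and [sigma0] is where it is chosen. *)
Lemma hyperelliptic_model (C : proj_scheme) (F : geom_function_field C) : hyperelliptic C ->
  exists u delta r s, @rational_fibre C F u delta r s.
Proof.
case=> -[_ hK hS] _ [phi [hphi [E [A [B [rep nB hx]]]]]].
have [theta thetaP] := ff_compare ratr_idfun E F.
set x := _ / _ in hx; have xE : x = evalp (ff_const E) A (ff_gen E) / evalp (ff_const E) B (ff_gen E) by [].
have dcX := double_cover_X thetaP hx hK hphi rep nB xE.
have [c [delta [r [s [nd ns pts pole]]]]] := specialization thetaP hx hK hphi rep nB xE.
exists (theta x - ff_const F (ratr c))^-1, delta, r, s; split => //.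
- exact: double_cover_inv_shift.
- by move=> eps P eeps hP; have [gP MP] := pole eps P eeps hP; rewrite invrK.
move=> K i P hP sigma0.
have gP sigma : geom_points C (map_ppoint sigma P) by apply: map_on_scheme hP.
have [d [A' [B' [hA hB _ eX nz]]]] := rep_at thetaP hphi rep nB xE (gP sigma0).
have ev (sigma : {rmorphism K -> algC}) (D : {mpoly rat[(pdim C).+1]}) :
    evalp rtr D (map_ppoint sigma P) = sigma (evalp i D P).
  by apply: evalp_map => a; apply: (rat_rmorph_uniq rtr (sigma \o i)).
pose a := evalp i A' P; pose b := evalp i B' P.
have mA := map_mpoly_homog rtr hA; have mB := map_mpoly_homog rtr hB.
pose g := a - i c * b.
pose G := map_mpoly rtr A' - (ratr c)%:MP * map_mpoly rtr B'.
have hG : G \is d.-homog by apply: dhomogD => //; rewrite dhomogN; apply: homogZ.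
have si (sigma : {rmorphism K -> algC}) : ratr c = sigma (i c).
  exact: (rat_rmorph_uniq rtr (sigma \o i)).
have evG sigma : evalp idfun G (map_ppoint sigma P) = sigma g.
  by rewrite evalpB evalpM evalpC !evP_map !ev (si sigma) /g rmorphB rmorphM.
have evGF : evalp (ff_const F) G (ff_gen F) =
    (theta x - ff_const F (ratr c)) * evalp (ff_const F) (map_mpoly rtr B') (ff_gen F).
  by rewrite evalpB evalpM evalpC eX mulrBl.
have nzP : a != 0 \/ b != 0.
  by move: nz; rewrite !ev !fmorph_eq0.
have [g0|ng] := eqVneq g 0.
  have nb : b != 0.
    case: nzP => [na|nb]; last exact: nb.
    apply: contra_neq na => b0.
    by move/eqP: g0; rewrite /g b0 mulr0 subr0 => /eqP.
  exists None => sigma; rewrite invrK.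
  have nBs : evalp idfun (map_mpoly rtr B') (map_ppoint sigma P) != 0.
    by rewrite evP_map ev fmorph_eq0.
  exists d, G, (map_mpoly rtr B'); split => //; first by rewrite evG g0 rmorph0.
  by rewrite evGF mulfK //; apply: (ev_neq0 F (gP sigma) mB).
exists (Some (b / g)) => sigma.
have nGs : evalp idfun G (map_ppoint sigma P) != 0 by rewrite evG fmorph_eq0.
have nGF := ev_neq0 F (gP sigma) hG nGs.
exists d, (map_mpoly rtr B' - (sigma (b / g))%:MP * G), G; split => //.
- by apply: dhomogD => //; rewrite dhomogN; apply: homogZ.
- by rewrite evalpB evalpM evalpC evG evP_map ev fmorph_div divfK ?fmorph_eq0 // subrr.
rewrite evalpB evalpM evalpC mulrBl mulfK //; congr (_ - _).
move: nGF; rewrite evGF mulf_eq0 negb_or => /andP[n1 n2].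
by rewrite invfM mulrCA divff // mulr1.
Qed.

End HyperellipticModel.

(** * The Galois action on divisors *)

Section GaloisAction.
Import GRing.Theory Num.Theory.
Local Open Scope ring_scope.

Lemma algC_sqrt (z : algC) : exists e : algC, e ^+ 2 = z.
Proof. by exists (sqrtC z); apply: sqrtCK. Qed.

Variables (C : proj_scheme) (sg : {rmorphism algC -> algC}).
Implicit Types D : {freeg (ppoint algC (pdim C)) / int}.

Lemma morphB_0D (U V : zmodType) (h : U -> V) : {morph h : x y / x - y} ->
  h 0 = 0 /\ {morph h : x y / x + y}.
Proof.
move=> hB; have h0 : h 0 = 0 by have := hB 0 0; rewrite !subrr.
split=> // x y; have hN : h (- y) = - h y by rewrite -sub0r hB h0 sub0r.
by rewrite -{1}[y]opprK hB hN opprK.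
Qed.

(** A sum over the support is not visibly additive, as supports may shrink under addition; the
    linear extension is. *)
Lemma galois_div_lift D : galois_div sg D = fglift (fun P => << map_ppoint sg P >>) D.
Proof.
have [h0 hD] := morphB_0D (lift_is_additive (fun P => << map_ppoint sg P >> : {freeg (ppoint algC (pdim C)) / int})).
rewrite -{2}[D]freeg_sumE (big_morph _ hD h0).
apply: eq_bigr => P _; rewrite liftU; apply/eqP/freeg_eqP => Q.
by rewrite coeffZ !coeffU mul1r.
Qed.

Lemma galois_div_B : {morph @galois_div C sg : D1 D2 / D1 - D2}.
Proof. by move=> D1 D2; rewrite !galois_div_lift lift_is_additive. Qed.

Lemma galois_div_0 : galois_div sg (0 : {freeg (ppoint algC (pdim C)) / int}) = 0.
Proof. by have [] := morphB_0D galois_div_B. Qed.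

Lemma galois_div_D : {morph @galois_div C sg : D1 D2 / D1 + D2}.
Proof. by have [] := morphB_0D galois_div_B. Qed.

Lemma galois_div_sum (I : Type) (t : seq I) (G : I -> {freeg (ppoint algC (pdim C)) / int}) :
  galois_div sg (\sum_(i <- t) G i) = \sum_(i <- t) galois_div sg (G i).
Proof. by apply: (big_morph (galois_div sg)); [exact: galois_div_D|exact: galois_div_0]. Qed.

Lemma galois_div_U k P : galois_div sg (<< k *g P >> : {freeg (ppoint algC (pdim C)) / int})
  = << k *g map_ppoint sg P >>.
Proof.
rewrite galois_div_lift liftU; apply/eqP/freeg_eqP => Q.
by rewrite coeffZ !coeffU mul1r.
Qed.

End GaloisAction.

Section MainArgument.
Import GRing.Theory Num.Theory Order.TTheory.
Local Open Scope ring_scope.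
Local Notation rtr := (ratr : {rmorphism rat -> algC}).
Variable C : proj_scheme.
Hypotheses (hS : smooth_of_dim C 1) (hJ : jacobian_rat_trivial C).
Variables (F : geom_function_field C) (u : ff_sort F) (delta : rat).
Variables (r s : 'I_(pdim C).+1 -> rat).
Hypothesis rf : rational_fibre u delta r s.
Variables (D : {freeg (ppoint algC (pdim C)) / int}) (l : nat).
Hypotheses (dD : is_divisor D) (dimD : dim_over (@constants C F) (@riemann_roch_space C F D) l).
Hypothesis genD : 2 <= deg D + 1 - l%:Z.
Variable eps : algC.
Hypothesis eeps : eps ^+ 2 = ratr delta.
Variables P1 P2 : ppoint algC (pdim C).
Hypotheses (hP1 : spec_coords r s rtr eps P1) (hP2 : spec_coords r s rtr (- eps) P2).
Local Notation kappa := (ff_const F).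
Local Notation gp := (geom_points C).

Let dcu : double_cover u := rf_cover rf.

Let eeps' : (- eps) ^+ 2 = ratr delta. Proof. by rewrite sqrrN. Qed.
Let gP1 : gp P1. Proof. by have [] := rf_pole rf eeps hP1. Qed.
Let gP2 : gp P2. Proof. by have [] := rf_pole rf eeps' hP2. Qed.

Let pole_vord P : gp P -> maximal_ideal P u^-1 -> 0 < vord P u^-1.
Proof. by move=> gP /(vge1 hS dcu gP)/(vge_neq0 (invr_neq0 (u_neq0 dcu))). Qed.

Let pole1 : 0 < vord P1 u^-1.
Proof. by apply: pole_vord => //; have [] := rf_pole rf eeps hP1. Qed.
Let pole2 : 0 < vord P2 u^-1.
Proof. by apply: pole_vord => //; have [] := rf_pole rf eeps' hP2. Qed.

Let rtr_neq0 (a : rat) : a != 0 -> rtr a != 0.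
Proof. by apply: contra_neq => e; apply: (fmorph_inj rtr); rewrite e rmorph0. Qed.

Let neps : eps != 0.
Proof.
apply: contraTneq (rtr_neq0 (rf_delta rf)) => e0.
by rewrite -[X in X != 0]eeps e0 expr0n eqxx.
Qed.

Let nP12 : P1 <> P2.
Proof.
move=> e; have [i ni] := rf_nonconst rf; have := hP2 i; rewrite -e hP1 => /addrI /eqP.
rewrite mulrN -subr_eq0 opprK -mulr2n -mulr_natr; apply/negP.
by apply: mulf_neq0; [apply: mulf_neq0; [exact: rtr_neq0|exact: neps]|rewrite pnatr_eq0].
Qed.

Lemma pole_divisor_poly D0 :
  (forall P, - (if (P == P1) || (P == P2) then 2 else 0) <= coeff P D0) -> principal D0 ->
  exists p : {poly algC}, [/\ p != 0, (size p <= 3)%N &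
     forall P, gp P -> vord P (hor kappa p u) = coeff P D0].
Proof.
move=> le [F' [f' [nf' of']]]; have [f nf tr] := ord_transfer F nf'.
have vf P : gp P -> vord P f = coeff P D0.
  by move=> gP; apply: (vordE hS dcu gP); apply: tr => //; apply: of'.
have bd := pole_space_bound hS dcu gP1 gP2 nP12 pole1 pole2 dD dimD genD.
have [|p sp ep] := pole_space2_poly hS dcu gP1 gP2 nP12 pole1 pole2 bd (f := f).
  move=> P gP; split=> [hP|Ou]; right; rewrite vf //; apply: le_trans (le P).
    by have -> : (P == P1) || (P == P2) by apply/orP; case: hP => ->; rewrite eqxx; [left|right].
  have [n1 n2] := regular_not_pole hS dcu gP1 gP2 nP12 pole1 pole2 gP Ou.
  by rewrite (introF eqP n1) (introF eqP n2).
exists p; split=> // [|P gP]; last by rewrite -ep vf.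
by apply: contra_neq nf; rewrite ep => ->; rewrite hor0.
Qed.

Lemma conj_poles (sg : {rmorphism algC -> algC}) :
  (map_ppoint sg P1 = P1 /\ map_ppoint sg P2 = P2) \/
  (map_ppoint sg P1 = P2 /\ map_ppoint sg P2 = P1).
Proof.
have sc e P Q : spec_coords r s rtr e P -> spec_coords r s rtr (sg e) Q -> map_ppoint sg P = Q.
  move=> hP hQ; apply: val_inj; apply/rowP => i; rewrite mxE hP hQ rmorphD rmorphM.
  by rewrite !fmorph_rat.
have : (sg eps == eps) || (sg eps == - eps) by rewrite -eqf_sqr -rmorphXn eeps fmorph_rat.
by case/orP => /eqP e; [left|right]; split; apply: sc; eauto; rewrite ?rmorphN e ?opprK.
Qed.

Lemma principal0 : principal (0 : {freeg (ppoint algC (pdim C)) / int}).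
Proof.
exists F, 1; rewrite oner_neq0; split => // P gP.
by rewrite coeff0 -(vord1 hS dcu gP); apply: (vordP hS dcu gP); rewrite oner_neq0.
Qed.

(* P1 - P2 would be principal if P1 and P2 were rational, but a function in
   L(2(P1 + P2)) is a polynomial in u and has the same order at P1 and P2. *)
Lemma eps_irrational (a : rat) : eps <> ratr a.
Proof.
move=> ea; have fixP (sg : {rmorphism algC -> algC}) : map_ppoint sg P1 = P1 /\ map_ppoint sg P2 = P2.
  have [//|[e1 e2]] := conj_poles sg; case: nP12; rewrite -e1; apply: val_inj.
  by apply/rowP => i; rewrite mxE hP1 rmorphD rmorphM ea !fmorph_rat.
pose D0 : {freeg (ppoint algC (pdim C)) / int} := << P1 >> - << P2 >>.
have pD0 : principal D0.
  apply: hJ; split.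
  - move=> P; rewrite mem_dom coeffB !coeffU; have [<- //|_] := eqVneq P1 P.
    by have [<- //|_] := eqVneq P2 P; rewrite !mulr0 subrr eqxx.
  - by rewrite degB !degU subrr.
  - move=> sg; have [e1 e2] := fixP sg.
    by rewrite /D0 galois_div_B !galois_div_U e1 e2 subrr; apply: principal0.
have [P|p [np _ vp]] := pole_divisor_poly _ pD0.
  rewrite coeffB !coeffU eq_sym [P == P2]eq_sym.
  by case: (P1 == P); case: (P2 == P).
have := vp P1 gP1; have := vp P2 gP2.
have vpole P := vord_u_pole hS dcu gP1 gP2 nP12 pole1 pole2 (P := P).
rewrite !(vord_hor_pole hS dcu) ?vpole //; [|by left|by right].
move=> ->; rewrite !coeffB !coeffU !eqxx (introF eqP nP12) eq_sym (introF eqP nP12).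
by [].
Qed.

(** The point has a coordinate r_i + s_i e with s_i nonzero; if that coordinate were rational, so
    would be e. *)
Lemma eps_point_not_rational (K : fieldExtType rat) (e : K) : e ^+ 2 = in_alg K delta ->
  (forall a, e <> in_alg K a) -> ~ same_points C K.
Proof.
move=> ee ne same; have [P hP oP] := rf_point rf ee.
have [Q _ eQ] := same P oP; have [i ni] := rf_nonconst rf.
have := hP i; rewrite eQ mxE => h.
apply: (ne ((pcoord Q 0 i - r i) / s i)); rewrite fmorph_div rmorphB.
by apply: (canRL (mulfK _)); rewrite ?fmorph_eq0 // [X in X - _]h addrC addKr mulrC.
Qed.

Lemma primitive_same_points (K : fieldExtType rat) : \dim {:K} = 4%N ->
  primitive_field K -> same_points C K.
Proof.
move=> dimK prim P oP.
have gen v : v \notin (1%VS : {vspace K}) -> <<1; v>>%VS = fullv.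
  move=> nv; case: (prim <<1; v>>%AS) => // e; case/negP: nv.
  by have := memv_adjoin 1 v; rewrite e.
case: (classic (forall i, pcoord P 0 i \in (1%VS : {vspace K}))) => [rat_coords|].
  have /fin_all_exists[a ha] : forall i, exists a, pcoord P 0 i = in_alg K a.
    by move=> i; apply: mem1P; apply: rat_coords.
  have nrm : normalized (\row_i a i).
    have /existsP[i /andP[/eqP i1 /forallP i0]] := pcoord_normalized P.
    apply/existsP; exists i; rewrite mxE; apply/andP; split.
      by apply/eqP; apply: (@in_alg_eq K); rewrite -ha i1 rmorph1.
    apply/forallP => j; apply/implyP => ji; rewrite mxE; apply/eqP; apply: (@in_alg_eq K).
    by rewrite -ha (eqP (implyP (i0 j) ji)) rmorph0.
  have eP : P = map_ppoint (in_alg K) (PPoint nrm).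
    by apply: val_inj; apply/rowP => i; rewrite !mxE ha.
  exists (PPoint nrm) => // A hA; apply: (@in_alg_eq K); rewrite [RHS]rmorph0.
  by rewrite -[RHS](oP A hA) eP (evalp_map (f := idfun)).
(* The nonrational coordinate generates K by primitivity, so the four embeddings take distinct
   values on it and the conjugates [Q i] are distinct. *)
move=> /not_all_ex_not[k /negP nk]; exfalso.
have [sigma [sinj sgal]] := num_field_embeddings K; rewrite dimK in sigma sinj sgal.
pose Q i := map_ppoint (sigma i) P.
have gQ i : gp (Q i) by apply: map_on_scheme oP.
have Qinj : injective Q.
  move=> i j /(congr1 (fun R => pcoord R 0 k)); rewrite !mxE => e.
  exact: (sinj _ (gen _ nk) i j e).
have uQ : uniq [seq Q i | i <- enum 'I_4] by rewrite map_inj_uniq // enum_uniq.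
have szQ : size [seq Q i | i <- enum 'I_4] = 4%N by rewrite size_map size_enum_ord.
have no4 x : (forall c, x <> kappa c) -> simple_ext kappa x u ->
    (forall i, maximal_ideal (Q i) x) -> False.
  move=> nx xu Mx; have n0 : x != 0 by apply/eqP => e; apply: (nx 0); rewrite e rmorph0.
  have vx i : 1 <= vord (Q i) x.
    by apply: (vge_neq0 n0); apply/(vge1 hS dcu (gQ i)).
  have := fibre_bound hS dcu nx xu uQ.
  have h : forall R, R \in [seq Q i | i <- enum 'I_4] -> gp R /\ 0 < vord R x.
    by move=> R /mapP[i _ ->]; split; [exact: gQ|exact: vx].
  move=> /(_ h); rewrite big_map big_enum /= => le.
  have : (4 : int) <= 2.
    apply: le_trans le; have -> : (4 : int) = \sum_(i < 4) 1 by rewrite sumr_const card_ord.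
    by apply: ler_sum => i _; apply: vx.
  by [].
pose D1 : {freeg (ppoint algC (pdim C)) / int} := \sum_(i <- enum 'I_4) << Q i >>.
pose D2 : {freeg (ppoint algC (pdim C)) / int} := << 2%:Z *g P1 >> + << 2%:Z *g P2 >>.
have c1 R : coeff R D1 = \sum_(i < 4) (Q i == R)%:R.
  by rewrite coeff_sum big_enum /=; apply: eq_bigr => i _; rewrite coeffU mul1r.
have c1pos R : 0 <= coeff R D1 by rewrite c1; apply: sumr_ge0 => i _; apply: ler0n.
have c2 R : coeff R D2 = if (R == P1) || (R == P2) then 2 else 0.
  rewrite coeffD !coeffU eq_sym [P2 == R]eq_sym; case: (eqVneq R P1) => [->|_] /=.
    by rewrite (introF eqP nP12) mulr1 mulr0 addr0.
  by case: (eqVneq R P2) => _; rewrite ?mulr1 !mulr0 ?addr0 ?add0r.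
have pD : principal (D1 - D2).
  apply: hJ; split.
  - move=> R; rewrite mem_dom coeffB c2; case: ifP => [/orP[]/eqP -> //|_].
    rewrite subr0 c1; case: (classic (exists i, Q i = R)) => [[i <-] //|nR].
    rewrite big1 ?eqxx // => i _; case: eqP => // e; by case: nR; exists i.
  - rewrite degB deg_sum; under eq_bigr do rewrite degU.
    by rewrite big_enum /= sumr_const card_ord degD !degU.
  (* The divisor itself is fixed, not only its class: [sg] permutes the conjugates of P and fixes or
     exchanges P1 and P2. *)
  - move=> sg; have -> : galois_div sg (D1 - D2) = D1 - D2; last by rewrite subrr; apply: principal0.
    rewrite galois_div_B; congr (_ - _).
      rewrite galois_div_sum; under eq_bigr do rewrite galois_div_U.
      have [pi pi_inj hpi] := sgal sg; rewrite /D1 !big_enum /= [RHS](reindex_inj pi_inj).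
      apply: eq_bigr => i _; congr << _ >>; apply: val_inj; apply/rowP => j.
      by rewrite !mxE hpi.
    rewrite galois_div_D !galois_div_U.
    by case: (conj_poles sg) => -[-> ->] //; rewrite addrC.
have [R|p [np sp vp]] := pole_divisor_poly _ pD.
  by rewrite coeffB c2 -[X in X <= _]add0r lerD2r.
have [v hv] := rf_value rf oP (sigma ord0).
(* If u(P) is infinite or a rational number b, then 1 / u or u - b vanishes at all four conjugates,
   against [no4]. *)
case: v hv => [a|] hv; last first.
  exact: (no4 _ (@inv_nonconst _ _ _ dcu) (inv_ext u) (fun i => hv (sigma i))).
have [a1|na] := boolP (a \in (1%VS : {vspace K})).
  have [b eb] := mem1P a1.
  apply: (no4 (u - kappa (ratr b)) (@shift_nonconst _ _ _ dcu _) (shift_ext _ _)) => i.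
  have -> : ratr b = sigma i a by rewrite eb (rmorph_in_alg (sigma i) rtr).
  exact: hv (sigma i).
(* p(u) vanishes at [Q i], where the divisor D1 - D2 has a positive coefficient, and its value there
   is p evaluated at [sigma i a]. If a is not rational, it generates K, and p would have four
   distinct roots although its size is at most 3. *)
have pr i : root p (sigma i a).
  have Mu := hv (sigma i); have gQi := gQ i; rewrite -/(Q i) in Mu.
  have Ou : local_ring (Q i) u.
    rewrite -(subrK (kappa (sigma i a)) u); apply: (O_D gQi); first exact: M_O.
    exact: O_const.
  have [n1 n2] := regular_not_pole hS dcu gP1 gP2 nP12 pole1 pole2 gQi Ou.
  have np' : hor kappa p u != 0 by apply: contra_neq np; apply: hor_eq0; apply: dc_nonconst dcu.
  have Mp : maximal_ideal (Q i) (hor kappa p u).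
    apply/(vge1 hS dcu gQi); right; rewrite vp // coeffB c2.
    rewrite (introF eqP n1) (introF eqP n2) /= subr0 c1 (bigD1 i) //= eqxx.
    by rewrite lerDl; apply: sumr_ge0 => j _; apply: ler0n.
  have /factor_theorem[w ew] : root (p - p.[sigma i a]%:P) (sigma i a).
    by rewrite rootE !hornerE subrr.
  have Mh : maximal_ideal (Q i) (hor kappa p u - kappa p.[sigma i a]).
    rewrite -(horC kappa p.[sigma i a] u) -horN -horD ew horM horD horN horX horC.
    by apply: (M_Ol) => //; apply: O_hor.
  rewrite rootE; apply/eqP; apply: (M_const (F := F) gQi).
  by rewrite -[kappa _](subKr (hor kappa p u)); apply: M_B.
have : (size [seq sigma i a | i <- enum 'I_4] < size p)%N.
  apply: max_poly_roots => //; first by apply/allP => _ /mapP[i _ ->].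
  by rewrite map_inj_uniq ?enum_uniq //; apply: sinj; apply: gen.
by rewrite size_map size_enum_ord => h; have := leq_trans h sp.
Qed.

End MainArgument.

Theorem theorem1p3 (C : proj_scheme) (g : nat) (hC : hyperelliptic C)
  (hg : genus C g) (hg23 : g = 2 \/ g = 3) (hJ : jacobian_rat_trivial C) :
  (forall K : fieldExtType rat, \dim (fullv : {vspace K}) = 4 ->
     primitive_field K -> same_points C K) /\
  (exists K : nat -> fieldExtType rat,
     (forall i : nat,
        [/\ \dim (fullv : {vspace K i}) = 4, imprimitive_field (K i)
          & ~ same_points C (K i)]) /\
     (forall i j : nat, i <> j -> ~ isomorphic_fields (K i) (K j))).
Proof.
have [F [[D [l [dD dimD genD]]] _]] := hg.
(* The divisor that attains the genus is the starting point for the bound on L(k (P1 + P2)). *)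
have genD2 : (2 <= freeg.deg D + 1 - l%:Z)%R by rewrite genD; case: hg23 => ->.
have [[_ _ hS] _ _] := hC.
have [u [delta [r [s rf]]]] := hyperelliptic_model F hC.
have [eps eeps] := algC_sqrt (ratr delta).
have [P1 hP1 _] := rf_point rf (rho := (ratr : {rmorphism rat -> algC})) eeps.
have eeps' : ((- eps) ^+ 2 = ratr delta)%R by rewrite GRing.sqrrN.
have [P2 hP2 _] := rf_point rf (rho := (ratr : {rmorphism rat -> algC})) eeps'.
split=> [K dimK prim|].
  exact: (primitive_same_points hS hJ rf dD dimD genD2 eeps hP1 hP2 dimK prim).
have irr := eps_irrational hS hJ rf dD dimD genD2 eeps hP1 hP2.
have [K [hK nK]] := biquadratic_fields eeps irr (rf_delta rf).
exists K; split=> // i; have [dK iK [e ee ne]] := hK i; split => //.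
exact: (eps_point_not_rational rf ee ne).
Qed.
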